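(* Let $\alpha>-1$ and $\rho>0$. Assume that $f$ is analytic within and on the parabola $P_\rho$ and that, for some $\beta\in\mathbb{R}$ and some constant $C>0$, $|f(z)|\le C|z|^{\beta}$ as $z\to\infty$ in $D_\rho$. Then both $$|I(f)-Q_n^{G}(f)|\le\mathcal{K}_n\,e^{-4\rho\sqrt{n}}\qquad\text{and}\qquad|I(f)-Q_n^{R}(f)|\le\mathcal{K}_n\,e^{-4\rho\sqrt{n}},$$ where the $\mathcal{K}_n>0$ are bounded uniformly in $n$ and $\mathcal{K}_n\to\int_{P_\rho}\left|e^{-z}(-z)^{\alpha+1/2}f(z)\right|\mathrm{d}s$ as $n\to\infty$.
   Context: $\mathbb{R}_+=[0,\infty)$. For $z\in\mathbb{C}\setminus\mathbb{R}_+$, $\sqrt{-z}$ and $(-z)^{p}$ denote the branches with cut along the positive real axis that are real and positive for $z<0$. $P_\rho=\{z\in\mathbb{C}:\Re(\sqrt{-z})=\rho\}$ is a parabola opening to the right with vertex $-\rho^2$ and focus $0$, and $D_\rho=\{z\in\mathbb{C}:\Re(\sqrt{-z})<\rho\}$ is its interior (which contains $\mathbb{R}_+$). ''Analytic within and on $P_\rho$'' means analytic in a neighbourhood of $D_\rho\cup P_\rho$. $\mathrm{d}s$ is the differential of arc length. With $\omega_\alpha(x)=x^\alpha e^{-x}$, $I(f)=\int_{\mathbb{R}_+}\omega_\alpha(x)f(x)\,\mathrm{d}x$. An interpolatory quadrature rule with $n+1$ nodes is $Q_n(f)=\sum_{k=0}^{n}w_kf(x_k)$, exact for all polynomials of degree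 at most $n$. $Q_n^{G}(f)$ is the $(n+1)$-point Gauss-Laguerre rule (nodes the zeros of the generalized Laguerre polynomial $L_{n+1}^{(\alpha)}$; exact, with respect to $\omega_\alpha$, for polynomials of degree at most $2n+1$). $Q_n^{R}(f)$ is the $(n+1)$-point Gauss-Laguerre-Radau rule with preassigned node $x_0=0$ (nodes the zeros of $xL_n^{(\alpha+1)}(x)$; exact for polynomials of degree at most $2n$). Here $L_k^{(\alpha)}(x)=\frac{(\alpha+1)_k}{k!}\sum_{j=0}^{k}\frac{(-k)_j}{(\alpha+1)_j}\frac{x^j}{j!}$, with $(z)_j$ the Pochhammer symbol. *)

(* Defs.v *)
From HB Require Import structures.
From mathcomp Require Import all_boot all_order all_algebra.
From mathcomp Require Import complex.
From mathcomp Require Import all_classical all_reals all_analysis.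
From mathcomp Require Import ring lra.

Set Implicit Arguments.
Unset Strict Implicit.
Unset Printing Implicit Defensive.

Import Order.TTheory GRing.Theory Num.Theory.
Import numFieldNormedType.Exports.
Import Normc.

Local Open Scope classical_set_scope.
Local Open Scope ring_scope.
Local Open Scope complex_scope.

(* Num.Theory's Re and Im are valued in R[i]; these are valued in R. *)
Local Notation Re := (@complex.Re _).
Local Notation Im := (@complex.Im _).

Definition cexp (R : realType) (z : R[i]) : R[i] :=
  (expR (Re z) * cos (Im z)) +i* (expR (Re z) * sin (Im z)).

(* The principal argument, with values in ]-pi, pi] (junk value at 0). *)
Definition carg (R : realType) (z : R[i]) : R :=
  if 0 <= Im z then acos (Re z / normc z) else - acos (Re z / normc z).

(* The principal power |z|^p e^(i p arg z), with cut along the negative real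
   axis: cpow (- z) p has its cut along the positive real axis and is real and
   positive for z < 0.  The library's sqrtc is the principal square root, with
   the same cut. *)
Definition cpow (R : realType) (z : R[i]) (p : R) : R[i] :=
  (normc z `^ p * cos (p * carg z)) +i* (normc z `^ p * sin (p * carg z)).

(* R[i]^o is R[i] as a normed space over itself, so that derivability in the
   direction 1 is complex differentiability. *)
Definition analytic_near (R : realType) (f : R[i] -> R[i]) (S : set R[i]) :=
  exists U : set R[i]^o, [/\ open U, S `<=` U &
    forall z, U z -> derivable (f : R[i]^o -> R[i]^o) z 1].

Definition parabola (R : realType) (rho : R) : set R[i] :=
  [set z | Re (sqrtc (- z)) = rho].

(* On the cut, sqrtc (- z) is purely imaginary: this set contains [0, +oo[. *)
Definition parabola_interior (R : realType) (rho : R) : set R[i] :=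
  [set z | Re (sqrtc (- z)) < rho].

(* Parametrization of the parabola by t = Im (sqrt (- z)). *)
Definition parabola_path (R : realType) (rho t : R) : R[i] :=
  - (rho +i* t) ^+ 2.

Definition path_speed (R : realType) (gamma : R -> R[i]) (t : R) : R :=
  normc (derive1 (Re \o gamma) t +i* derive1 (Im \o gamma) t).

Definition arc_length_integral (R : realType) (gamma : R -> R[i])
    (g : R[i] -> R) : \bar R :=
  (\int[lebesgue_measure]_t (g (gamma t) * path_speed gamma t)%:E)%E.

Definition laguerre_weight (R : realType) (alpha x : R) : R :=
  x `^ alpha * expR (- x).

Definition laguerre_integral (R : realType) (alpha : R) (f : R[i] -> R[i])
    : R[i] :=
  (\int[lebesgue_measure]_(x in `[0, +oo[)
     (laguerre_weight alpha x * Re (f x%:C))) +i*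
  (\int[lebesgue_measure]_(x in `[0, +oo[)
     (laguerre_weight alpha x * Im (f x%:C))).

Definition pochhammer (R : realType) (z : R) (j : nat) : R :=
  \prod_(i < j) (z + i%:R).

Definition laguerre (R : realType) (k : nat) (alpha : R) : {poly R} :=
  (pochhammer (alpha + 1) k / k`!%:R) *:
  \poly_(j < k.+1)
    (pochhammer (- k%:R) j / pochhammer (alpha + 1) j / j`!%:R).

Definition quadrature (R : realType) (n : nat) (x w : 'I_n.+1 -> R)
    (f : R[i] -> R[i]) : R[i] :=
  \sum_(k < n.+1) (w k)%:C * f (x k)%:C.

Definition interpolatory (R : realType) (alpha : R) (n : nat)
    (x w : 'I_n.+1 -> R) : Prop :=
  injective x /\
  forall p : {poly R[i]}, (size p <= n.+1)%N ->
    laguerre_integral alpha (horner p) = quadrature x w (horner p).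

(* The n + 1 distinct nodes are all the zeros of the polynomial, which has
   degree n + 1; the weights are determined by exactness in degree at most n. *)
Definition gauss_laguerre_rule (R : realType) (alpha : R) (n : nat)
    (x w : 'I_n.+1 -> R) : Prop :=
  interpolatory alpha x w /\ forall k, root (laguerre n.+1 alpha) (x k).

Definition gauss_laguerre_radau_rule (R : realType) (alpha : R) (n : nat)
    (x w : 'I_n.+1 -> R) : Prop :=
  [/\ interpolatory alpha x w, x ord0 = 0 &
      forall k, root ('X * laguerre n (alpha + 1)) (x k)].

Lemma parabola_path_inj (R : realType) (rho : R) :
  0 < rho -> injective (parabola_path rho).
Proof.
move=> rho0 s t /oppr_inj; rewrite !expr2 /= => -[_].
rewrite [s * rho]mulrC [t * rho]mulrC -!mulrDr => /(mulfI (lt0r_neq0 rho0)).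
lra.
Qed.

Lemma parabola_pathE (R : realType) (rho : R) :
  0 < rho -> range (parabola_path rho) = parabola rho.
Proof.
move=> rho0; rewrite eqEsubset; split => [_ [t _ <-]|z] /=; last first.
  move=> zrho; exists (Im (sqrtc (- z))) => //.
  rewrite /parabola_path -[RHS]opprK -[in RHS](sqr_sqrtc (- z)).
  by rewrite -zrho; case: (sqrtc _).
change (Re (sqrtc (- - (rho +i* t) ^+ 2)) = rho); rewrite opprK.
have : sqrtc ((rho +i* t) ^+ 2) ^+ 2 == (rho +i* t) ^+ 2 by rewrite sqr_sqrtc.
rewrite eqf_sqr => /orP[/eqP -> //|/eqP h].
have : 0 <= Re (sqrtc ((rho +i* t) ^+ 2)).
  by case: ((_ +i* _) ^+ 2) => a b /=; exact: sqrtr_ge0.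
by rewrite h /= oppr_ge0 leNgt rho0.
Qed.

(* Main.v *)
Require Import Defs.
From HB Require Import structures.
From mathcomp Require Import all_boot all_order all_algebra.
From mathcomp Require Import complex.
From mathcomp Require Import all_classical all_reals all_analysis.
From mathcomp Require Import measurable_realfun.
From mathcomp Require Import ring lra.
Set Implicit Arguments.
Unset Strict Implicit.
Unset Printing Implicit Defensive.
Import Order.TTheory GRing.Theory Num.Theory.
Import numFieldNormedType.Exports.
Import Normc.
Local Open Scope classical_set_scope.
Local Open Scope ring_scope.
Local Open Scope complex_scope.

(** The substitution z = -s^2 turns the closed parabolic region into the strip |Re s| <= rho, and
    the parabola into the line Re s = rho; s and -s give the same z. Both rules are treated at once,
    with e = 0 for Gauss and e = 1 for Radau: the nodes are the zeros of x^e L_N, where N + e = n +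
    1 and L_N has parameter b = alpha + e, hence is orthogonal for the weight x^e omega_alpha.

    Let p = x^e L_N^2. The Hermite interpolant H of f at the zeros of p, counted with multiplicity,
    has degree < 2N + e. It agrees with f at the nodes and the rule integrates it exactly, so the
    error is the integral of omega_alpha (f - H) ([rule_error]). Cauchy's formula on a rectangle of
    the s-plane gives, for x >= 0, f(x) - H(x) = p(x) / (4 pi i) times the contour integral of
    f(-s^2) 2s / (p(-s^2) (s^2 + x)) ds ([hermite_remainder]); its horizontal sides recede to
    infinity.

    Two estimates of L_N(-s^2) are needed. Along a line Re s = r, |L_N(-(r+it)^2)|^2 is at least C
    (1 + t^2)^m L_N(-r^2)^2 with C independent of t and of large N ([strip_mod_growth]). Hence the
    polynomial growth of f is harmless and the line contributes at most a constant times x^e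
    L_N(x)^2 / (L_N(-r^2)^2 (x + r^2)). Integrated against omega_alpha, this becomes
    [laguerre_resolvent] divided by L_N(-r^2)^2, which is O(e^{-4 r sqrt N})
    ([laguerre_resolvent_bound]): orthogonality writes this quotient as a telescoping sum whose
    terms are controlled by the growth of L_k(-r^2) in k ([laguerre_sq_growth]). Both growth
    estimates come from the Riccati equation of the logarithmic derivative of s |-> L_N(-s^2), on
    the real axis ([laguerre_ld_asymp]) and on vertical lines ([strip_riccati], [strip_A_lower]).

    As for the constant, f is analytic slightly beyond the parabola, with a margin that may shrink
    at infinity. Given eps, the part |Im s| >= T0 of the contour stays on Re s = rho and contributes
    at most a fraction eps of the bound. The compact part |Im s| <= T0 moves to a line Re s = r'
    with r' > rho, where it contributes only O(e^{-4 r' sqrt N}) ([contour_error]). Thus the error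
    is o(e^{-4 rho sqrt n}) ([rule_error_littleo]), and K_n is taken to be the arc length integral,
    finite by [arc_length_integral_fin], plus a positive null sequence that bounds both errors
    multiplied by e^{4 rho sqrt n}. *)

(** * Laguerre polynomials: coefficients, signs, differential equation *)

Lemma pochhammer0 (R : realType) (z : R) : pochhammer z 0 = 1.
Proof. by rewrite /pochhammer big_ord0. Qed.

Lemma pochhammerS (R : realType) (z : R) j :
  pochhammer z j.+1 = pochhammer z j * (z + j%:R).
Proof. by rewrite /pochhammer big_ord_recr. Qed.

Lemma pochhammer_gt0 (R : realType) (z : R) j : 0 < z -> 0 < pochhammer z j.
Proof.
by move=> z0; apply: prodr_gt0 => i _; apply: ltr_wpDr => //; exact: ler0n.
Qed.

Lemma pochhammerN_gt (R : realType) n j : (n < j)%N ->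
  pochhammer (- n%:R : R) j = 0.
Proof.
move=> nj; rewrite /pochhammer (bigD1 (Ordinal nj)) //=.
by rewrite addrC subrr mul0r.
Qed.

Lemma pochhammerN_succ (R : realType) n j :
  (n.+1%:R - j%:R) * pochhammer (- n.+1%:R : R) j
  = n.+1%:R * pochhammer (- n%:R) j.
Proof.
elim: j => [|j IH]; first by rewrite !pochhammer0 subr0.
rewrite !pochhammerS [RHS]mulrA -IH -!natr1; ring.
Qed.

Lemma pochhammerN_diag (R : realType) n :
  pochhammer (- n%:R : R) n = (-1) ^+ n * n`!%:R.
Proof.
elim: n => [|n IH]; first by rewrite pochhammer0 mulr1.
have E : forall j, pochhammer (- n.+1%:R : R) j.+1
    = - n.+1%:R * pochhammer (- n%:R) j.
  move=> j; rewrite /pochhammer big_ord_recl /= addr0; congr (_ * _).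
  by apply: eq_bigr => i _; rewrite /= /bump /= -[n.+1%:R]natr1 -[(1 + i)%:R]/((i.+1)%:R) -natr1; ring.
by rewrite E IH factS natrM exprS; ring.
Qed.

Lemma coef_laguerre (R : realType) n (a : R) j :
  (laguerre n a)`_j = pochhammer (a + 1) n / n`!%:R *
    (pochhammer (- n%:R) j / pochhammer (a + 1) j / j`!%:R).
Proof.
rewrite /laguerre coefZ coef_poly; case: ltnP => // nj.
by rewrite pochhammerN_gt // !mul0r !mulr0.
Qed.

Lemma natr_fact_neq0 (R : realType) n : n`!%:R != 0 :> R.
Proof. by rewrite pnatr_eq0 -lt0n fact_gt0. Qed.

(** The Laguerre differential equation read coefficient by coefficient. It also yields the
    alternating signs and, through Vieta, the sum of the zeros. *)
Lemma coef_laguerre_rec (R : realType) n (a : R) j : -1 < a ->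
  (laguerre n a)`_j.+1 * (j.+1%:R * (a + 1 + j%:R))
  = (j%:R - n%:R) * (laguerre n a)`_j.
Proof.
move=> a1; rewrite !coef_laguerre !pochhammerS factS natrM.
have h1 : pochhammer (a + 1) j != 0 by rewrite gt_eqF// pochhammer_gt0//; lra.
have h2 : a + 1 + j%:R != 0.
  by rewrite gt_eqF//; have := ler0n R j; move: (j%:R : R) => u; lra.
have h3 : j.+1%:R != 0 :> R by rewrite pnatr_eq0.
have := natr_fact_neq0 R j; have := natr_fact_neq0 R n => h4 h5.
by field; rewrite h1 h2 h4 h5 nat1r h3.
Qed.

(** Coefficientwise form of x L_{n+1}' = (n+1) L_{n+1} - (n+1+a) L_n, kept free of division so that
    [j = n.+1] is covered. *)
Lemma coef_laguerre_succ (R : realType) n (a : R) j : -1 < a ->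
  (n.+1%:R - j%:R) * (laguerre n.+1 a)`_j
  = (n.+1%:R + a) * (laguerre n a)`_j.
Proof.
move=> a1; rewrite !coef_laguerre pochhammerS factS natrM.
have h1 : pochhammer (a + 1) j != 0 by rewrite gt_eqF// pochhammer_gt0//; lra.
have h3 : n.+1%:R != 0 :> R by rewrite pnatr_eq0.
have := natr_fact_neq0 R j; have := natr_fact_neq0 R n => h4 h5.
have := pochhammerN_succ R n j; move: (pochhammer (- n%:R) j) => u.
move: (pochhammer (- n.+1%:R) j) => v H.
transitivity (pochhammer (a + 1) n * (a + 1 + n%:R) / (n.+1%:R * n`!%:R)
  * (((n.+1%:R - j%:R) * v) / pochhammer (a + 1) j / j`!%:R)).
  by field; rewrite ?h1 ?h4 ?h5 ?nat1r ?natr1 ?h3.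
by rewrite H -natr1;
   field; rewrite ?h1 ?h4 ?h5 ?nat1r ?natr1 ?h3.
Qed.

Lemma coef_laguerre_diag (R : realType) n (a : R) : -1 < a ->
  (laguerre n a)`_n = (-1) ^+ n / n`!%:R.
Proof.
move=> a1; rewrite coef_laguerre pochhammerN_diag.
have h1 : pochhammer (a + 1) n != 0 by rewrite gt_eqF// pochhammer_gt0//; lra.
have := natr_fact_neq0 R n => h4.
by field; rewrite h1 h4.
Qed.

Lemma coef_laguerre_gt (R : realType) n (a : R) j : (n < j)%N ->
  (laguerre n a)`_j = 0.
Proof. by move=> nj; rewrite coef_laguerre pochhammerN_gt// !mul0r !mulr0. Qed.

Lemma signr_neq0 (R : realType) n : (-1) ^+ n != 0 :> R.
Proof. by rewrite expf_neq0// oppr_eq0 oner_eq0. Qed.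

Lemma size_laguerre (R : realType) n (a : R) : -1 < a ->
  size (laguerre n a) = n.+1.
Proof.
move=> a1; apply/eqP; rewrite eqn_leq; apply/andP; split.
  by apply/leq_sizeP => j; exact: coef_laguerre_gt.
rewrite ltnNge; apply/negP => /leq_sizeP/(_ n (leqnn n))/eqP.
by rewrite coef_laguerre_diag// mulf_eq0 invr_eq0 (negbTE (natr_fact_neq0 _ _)) (negbTE (signr_neq0 _ _)).
Qed.

(** Alternating signs make the value at [- u], [u >= 0], a sum of nonnegative terms: the source of
    positivity and monotonicity on the negative axis. *)
Lemma coef_laguerre_sign (R : realType) n (a : R) j : -1 < a ->
  0 <= (-1) ^+ j * (laguerre n a)`_j.
Proof.
move=> a1; elim: j => [|j IH].
  rewrite expr0 mul1r coef_laguerre !pochhammer0 !divr1 mulr1.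
  by rewrite divr_ge0 ?ler0n// ltW// pochhammer_gt0//; lra.
have [nj|nj] := leqP n j; first by rewrite coef_laguerre_gt ?mulr0.
have D : 0 < j.+1%:R * (a + 1 + j%:R).
  by rewrite mulr_gt0 ?ltr0n//; have := ler0n R j; move: (j%:R : R) => u; lra.
rewrite -(pmulr_lge0 _ D) -mulrA coef_laguerre_rec// exprS.
have -> : -1 * (-1) ^+ j * ((j%:R - n%:R) * (laguerre n a)`_j) =
  (n%:R - j%:R) * ((-1) ^+ j * (laguerre n a)`_j) by ring.
by rewrite mulr_ge0// subr_ge0 ler_nat ltnW.
Qed.

Lemma laguerre_ode (R : realType) n (a : R) : -1 < a ->
  'X * (laguerre n a)^`()^`() + ((a + 1)%:P - 'X) * (laguerre n a)^`()
    + n%:R *: laguerre n a = 0.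
Proof.
move=> a1; apply/polyP => j.
rewrite mulrBl !coefD coefN coefXM coefCM coefXM coefZ coef0 !coef_deriv.
case: j => [|j] /=.
  have := coef_laguerre_rec n 0 a1; rewrite addr0 mulr1n mul1r => H.
  rewrite add0r subr0 mulr1n [_ * _`_1]mulrC H; ring.
have := coef_laguerre_rec n j.+1 a1 => H.
have -> : n%:R * (laguerre n a)`_j.+1 =
   j.+1%:R * (laguerre n a)`_j.+1 - (j.+1%:R - n%:R) * (laguerre n a)`_j.+1.
  by ring.
rewrite -H -!natr1; ring.
Qed.

Lemma laguerre_deriv_succ (R : realType) n (a : R) : -1 < a ->
  'X * (laguerre n.+1 a)^`() =
  n.+1%:R *: laguerre n.+1 a - (n.+1%:R + a) *: laguerre n a.
Proof.
move=> a1; apply/polyP => j; rewrite coefXM coefB [in RHS]coefZ [X in _ - X]coefZ -coef_laguerre_succ//.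
case: j => [|j] /=; first by rewrite subr0 subrr.
by rewrite coef_deriv -[_ *+ _]mulr_natr; ring.
Qed.

Lemma laguerre0 (R : realType) (a : R) : laguerre 0 a = 1.
Proof.
apply/polyP => j; rewrite coef1 coef_laguerre; case: j => [|j].
  by rewrite !pochhammer0 !divr1 mulr1.
by rewrite pochhammerN_gt// !mul0r mulr0.
Qed.

(** * Real derivatives, monotonicity, and a damped differential equation *)

(* Unlike [is_derive], not a class: it is never inferred behind one's back. *)
Definition deriv_at (R : realType) (f : R -> R) (x df : R) : Prop :=
  is_derive x 1 f df.

Lemma drv_eq (R : realType) (f : R -> R) (x df df' : R) :
  deriv_at f x df -> df = df' -> deriv_at f x df'.
Proof. by move=> ? <-. Qed.

Lemma drv_id (R : realType) (x : R) : deriv_at (fun y => y) x 1.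
Proof. exact: is_derive_id. Qed.

Lemma drvD (R : realType) (f g : R -> R) (x df dg : R) :
  deriv_at f x df -> deriv_at g x dg ->
  deriv_at (fun y => f y + g y) x (df + dg).
Proof. by move=> ? ?; exact: is_deriveD. Qed.

Lemma drvN (R : realType) (f : R -> R) (x df : R) :
  deriv_at f x df -> deriv_at (fun y => - f y) x (- df).
Proof. by move=> ?; exact: is_deriveN. Qed.

Lemma drvB (R : realType) (f g : R -> R) (x df dg : R) :
  deriv_at f x df -> deriv_at g x dg ->
  deriv_at (fun y => f y - g y) x (df - dg).
Proof. by move=> ? ?; apply: drvD => //; exact: drvN. Qed.

Lemma drvM (R : realType) (f g : R -> R) (x df dg : R) :
  deriv_at f x df -> deriv_at g x dg ->
  deriv_at (fun y => f y * g y) x (df * g x + f x * dg).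
Proof.
move=> hf hg; apply: (is_derive_eq (is_deriveM hf hg)).
by rewrite addrC /GRing.scale /= mulrC.
Qed.

Lemma drvC (R : realType) (c x : R) : deriv_at (fun _ => c) x 0.
Proof. exact: is_derive_cst. Qed.

Lemma drvZ (R : realType) (f : R -> R) (x c df : R) :
  deriv_at f x df -> deriv_at (fun y => c * f y) x (c * df).
Proof.
by move=> h; apply: (drv_eq (drvM (drvC c x) h)); rewrite mul0r add0r.
Qed.

Lemma drvV (R : realType) (f : R -> R) (x df : R) : f x != 0 ->
  deriv_at f x df -> deriv_at (fun y => (f y)^-1) x (- df / f x ^+ 2).
Proof.
move=> fx0 [hd hv]; apply: DeriveDef; first exact: derivableV.
by rewrite deriveV// hv /GRing.scale /=; ring.
Qed.

Lemma drvQ (R : realType) (f g : R -> R) (x df dg : R) : g x != 0 ->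
  deriv_at f x df -> deriv_at g x dg ->
  deriv_at (fun y => f y / g y) x ((df * g x - f x * dg) / g x ^+ 2).
Proof.
move=> gx0 hf hg; apply: (drv_eq (drvM hf (drvV gx0 hg))).
by field.
Qed.

Lemma drv_comp (R : realType) (f g : R -> R) (x df dg : R) :
  deriv_at f (g x) df -> deriv_at g x dg ->
  deriv_at (fun y => f (g y)) x (df * dg).
Proof. move=> hf hg; exact: (@is_derive1_comp R f g x df dg hf hg). Qed.

Lemma drv_exp (R : realType) (g : R -> R) (x dg : R) :
  deriv_at g x dg ->
  deriv_at (fun y => expR (g y)) x (expR (g x) * dg).
Proof. by move=> hg; apply: drv_comp => //; exact: is_derive_expR. Qed.

Lemma drv_X (R : realType) (g : R -> R) (x dg : R) n :
  deriv_at g x dg ->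
  deriv_at (fun y => g y ^+ n) x (n%:R * g x ^+ n.-1 * dg).
Proof.
move=> hg; have -> : (fun y => g y ^+ n) = g ^+ n by apply/funext => y; rewrite exprfctE.
exact: is_deriveX.
Qed.

Lemma derive_continuous (R : realType) (f : R -> R) (x df : R) :
  deriv_at f x df -> {for x, continuous f}.
Proof.
by move=> [h _]; apply/differentiable_continuous/derivable1_diffP.
Qed.

Lemma derive_within_continuous (R : realType) (f df : R -> R) (a b : R) :
  (forall x, x \in `[a, b] -> deriv_at f x (df x)) ->
  {within `[a, b], continuous f}.
Proof.
move=> H; apply: continuous_in_subspaceT => x; rewrite inE => /= hx.
exact: derive_continuous (H x hx).
Qed.

Lemma derive_ge0_le (R : realType) (f df : R -> R) (a b : R) : a <= b ->
  (forall x, a <= x <= b -> deriv_at f x (df x)) ->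
  (forall x, a <= x <= b -> 0 <= df x) -> f a <= f b.
Proof.
move=> ab H H0.
have [||c hc E] := @MVT_segment R f df a b ab.
- by move=> x /[!in_itv]/= /andP[h1 h2]; apply: H; rewrite !ltW.
- by apply: (derive_within_continuous (df := df)) => x hx; apply: H; rewrite in_itv in hx.
- rewrite -subr_ge0 E mulr_ge0 ?subr_ge0// H0//; by rewrite in_itv in hc.
Qed.

Lemma derive_le0_le (R : realType) (f df : R -> R) (a b : R) : a <= b ->
  (forall x, a <= x <= b -> deriv_at f x (df x)) ->
  (forall x, a <= x <= b -> df x <= 0) -> f b <= f a.
Proof.
move=> ab H H0; rewrite -lerN2.
apply: (derive_ge0_le (f := fun x => - f x) (df := fun x => - df x) ab).
  by move=> x hx; apply: drvN; exact: H.
by move=> x hx; rewrite oppr_ge0; exact: H0.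
Qed.

(* [(e^2 - (c/w)^2) e^(w s)] is nonincreasing. *)
Lemma damped_ode_bound (R : realType) (e c k : R -> R) (c0 w s0 s1 : R) :
  s0 <= s1 -> 0 < w ->
  (forall s, s0 <= s <= s1 -> deriv_at e s (c s - e s * k s)) ->
  (forall s, s0 <= s <= s1 -> `|c s| <= c0) ->
  (forall s, s0 <= s <= s1 -> w <= k s) ->
  e s1 ^+ 2 <= (c0 / w) ^+ 2 + e s0 ^+ 2 * expR (- (w * (s1 - s0))).
Proof.
move=> s01 w0 de hc hk.
have := @derive_le0_le R (fun s => (e s ^+ 2 - (c0 / w) ^+ 2) * expR (w * s))
  (fun s => (2 * e s * (c s - e s * k s) + w * (e s ^+ 2 - (c0 / w) ^+ 2))
     * expR (w * s)) s0 s1 s01.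
have H1 : forall s, s0 <= s <= s1 ->
  deriv_at (fun s => (e s ^+ 2 - (c0 / w) ^+ 2) * expR (w * s)) s
   ((2 * e s * (c s - e s * k s) + w * (e s ^+ 2 - (c0 / w) ^+ 2))
     * expR (w * s)).
  move=> s hs; apply: drv_eq.
    apply: drvM; last by apply: drv_exp; apply: drvZ; exact: drv_id.
    by apply: drvB; [apply: drv_X; exact: de|exact: drvC].
  by rewrite /= expr1; ring.
move=> /(_ H1) H2.
have {H2} : (e s1 ^+ 2 - (c0 / w) ^+ 2) * expR (w * s1) <=
            (e s0 ^+ 2 - (c0 / w) ^+ 2) * expR (w * s0).
  apply: H2 => s hs; rewrite pmulr_lle0 ?expR_gt0//.
  have c00 : 0 <= c0 by apply: le_trans (hc s hs).
  (* Young's inequality. The damping supplies [- 2 * k s * e s ^+ 2]; one half of it pays for the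
     forcing [c], the other for the derivative of the weight [expR (w * s)]. *)
  have h1 : 2 * (e s * c s) <= w * e s ^+ 2 + w * (c0 / w) ^+ 2.
    have h : c s ^+ 2 <= c0 ^+ 2.
      by rewrite -[leLHS]real_normK ?num_real// ler_sqr ?nnegrE// hc.
    have -> : w * e s ^+ 2 + w * (c0 / w) ^+ 2 = 2 * (e s * c s) +
       ((w * e s - c s) ^+ 2 + (c0 ^+ 2 - c s ^+ 2)) / w.
      by field; lra.
    rewrite lerDl; apply: divr_ge0; last exact: ltW.
    by rewrite addr_ge0 ?sqr_ge0// subr_ge0.
  have h2 : w * e s ^+ 2 <= k s * e s ^+ 2.
    by apply: ler_wpM2r; [exact: sqr_ge0|exact: hk].
  move: h1 h2; rewrite !expr2; nra.
rewrite -ler_pdivlMr ?expR_gt0// -expRN -mulrA -expRD.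
have -> : w * s0 - w * s1 = - (w * (s1 - s0)) by ring.
move=> H; have h : 0 <= (c0 / w) ^+ 2 * expR (- (w * (s1 - s0))).
  by rewrite mulr_ge0 ?sqr_ge0 ?expR_ge0.
move: H h; set X := expR _; set Y := (c0 / w) ^+ 2; lra.
Qed.

(** * Laguerre polynomials on the negative axis and their growth in n *)

(** In the variable s = sqrt(-z) the parabola is the line Re s = rho, and real s stand for points of
    the negative axis. *)
Definition laguerre_sq (R : realType) n (a : R) : {poly R} :=
  laguerre n a \Po (- 'X^2).

Lemma horner_laguerre_sq (R : realType) n (a s : R) :
  (laguerre_sq n a).[s] = (laguerre n a).[- s ^+ 2].
Proof. by rewrite /laguerre_sq horner_comp hornerN hornerXn. Qed.

Lemma deriv_laguerre_sq (R : realType) n (a : R) :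
  (laguerre_sq n a)^`() = - (2 *: 'X) * ((laguerre n a)^`() \Po (- 'X^2)).
Proof.
by rewrite /laguerre_sq deriv_comp derivN derivXn mulrC scaler_nat.
Qed.

(** The Laguerre equation after z = -s^2, multiplied by [- 4 * 'X]. As an identity of polynomials it
    serves both for real s and for complex s on vertical lines. *)
Lemma laguerre_sq_ode (R : realType) n (a : R) : -1 < a ->
  'X * (laguerre_sq n a)^`()^`()
    + ((2 * a + 1)%:P + 2 *: 'X^2) * (laguerre_sq n a)^`()
  = (4 * n%:R) *: ('X * laguerre_sq n a).
Proof.
move=> a1; have := congr1 (fun p => p \Po (- 'X^2)) (laguerre_ode n a1).
rewrite /= comp_polyD comp_polyD !comp_polyM comp_polyB comp_polyX comp_polyC.
rewrite comp_polyZ comp_poly0 => H.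
rewrite !deriv_laguerre_sq derivM deriv_comp derivN derivZ derivX derivN derivXn.
rewrite /laguerre_sq -!mul_polyC.
move: H; rewrite -mul_polyC polyCD !polyCM !polyCD.
set p0 := laguerre n a \Po _; set p2 := _^`()^`() \Po _; set p1 := _^`() \Po _.
rewrite (polyCM 2 a) polyCD !polyC1 polyC_natr expr1 => H.
transitivity (- 4 * 'X * (- 'X^2 * p2 + (a%:P + 1 - - 'X^2) * p1 + n%:R * p0)
   + 4 * n%:R * ('X * p0) : {poly R}); first by ring.
by rewrite H mulr0 add0r; ring.
Qed.

Lemma horner_laguerreN_gt0 (R : realType) n (a u : R) : -1 < a -> 0 <= u ->
  0 < (laguerre n a).[- u].
Proof.
move=> a1 u0; rewrite horner_coef size_laguerre// big_ord_recl /= expr0 mulr1.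
apply: ltr_pwDl.
  rewrite coef_laguerre !pochhammer0 !divr1 mulr1.
  by rewrite divr_gt0 ?ltr0n ?fact_gt0// pochhammer_gt0//; lra.
apply: sumr_ge0 => i _; rewrite exprNn mulrA [_ * (-1) ^+ _]mulrC.
by rewrite mulr_ge0 ?exprn_ge0// coef_laguerre_sign.
Qed.

Lemma horner_deriv_laguerreN_le0 (R : realType) n (a u : R) :
  -1 < a -> 0 <= u -> (laguerre n a)^`().[- u] <= 0.
Proof.
move=> a1 u0; rewrite horner_coef -oppr_ge0 -sumrN.
apply: sumr_ge0 => i _; rewrite coef_deriv exprNn -mulr_natr.
have -> : - ((laguerre n a)`_i.+1 * i.+1%:R * ((-1) ^+ i * u ^+ i)) =
  ((-1) ^+ i.+1 * (laguerre n a)`_i.+1) * (i.+1%:R * u ^+ i).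
  by rewrite exprS; ring.
by rewrite mulr_ge0 ?coef_laguerre_sign// mulr_ge0 ?exprn_ge0 ?ler0n.
Qed.

Lemma laguerre_sq_gt0 (R : realType) n (a s : R) : -1 < a ->
  0 < (laguerre_sq n a).[s].
Proof.
by move=> a1; rewrite horner_laguerre_sq horner_laguerreN_gt0// sqr_ge0.
Qed.

Lemma deriv_laguerre_sq_ge0 (R : realType) n (a s : R) : -1 < a -> 0 <= s ->
  0 <= (laguerre_sq n a)^`().[s].
Proof.
move=> a1 s0; rewrite deriv_laguerre_sq hornerM hornerN hornerZ hornerX.
rewrite horner_comp hornerN hornerXn mulNr -mulrN mulr_ge0 ?mulr_ge0//.
by rewrite oppr_ge0 horner_deriv_laguerreN_le0// sqr_ge0.
Qed.

Lemma deriv_laguerre_sq_succ (R : realType) n (a s : R) : -1 < a ->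
  s / 2 * (laguerre_sq n.+1 a)^`().[s] =
  n.+1%:R * (laguerre_sq n.+1 a).[s] - (n.+1%:R + a) * (laguerre_sq n a).[s].
Proof.
move=> a1; have := congr1 (fun p => p.[- s ^+ 2]) (laguerre_deriv_succ n a1).
rewrite /= hornerD hornerN !(hornerZ _ (laguerre _ _)) hornerM hornerX.
rewrite -!horner_laguerre_sq => <-.
rewrite deriv_laguerre_sq hornerM hornerN hornerZ hornerX.
by rewrite horner_comp hornerN hornerXn; field.
Qed.

(** The relation [deriv_laguerre_sq_succ] without its positive last term. The bound, of order n, is
    crude; it provides the initial value for the damping argument in [laguerre_ld_asymp]. *)
Lemma deriv_laguerre_sq_le (R : realType) n (a s : R) : -1 < a ->
  s * (laguerre_sq n a)^`().[s] <= 2 * n%:R * (laguerre_sq n a).[s].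
Proof.
move=> a1; case: n => [|n].
  by rewrite /laguerre_sq laguerre0 comp_polyC derivC horner0 !(mulr0, mul0r).
have := deriv_laguerre_sq_succ n s a1.
have : 0 <= (n.+1%:R + a) * (laguerre_sq n a).[s].
  rewrite mulr_ge0// ?ltW ?laguerre_sq_gt0//.
  by rewrite -natr1; have := ler0n R n; move: (n%:R : R) => u; lra.
set X := (_ + a) * (laguerre_sq n a).[s]; set Y := _.[s]; set Z := _.[s].
by move: (n.+1%:R) => N; lra.
Qed.

(* The logarithmic derivative of [laguerre_sq n a] solves a Riccati equation. *)
Definition laguerre_ld (R : realType) n (a s : R) : R :=
  (laguerre_sq n a)^`().[s] / (laguerre_sq n a).[s].

Lemma laguerre_ld_ge0 (R : realType) n (a s : R) : -1 < a -> 0 <= s ->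
  0 <= laguerre_ld n a s.
Proof.
move=> a1 s0; apply: divr_ge0; first exact: deriv_laguerre_sq_ge0.
exact/ltW/laguerre_sq_gt0.
Qed.

Lemma laguerre_ld_le (R : realType) n (a s : R) : -1 < a -> 0 < s ->
  laguerre_ld n a s <= 2 * n%:R / s.
Proof.
move=> a1 s0; rewrite ler_pdivrMr ?laguerre_sq_gt0//.
rewrite mulrAC ler_pdivlMr// mulrC; exact: deriv_laguerre_sq_le.
Qed.

Lemma drv_laguerre_ld (R : realType) n (a s : R) : -1 < a -> 0 < s ->
  deriv_at (laguerre_ld n a) s
    (4 * n%:R - ((2 * a + 1) / s + 2 * s) * laguerre_ld n a s
       - laguerre_ld n a s ^+ 2).
Proof.
move=> a1 s0; have Q0 := laguerre_sq_gt0 n s a1.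
apply: drv_eq.
  apply: drvQ; [by rewrite gt_eqF|exact: is_derive_poly|exact: is_derive_poly].
have := congr1 (fun p => p.[s]) (laguerre_sq_ode n a1).
rewrite /= hornerD !hornerM hornerX hornerD hornerC !hornerZ hornerXn hornerM hornerX.
rewrite /laguerre_ld; move: Q0; set Q := _.[s]; set Q1 := _^`().[s].
set Q2 := _^`()^`().[s] => Q0 H.
have -> : Q2 = (4 * n%:R * (s * Q) - (2 * a + 1 + 2 * s ^+ 2) * Q1) / s.
  by rewrite -H; field; lra.
by field; rewrite !gt_eqF.
Qed.

Lemma sqrtn_ge (R : realType) (x : R) :
  exists n0, forall n, (n0 <= n)%N -> x <= Num.sqrt n%:R.
Proof.
exists (Num.truncn (x ^+ 2)).+1 => n hn.
rewrite (le_trans (ler_norm _))// -sqrtr_sqr ler_sqrt ?ler0n//.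
apply/ltW/(lt_le_trans (truncnS_gt _)).
by rewrite ler_nat.
Qed.

Lemma expRN_pow_le (R : realType) k : exists2 K : R, 0 < K &
  forall y, 0 <= y -> y ^+ k * expR (- y) <= K.
Proof.
exists (k.+1)`!%:R; first by rewrite ltr0n fact_gt0.
move=> y y0; rewrite expRN ler_pdivrMr ?expR_gt0//.
have K0 : 0 < (k.+1)`!%:R :> R by rewrite ltr0n fact_gt0.
have [y1|y1] := leP y 1.
  rewrite (le_trans (exprn_ile1 _ y0 y1))//.
  rewrite -[leLHS]mulr1 ler_pM ?ler01 ?ler1n ?fact_gt0//.
  by have := expR_ge1Dx y; lra.
have := expR_ge1Dxn k y0; move: (expR y) => E.
rewrite -lerBrDl ler_pdivrMr// mulrC => h.
rewrite (le_trans _ (le_trans h _))//.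
  by rewrite exprS ler_peMl ?exprn_ge0// ltW.
by rewrite ler_pM2l//; lra.
Qed.

(** With b(s) = (2a+1)/s + 2s, the Riccati equation has the approximate solution 2 sqrt n - b(s)/2.
    The deviation e from it satisfies e' = c - e k, where c is bounded independently of n and k >=
    sqrt n, so that an initial deviation of order n at [rho / 2] is damped to O(1 / sqrt n) at
    [rho]. *)
Lemma laguerre_ld_asymp (R : realType) (a rho : R) : -1 < a -> 0 < rho ->
  exists C : R, 0 <= C /\ exists n0, forall n, (n0 <= n)%N ->
    `|laguerre_ld n a rho
       - (2 * Num.sqrt n%:R - ((2 * a + 1) / rho + 2 * rho) / 2)|
    <= C / Num.sqrt n%:R.
Proof.
move=> a1 r0.
pose a0 := 2 * `|a| + 1.
have a00 : 0 < a0 by rewrite /a0; have := normr_ge0 a; lra.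
have ha0 : `|2 * a + 1| <= a0.
  have := ler_norm a; have := ler_norm (- a); rewrite normrN => h1 h2.
  by rewrite /a0 ler_norml; apply/andP; split; lra.
pose b (s : R) := (2 * a + 1) / s + 2 * s.
pose b0 := a0 * (2 / rho) + 2 * rho.
(* The defect of the approximate solution, [b ^+ 2 / 4] plus half the derivative of [b]. *)
pose c (s : R) := b s ^+ 2 / 4 + (- (2 * a + 1) / s ^+ 2 + 2) / 2.
pose c0 := b0 ^+ 2 / 4 + (a0 * (2 / rho) ^+ 2 + 2) / 2.
have hin s : rho / 2 <= s <= rho -> s^-1 <= 2 / rho /\ 0 < s.
  move=> /andP[h1 h2]; have s0 : 0 < s by lra.
  split=> //; rewrite ler_pdivlMr// mulrC ler_pdivrMr//; lra.
have hb s : rho / 2 <= s <= rho -> `|b s| <= b0.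
  move=> hs; have [h1 s0] := hin _ hs; case/andP: hs => hs1 hs2.
  rewrite /b /b0 (le_trans (ler_normD _ _))// lerD//.
    rewrite normrM; apply: ler_pM => //.
    by rewrite ger0_norm// invr_ge0 ltW.
  by rewrite ger0_norm//; lra.
have hc s : rho / 2 <= s <= rho -> `|c s| <= c0.
  move=> hs; have [h1 s0] := hin _ hs; have hb' := hb _ hs.
  rewrite /c /c0 (le_trans (ler_normD _ _))// lerD//.
    rewrite normrM [X in _ * X]gtr0_norm//.
    apply: ler_wpM2r; first by lra.
    by rewrite normrX lerXn2r ?nnegrE// (le_trans _ hb').
  rewrite normrM [X in _ * X]gtr0_norm//.
  apply: ler_wpM2r; first by lra.
  apply: (le_trans (ler_normD _ _)); apply: lerD; last by rewrite ger0_norm.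
  rewrite normrM normrN; apply: ler_pM => //.
  have i0 : 0 <= s^-1 by rewrite invr_ge0 ltW.
  by rewrite -exprVn normrX ger0_norm// lerXn2r ?nnegrE// (le_trans i0).
have b00 : 0 <= b0 by rewrite (le_trans _ (hb rho _))//; lra.
(* The squared initial deviation is of order [w ^+ 4], and two further powers of [w] are needed for
   the bound [C2 / w ^+ 2]. *)
have [k k0 hk] := expRN_pow_le R 6.
pose E1 := 4 / rho + 2 + b0.
pose C2 := c0 ^+ 2 + E1 ^+ 2 * (k * (2 / rho) ^+ 6).
have C20 : 0 <= C2.
  have h : 0 <= 2 / rho by rewrite divr_ge0// ltW.
  by rewrite addr_ge0 ?sqr_ge0// mulr_ge0 ?sqr_ge0// mulr_ge0 ?exprn_ge0 ?(ltW k0).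
exists (Num.sqrt C2); split; first exact: sqrtr_ge0.
have [n0 hn0] := sqrtn_ge (b0 + 1); exists n0 => n /hn0.
set w := Num.sqrt n%:R => hw.
have w0 : 0 < w by lra.
have nE : n%:R = w ^+ 2 :> R by rewrite sqr_sqrtr// ler0n.
pose e s := laguerre_ld n a s - (2 * w - b s / 2).
have H := @damped_ode_bound R e c (fun s => 2 * w + b s / 2 + laguerre_ld n a s)
  c0 w (rho / 2) rho _ w0 _ hc _.
rewrite -/(e rho); suff HH : e rho ^+ 2 <= C2 / w ^+ 2.
  rewrite -ler_sqr ?nnegrE ?divr_ge0 ?sqrtr_ge0 ?(ltW w0)//.
  by rewrite real_normK ?num_real// expr_div_n sqr_sqrtr.
apply: (le_trans (H _ _ _)).
- lra.
- move=> s hs; have [h1 s0] := hin _ hs.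
  apply: drv_eq.
    apply: drvB; first exact: drv_laguerre_ld.
    apply: drvB; first exact: drvC.
    apply: (@drvM _ b (fun _ => 2^-1)); last exact: drvC.
    apply: drvD; last by apply: drvZ; exact: drv_id.
    by apply: drvZ; apply: drvV; [rewrite gt_eqF|exact: drv_id].
  rewrite /e /c /b nE; field; lra.
- move=> s hs; have [h1 s0] := hin _ hs; have := hb _ hs.
  have := laguerre_ld_ge0 n a1 (ltW s0); rewrite ler_norml => h2 /andP[h3 _].
  lra.
have he : `|e (rho / 2)| <= E1 * w ^+ 2.
  have hr : rho / 2 <= rho / 2 <= rho by lra.
  have r20 : 0 < rho / 2 by lra.
  have w1 : 1 <= w by lra.
  have ww : w <= w ^+ 2 by rewrite expr2; nra.
  have hl := laguerre_ld_le n a1 r20; have hg := laguerre_ld_ge0 n a1 (ltW r20).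
  have hb2 := hb _ hr; rewrite /e /E1.
  have hl2 : `|laguerre_ld n a (rho / 2)| <= 4 / rho * w ^+ 2.
    by rewrite ger0_norm// (le_trans hl)// -nE le_eqVlt; apply/orP; left; apply/eqP; field; lra.
  have -> : (4 / rho + 2 + b0) * w ^+ 2 =
    4 / rho * w ^+ 2 + (2 * w ^+ 2 + b0 * w ^+ 2) by ring.
  apply: (le_trans (ler_normB _ _)); apply: lerD => //.
  apply: (le_trans (ler_normB _ _)); apply: lerD.
    by rewrite ger0_norm ?mulr_ge0 ?(ltW w0)//; lra.
  rewrite normrM [X in _ * X]gtr0_norm//.
  apply: ler_pM => //.
  have : (1 : R) <= w ^+ 2 by lra.
  lra.
have -> : w * (rho - rho / 2) = w * (rho / 2) by field.
have hy : 0 <= w * (rho / 2) by rewrite mulr_ge0//; lra.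
have := hk _ hy; move: (expR_ge0 (- (w * (rho / 2)))).
move: (expR _) => X X0; rewrite exprMn => HX.
rewrite expr_div_n /C2 mulrDl lerD2l.
have he2 : e (rho / 2) ^+ 2 <= (E1 * w ^+ 2) ^+ 2.
  by rewrite -[leLHS]real_normK ?num_real// lerXn2r ?nnegrE// (le_trans _ he).
rewrite (le_trans (ler_wpM2r X0 he2))// ler_pdivlMr ?exprn_gt0//.
have -> : (E1 * w ^+ 2) ^+ 2 * X * w ^+ 2 =
  E1 ^+ 2 * ((2 / rho) ^+ 6 * (w ^+ 6 * (rho / 2) ^+ 6 * X)) by field; lra.
apply: ler_wpM2l; first exact: sqr_ge0.
by rewrite [leRHS]mulrC ler_wpM2l ?exprn_ge0// divr_ge0// ltW.
Qed.

(** The second order term matters: this is applied with [d] of order 1 / sqrt n, and the terms d^2,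
    of order 1/n, have a divergent sum. *)
Lemma oneB_le_expR (R : realType) (d : R) : 0 <= d ->
  1 - d <= expR (- d - d ^+ 2 / 2).
Proof.
move=> d0; have E0 := expR_gt0 (d + d ^+ 2 / 2).
have -> : - d - d ^+ 2 / 2 = - (d + d ^+ 2 / 2) by ring.
rewrite expRN -[leRHS]mul1r ler_pdivlMr//.
have := @derive_le0_le R (fun d => (1 - d) * expR (d + d ^+ 2 / 2))
  (fun d => - d ^+ 2 * expR (d + d ^+ 2 / 2)) 0 d d0.
rewrite subr0 expr0n /= mul0r addr0 expR0 mulr1; apply.
- move=> x _; apply: drv_eq.
    apply: drvM; first by apply: drvB; [exact: drvC|exact: drv_id].
    apply: drv_exp; apply: drvD; first exact: drv_id.
    by apply: (@drvM _ (fun x => x ^+ 2) (fun _ => 2^-1));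
       [apply: drv_X; exact: drv_id|exact: drvC].
  by rewrite /= expr1; field.
- by move=> x _; rewrite mulNr oppr_le0 mulr_ge0 ?sqr_ge0 ?expR_ge0.
Qed.

(** For w = sqrt(n+1) and v = sqrt n, the left-hand side collects the logarithms of the factors by
    which the quotient studied in [laguerre_sq_growth] changes from n to n+1. The orders 1/w and
    1/w^2 cancel exactly, and O(1/w^3) remains, which is summable over n. *)
Lemma laguerre_exponent_bound (R : realType) (a rho C w v e b d K : R) :
  0 < rho -> 0 <= C -> 1 <= w -> 0 <= v -> w ^+ 2 = v ^+ 2 + 1 ->
  2 * `|a| <= w ^+ 2 -> `|e| <= C / w ->
  b = (2 * a + 1) / rho + 2 * rho ->
  d = rho * (2 * w - b / 2 + e) / (2 * w ^+ 2) ->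
  K = rho * C + 2 * rho * (`|rho * b| / 4 + rho * C / 2) + 2 * a ^+ 2
     + 2 * rho ->
  - 2 * d - d ^+ 2 - a / (w ^+ 2 + a) + 4 * rho * (w - v) - 1 / (2 * w ^+ 2)
   <= K / w ^+ 3.
Proof.
move=> r0 C0 w1 v0 wv aw he bE dE0 KE.
have w0 : 0 < w by lra.
pose i := w^-1; have i0 : 0 < i by rewrite invr_gt0.
have iw : i * w = 1 by rewrite mulVf// gt_eqF.
have i1 : i <= 1 by rewrite invf_le1.
pose kp := rho * b / 4 - rho * e / 2.
have rb : rho * b = 2 * a + 1 + 2 * rho ^+ 2 by rewrite bE; field; lra.
have dE : d = rho * i - kp * i ^+ 2 by rewrite dE0 /kp /i; field; lra.
have heC : `|e| <= C.
  by rewrite (le_trans he)// ler_pdivrMr// -[leLHS]mulr1 ler_wpM2l.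
have hkp : kp <= `|rho * b| / 4 + rho * C / 2.
  rewrite /kp; have := ler_norm (rho * b); have := ler_norm (- e).
  rewrite normrN => h1 h2; have : rho * - e <= rho * C by rewrite ler_pM2l//; lra.
  lra.
have hie : - (rho * e) <= rho * C * i.
  rewrite -mulrA -mulrN ler_pM2l//; have := ler_norm (- e); rewrite normrN.
  by move/le_trans; apply.
have wa : 0 < w ^+ 2 + a.
  have := ler_norm (- a); rewrite normrN; have : 1 <= w ^+ 2 by rewrite expr2; nra.
  lra.
have ha : - (a / (w ^+ 2 + a)) <= - a * i ^+ 2 + 2 * a ^+ 2 * i ^+ 4.
  have -> : - a * i ^+ 2 + 2 * a ^+ 2 * i ^+ 4 = - (a / (w ^+ 2 + a)) +
     a ^+ 2 * i ^+ 4 * (w ^+ 2 + 2 * a) / (w ^+ 2 + a).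
    by rewrite /i; field; rewrite !gt_eqF.
  rewrite lerDl; apply: divr_ge0; last exact: ltW.
  apply: mulr_ge0; first by rewrite (mulr_ge0 (sqr_ge0 _))// exprn_ge0// ltW.
  by have := ler_norm (- a); rewrite normrN; lra.
have hv : v <= w by rewrite -ler_sqr ?nnegrE ?(ltW w0)//; lra.
have wv0 : w + v != 0 by rewrite gt_eqF//; lra.
have hwv1 : w - v = (w + v)^-1.
  apply: (mulIf wv0); rewrite mulVf//.
  have -> : (w - v) * (w + v) = w ^+ 2 - v ^+ 2 by ring.
  by rewrite wv; ring.
have hwv : 4 * rho * (w - v) <= 2 * rho * i + 2 * rho * i ^+ 3.
  have -> : w - v = (w + v)^-1.
    exact: hwv1.
  have -> : 2 * rho * i + 2 * rho * i ^+ 3 = 4 * rho * (i / 2 + i ^+ 3 / 2).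
    by field.
  rewrite ler_pM2l ?mulr_gt0//.
  have -> : i / 2 + i ^+ 3 / 2 = (w + v)^-1 + (i ^+ 3 / 2 - i / 2 * (w - v) / (w + v)).
    by rewrite /i; field; rewrite !gt_eqF//; lra.
  rewrite lerDl subr_ge0 ler_pdivrMr; last by lra.
  have -> : i / 2 * (w - v) = i / 2 * (w + v)^-1.
    by rewrite hwv1.
  have -> : i ^+ 3 / 2 * (w + v) = i / 2 * (i ^+ 2 * (w + v)) by ring.
  rewrite ler_pM2l; last by lra.
  rewrite -[leLHS]mul1r ler_pdivrMr; last by lra.
  rewrite -mulrA -expr2 -exprMn -(expr1n _ 2) ler_sqr ?nnegrE//; last first.
    by rewrite mulr_ge0//; lra.
  by rewrite mulrDr iw lerDl mulr_ge0// ltW.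
have -> : - 2 * d - d ^+ 2 - a / (w ^+ 2 + a) + 4 * rho * (w - v) - 1 / (2 * w ^+ 2)
  = - (a / (w ^+ 2 + a)) + (4 * rho * (w - v)) + (- 2 * d - d ^+ 2) - i ^+ 2 / 2.
  by rewrite /i; field; rewrite !gt_eqF.
have -> : K / w ^+ 3 = rho * C * i ^+ 3 +
   2 * rho * (`|rho * b| / 4 + rho * C / 2) * i ^+ 3 + 2 * a ^+ 2 * i ^+ 3
     + 2 * rho * i ^+ 3 by rewrite KE /i; field; rewrite !gt_eqF.
have h4 : 2 * a ^+ 2 * i ^+ 4 <= 2 * a ^+ 2 * i ^+ 3.
  apply: ler_wpM2l; first by rewrite (mulr_ge0 _ (sqr_ge0 _)).
  by rewrite exprSr -[leRHS]mulr1 ler_wpM2l// exprn_ge0// ltW.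
have hd : - 2 * d - d ^+ 2 <= - 2 * rho * i + (2 * a + 1 + 2 * rho ^+ 2) / 2 * i ^+ 2
   + rho * C * i ^+ 3 - rho ^+ 2 * i ^+ 2 + 2 * rho * (`|rho * b| / 4 + rho * C / 2) * i ^+ 3.
  have h1 : 2 * rho * kp * i ^+ 3 <= 2 * rho * (`|rho * b| / 4 + rho * C / 2) * i ^+ 3.
    by rewrite ler_pM2r ?exprn_gt0// ler_pM2l// mulr_gt0.
  have h2 : - (rho * e) * i ^+ 2 <= rho * C * i ^+ 3.
    by rewrite (exprS i 2) [leRHS]mulrA ler_pM2r ?exprn_gt0.
  have h3 : 0 <= (kp * i ^+ 2) ^+ 2 by exact: sqr_ge0.
  have -> : - 2 * d - d ^+ 2 = - 2 * rho * i + (rho * b / 2) * i ^+ 2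
    - (rho * e) * i ^+ 2 - rho ^+ 2 * i ^+ 2 + 2 * rho * kp * i ^+ 3 - (kp * i ^+ 2) ^+ 2.
    by rewrite dE /kp; field.
  rewrite rb in h1 *; lra.
lra.
Qed.

(** Puts the remainder 1/w^3 of [laguerre_exponent_bound] in telescoping form. *)
Lemma sqrtn_invB (R : realType) (w v : R) : 0 < v -> v <= w ->
  w ^+ 2 = v ^+ 2 + 1 -> 1 / w ^+ 3 <= 2 * (v^-1 - w^-1).
Proof.
move=> v0 vw wv; have w0 : 0 < w by lra.
have -> : v^-1 - w^-1 = (v * w * (w + v))^-1.
  apply: (mulIf (x := v * w * (w + v))); first by rewrite gt_eqF// !mulr_gt0//; lra.
  rewrite mulVf; last by rewrite gt_eqF// !mulr_gt0//; lra.
  have -> : (v^-1 - w^-1) * (v * w * (w + v)) = w ^+ 2 - v ^+ 2.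
    by field; rewrite !gt_eqF.
  by rewrite wv; ring.
have h : 0 < v * w * (w + v) by rewrite !mulr_gt0//; lra.
rewrite ler_pdivrMr ?exprn_gt0// mulrAC ler_pdivlMr// mul1r.
rewrite exprS !expr2; nra.
Qed.

(** The squared norm of L_n relative to that of the constant 1, as proved in
    [weight_int_laguerre_sqr]. *)
Definition laguerre_norm (R : realType) n (a : R) : R :=
  pochhammer (a + 1) n / n`!%:R.

Lemma laguerre_normS (R : realType) n (a : R) :
  laguerre_norm n.+1 a = laguerre_norm n a * ((n.+1%:R + a) / n.+1%:R).
Proof.
rewrite /laguerre_norm pochhammerS factS natrM -natr1.
by field; rewrite natr_fact_neq0 ?nat1r ?natr1 pnatr_eq0.
Qed.

Lemma laguerre_norm_gt0 (R : realType) n (a : R) : -1 < a ->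
  0 < laguerre_norm n a.
Proof.
by move=> a1; rewrite divr_gt0 ?ltr0n ?fact_gt0// pochhammer_gt0//; lra.
Qed.

(** Expresses the quotient of consecutive polynomials at a fixed point through the logarithmic
    derivative, so that [laguerre_ld_asymp] becomes a statement about growth in n. *)
Lemma laguerre_sq_ratio (R : realType) n (a s : R) : -1 < a ->
  (n.+1%:R + a) * (laguerre_sq n a).[s] =
  (n.+1%:R - s * laguerre_ld n.+1 a s / 2) * (laguerre_sq n.+1 a).[s].
Proof.
move=> a1; have := deriv_laguerre_sq_succ n s a1.
have := laguerre_sq_gt0 n.+1 s a1; rewrite /laguerre_ld => h E.
rewrite mulrBl [X in _ = _ - X](_ : _ = s / 2 * (laguerre_sq n.+1 a)^`().[s]).
  by rewrite E; ring.
by field; rewrite gt_eqF.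
Qed.

(** The lower half of Perron's asymptotics at [- rho ^+ 2]: L_n(-rho^2)^2 is at least a multiple of
    n^{-1/2} e^{4 rho sqrt n} times the norm. The quotient [T n] below is eventually nonincreasing,
    hence bounded. *)
Lemma laguerre_sq_growth (R : realType) (a rho : R) : -1 < a -> 0 < rho ->
  exists C : R, 0 <= C /\ exists n0, forall n, (n0 <= n)%N ->
    laguerre_norm n a * expR (4 * rho * Num.sqrt n%:R)
      <= C * Num.sqrt n%:R * (laguerre_sq n a).[rho] ^+ 2
    /\ (laguerre_sq n a).[rho] <= (laguerre_sq n.+1 a).[rho].
Proof.
move=> a1 r0; have [C [C0 [n1 H1]]] := laguerre_ld_asymp a1 r0.
pose b := (2 * a + 1) / rho + 2 * rho.
pose K := rho * C + 2 * rho * (`|rho * b| / 4 + rho * C / 2) + 2 * a ^+ 2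
     + 2 * rho.
have K0 : 0 <= K.
  have h1 : 0 <= rho * `|rho * b| by rewrite mulr_ge0// ltW.
  have h0 : 0 <= rho * C by rewrite mulr_ge0// ltW.
  have h2 : 0 <= rho * (rho * C) by rewrite mulr_ge0// ltW.
  by have := sqr_ge0 a; rewrite /K; lra.
(* The extra factor e^{2K / sqrt n} decreases by enough at each step to absorb the remainder
   [K / w ^+ 3]. *)
pose T n := laguerre_norm n a * expR (4 * rho * Num.sqrt n%:R + 2 * K / Num.sqrt n%:R)
  / (Num.sqrt n%:R * (laguerre_sq n a).[rho] ^+ 2).
have [n2 H2] := sqrtn_ge (2 + `|2 * a| + 2 * (C + `|b| + 2 / rho * `|a|) + 2 * rho + 2 * rho * C + rho * `|b|).
pose n0 := maxn n1 n2.
have step n : (n0 <= n)%N -> T n.+1 <= T n /\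
   (laguerre_sq n a).[rho] <= (laguerre_sq n.+1 a).[rho].
  move=> hn; have hn' : (n0 <= n.+1)%N by rewrite ltnW.
  have h1 := H1 n.+1 (leq_trans (leq_maxl _ _) hn').
  have h2 := H2 n.+1 (leq_trans (leq_maxr _ _) hn').
  have h2' := H2 n (leq_trans (leq_maxr _ _) hn).
  have rat := laguerre_sq_ratio n rho a1.
  move: h1 h2 h2' rat; rewrite /T laguerre_normS.
  set w := Num.sqrt n.+1%:R; set v := Num.sqrt n%:R => h1 h2 h2'.
  have nE : n.+1%:R = w ^+ 2 by rewrite sqr_sqrtr// ler0n.
  have wv : w ^+ 2 = v ^+ 2 + 1 by rewrite -nE sqr_sqrtr ?ler0n// natr1.
  rewrite nE; have Q0 := laguerre_sq_gt0 n rho a1.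
  have Q1 := laguerre_sq_gt0 n.+1 rho a1; have N0 := laguerre_norm_gt0 n a1.
  move: Q0 Q1 h1; set q0 := _.[rho]; set q1 := _.[rho].
  set m := laguerre_ld _ _ _ => Q0 Q1 h1 rat.
  pose e := m - (2 * w - b / 2).
  have p1 := normr_ge0 (2 * a); have p2 := normr_ge0 b; have p3 := normr_ge0 a.
  have p4 : 0 <= rho * C by rewrite mulr_ge0// ltW.
  have p5 : 0 <= rho * `|b| by rewrite mulr_ge0// ltW.
  have p6 : 0 <= 2 / rho * `|a| by rewrite mulr_ge0// divr_ge0// ltW.
  have w1 : 1 <= w by lra.
  have v0 : 0 < v by lra.
  have w0 : 0 < w by lra.
  have ww : w <= w ^+ 2 by rewrite expr2; nra.
  have aw : 2 * `|a| <= w ^+ 2 by move: h2; rewrite normrM [`|2|]gtr0_norm//; lra.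
  have hm : 2 * w - b / 2 + e = m by rewrite /e; ring.
  (* By [laguerre_sq_ratio], [q0] is [1 - d] times [w ^+ 2 / (w ^+ 2 + a)] times [q1]. *)
  pose d := rho * m / (2 * w ^+ 2).
  have := @laguerre_exponent_bound R a rho C w v e b d K r0 C0 w1 (ltW v0) wv aw h1
    erefl _ erefl.
  rewrite hm => /(_ erefl) HK.
  have dE : d * w ^+ 2 = rho * m / 2 by rewrite /d; field; lra.
  have heC : `|e| <= C.
    by rewrite (le_trans h1)// ler_pdivrMr// -[leLHS]mulr1 ler_wpM2l.
  have [e1 e2] : - C <= e /\ e <= C by move: heC; rewrite ler_norml => /andP.
  have [b1 b2] : - `|b| <= b /\ b <= `|b|.
    by apply/andP; rewrite -ler_norml.
  have [a2 a3] : - `|a| <= a /\ a <= `|a|.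
    by apply/andP; rewrite -ler_norml.
  have m0 : 2 / rho * `|a| <= m by rewrite -hm; lra.
  have m00 : 0 <= m by lra.
  have rm : `|a| <= rho * m / 2.
    have : 0 < rho / 2 by lra.
    move=> h; have : (rho / 2) * (2 / rho * `|a|) <= (rho / 2) * m by rewrite ler_pM2l.
    have -> : rho / 2 * (2 / rho * `|a|) = `|a| by field; lra.
    lra.
  have d0 : 0 <= d.
    apply: divr_ge0; first by rewrite mulr_ge0// ltW.
    by rewrite (mulr_ge0 _ (sqr_ge0 _)).
  have d1 : d <= 1.
    rewrite /d ler_pdivrMr ?mul1r; last by rewrite mulr_gt0// exprn_gt0.
    have : rho * m <= rho * (2 * w + `|b| / 2 + C) by rewrite ler_pM2l//; lra.
    have : rho * (2 * w) <= w ^+ 2.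
      by rewrite expr2 mulrA ler_pM2r//; lra.
    lra.
  have wa : 0 < w ^+ 2 + a.
    have w2 : 1 <= w ^+ 2 by lra.
    lra.
  have q0E : q0 = (1 - d) * (w ^+ 2 / (w ^+ 2 + a)) * q1.
    apply: (mulfI (x := w ^+ 2 + a)); first by rewrite gt_eqF.
    by rewrite rat -dE; field; rewrite gt_eqF.
  split; last first.
    rewrite q0E -[leRHS]mul1r ler_pM2r// mulrA ler_pdivrMr// mul1r mulrBl mul1r dE.
    lra.
  rewrite ler_pdivrMr ?mulr_gt0 ?exprn_gt0// [leRHS]mulrAC ler_pdivlMr ?mulr_gt0 ?exprn_gt0//.
  have -> : laguerre_norm n a * ((w ^+ 2 + a) / w ^+ 2) *
     expR (4 * rho * w + 2 * K / w) * (v * q0 ^+ 2) =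
     (laguerre_norm n a * w * q1 ^+ 2) * ((1 - d) ^+ 2 * (w ^+ 2 / (w ^+ 2 + a)) * (v / w)
      * expR (4 * rho * w + 2 * K / w)).
    by rewrite q0E; field; rewrite !gt_eqF.
  have -> : laguerre_norm n a * expR (4 * rho * v + 2 * K / v) * (w * q1 ^+ 2) =
     (laguerre_norm n a * w * q1 ^+ 2) * expR (4 * rho * v + 2 * K / v) by ring.
  rewrite ler_pM2l; last first.
    by apply: mulr_gt0; [exact: mulr_gt0|exact: exprn_gt0].
  (* The three factors of the quotient of consecutive values of [T] are bounded by exponentials;
     their exponents are those summed in [laguerre_exponent_bound]. *)
  have t1 : (1 - d) ^+ 2 <= expR (- 2 * d - d ^+ 2).
    have -> : - 2 * d - d ^+ 2 = 2%:R * (- d - d ^+ 2 / 2) by field.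
    by rewrite expRM_natl lerXn2r ?nnegrE ?expR_ge0 ?subr_ge0 ?oneB_le_expR.
  have t2 : w ^+ 2 / (w ^+ 2 + a) <= expR (- (a / (w ^+ 2 + a))).
    apply: le_trans (expR_ge1Dx _).
    by rewrite le_eqVlt; apply/orP; left; apply/eqP; field; rewrite gt_eqF.
  have t3 : v / w <= expR (- (1 / (2 * w ^+ 2))).
    rewrite -ler_sqr ?nnegrE ?expR_ge0 ?divr_ge0 ?(ltW v0) ?(ltW w0)//.
    rewrite -expRM_natl; apply: le_trans (expR_ge1Dx _).
    rewrite expr_div_n (_ : v ^+ 2 = w ^+ 2 - 1); last by rewrite wv; ring.
    by rewrite le_eqVlt; apply/orP; left; apply/eqP; field; rewrite gt_eqF.
  have t12 : (1 - d) ^+ 2 * (w ^+ 2 / (w ^+ 2 + a)) * (v / w) <=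
    expR (- 2 * d - d ^+ 2) * expR (- (a / (w ^+ 2 + a))) * expR (- (1 / (2 * w ^+ 2))).
    apply: ler_pM => //; last apply: ler_pM => //.
    - by rewrite mulr_ge0 ?sqr_ge0// divr_ge0 ?sqr_ge0// ltW.
    - by rewrite divr_ge0// ltW.
    - exact: sqr_ge0.
    - by rewrite divr_ge0 ?sqr_ge0// ltW.
  rewrite (le_trans (ler_wpM2r (expR_ge0 _) t12))// -!expRD ler_expR.
  have vw : v <= w by rewrite -ler_sqr ?nnegrE ?ltW//; lra.
  have h3 := sqrtn_invB v0 vw wv.
  have : K * (1 / w ^+ 3) <= K * (2 * (v^-1 - w^-1)) by rewrite ler_wpM2l.
  lra.
have Tn n : (n0 <= n)%N -> T n <= T n0.
  move=> hn; rewrite -(subnK hn); elim: (n - n0)%N => [//|k IH].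
  by rewrite addSn (le_trans (step _ _).1 IH)// leq_addl.
have T0 n : 0 <= T n.
  apply: divr_ge0; last by apply: mulr_ge0; [exact: sqrtr_ge0|exact: sqr_ge0].
  by apply: mulr_ge0; [exact/ltW/laguerre_norm_gt0|exact: expR_ge0].
exists (T n0); split => //; exists n0 => n hn; split; last exact: (step n hn).2.
have h2 := H2 n (leq_trans (leq_maxr _ _) hn).
have w0 : 0 < Num.sqrt n%:R :> R.
  have p1 := normr_ge0 (2 * a); have p2 := normr_ge0 b.
  have p4 : 0 <= rho * C by rewrite mulr_ge0// ltW.
  have p5 : 0 <= rho * `|b| by rewrite mulr_ge0// ltW.
  have p6 : 0 <= 2 / rho * `|a| by rewrite mulr_ge0// divr_ge0// ltW.
  clear step Tn T0 K0 T H1 H2 K; lra.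
have Q0 := laguerre_sq_gt0 n rho a1; have N0 := laguerre_norm_gt0 n a1.
apply: (le_trans (y := T n * Num.sqrt n%:R * (laguerre_sq n a).[rho] ^+ 2)).
  have -> : T n * Num.sqrt n%:R * (laguerre_sq n a).[rho] ^+ 2 =
     laguerre_norm n a * expR (4 * rho * Num.sqrt n%:R + 2 * K / Num.sqrt n%:R).
    rewrite /T; move: w0 Q0 {h2}; move: (Num.sqrt _) (_.[_]) => w q w0 q0.
    by field; rewrite !gt_eqF.
  by rewrite ler_pM2l// ler_expR lerDl divr_ge0 ?mulr_ge0// ltW.
rewrite -[leLHS]mulrA -[leRHS]mulrA; apply: ler_wpM2r; last exact: Tn.
by apply: mulr_ge0; [exact: ltW|exact: sqr_ge0].
Qed.

(** * Improper integrals by exhaustion, and integrability against the Laguerre weight *)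

Lemma Rintegral_FTC (R : realType) (f F : R -> R) (a b : R) : a <= b ->
  (forall x, a <= x <= b -> deriv_at F x (f x)) ->
  {within `[a, b], continuous f} ->
  (\int[lebesgue_measure]_(x in `[a, b]) (f x)%:E = (F b - F a)%:E)%E.
Proof.
rewrite le_eqVlt => /predU1P[<- _ _|ab dF cf].
  by rewrite set_itv1 integral_set1 subrr.
have hin x : x \in `]a, b[ -> a <= x <= b.
  by rewrite in_itv/= => /andP[h1 h2]; rewrite !ltW.
have cF x : a <= x <= b -> {for x, continuous F}.
  by move=> hx; exact: derive_continuous (dF x hx).
rewrite (continuous_FTC2 (F := F) ab cf)//.
- split.
  + by move=> x /hin /dF[].
  + by apply: cvg_at_right_filter; apply: cF; rewrite lexx ltW.
  + by apply: cvg_at_left_filter; apply: cF; rewrite lexx ltW.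
- by move=> x /hin /dF[h <-]; rewrite derive1E.
Qed.

(** Monotone convergence along the intervals; on each of them the dominating function [h] is
    integrated by its antiderivative [F]. *)
Lemma exhaustion_integral_le (R : realType) (f h F : R -> R) (u v : nat -> R)
    (M : R) :
  (forall n, u n <= v n) ->
  nondecreasing_seq (fun n => `[u n, v n]%classic) ->
  (forall n x, u n <= x <= v n -> deriv_at F x (h x)) ->
  (forall n, {within `[u n, v n], continuous h}) ->
  (forall n x, u n <= x <= v n -> 0 <= f x <= h x) ->
  (forall n, measurable_fun `[u n, v n] f) ->
  (forall n, F (v n) - F (u n) <= M) ->
  (\int[lebesgue_measure]_(x in \bigcup_n `[u n, v n]%classic) (f x)%:E
    <= M%:E)%E.
Proof.
move=> uv nd dF ch fh mf hM.
have f0 n x : `[u n, v n]%classic x -> (0 <= (f x)%:E)%E.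
  by rewrite /= in_itv/= => hx; rewrite lee_fin; have /andP[] := fh n x hx.
have H : (\int[lebesgue_measure]_(x in `[u n, v n]) (f x)%:E)%E @[n --> \oo] -->
    (\int[lebesgue_measure]_(x in \bigcup_n `[u n, v n]%classic) (f x)%:E)%E.
  apply: (@ge0_nondecreasing_set_cvg_integral _ (measurableTypeR R) R
    (fun n => `[u n, v n]%classic) (EFin \o f) lebesgue_measure nd) => //.
  by move=> n; apply/measurable_EFinP; exact: mf.
rewrite -(cvg_lim (@ereal_hausdorff R) H).
apply: lime_le; first exact: cvgP H.
apply: nearW => n; apply: (@le_trans _ _ (F (v n) - F (u n))%:E); last by rewrite lee_fin.
rewrite -(Rintegral_FTC (uv n) (dF n) (ch n)).
apply: ge0_le_integral => //=.
- by move=> x hx; exact: (f0 n).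
- by apply/measurable_EFinP; exact: mf.
- apply/measurable_EFinP; exact: subspace_continuous_measurable_fun.
- by move=> x /= hx; rewrite lee_fin; rewrite in_itv/= in hx; have /andP[] := fh n x hx.
Qed.

(** Dominated convergence along the intervals, the integrand itself serving as the dominating
    function. *)
Lemma exhaustion_FTC (R : realType) (f F : R -> R) (u v : nat -> R)
    (l0 l1 : R) :
  (forall n, u n <= v n) ->
  nondecreasing_seq (fun n => `[u n, v n]%classic) ->
  (forall n x, u n <= x <= v n -> deriv_at F x (f x)) ->
  (forall n, {within `[u n, v n], continuous f}) ->
  lebesgue_measure.-integrable (\bigcup_n `[u n, v n]%classic) (EFin \o f) ->
  F (u n) @[n --> \oo] --> l0 -> F (v n) @[n --> \oo] --> l1 ->
  \int[lebesgue_measure]_(x in \bigcup_n `[u n, v n]%classic) f x = l1 - l0.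
Proof.
move=> uv nd dF cf fi hl0 hl1.
pose D := \bigcup_n `[u n, v n]%classic.
have mD : measurable D by apply: bigcup_measurable => n _; exact: measurable_itv.
pose f_ n := (EFin \o f) \_ `[u n, v n]%classic.
have mf : measurable_fun D (EFin \o f) by case/integrableP : fi.
have [|||_ _] := @dominated_convergence _ _ R lebesgue_measure D mD f_
  (EFin \o f) (abse \o (EFin \o f)) _ mf _ (integrable_abse fi) _.
- move=> n; apply/measurable_restrict => //.
  by apply: measurable_funS mf => //; exact: subIsetl.
- apply: aeW => x [N _ hN]; apply: cvg_near_cst; exists N => // n /= Nn.
  rewrite /f_ patchE mem_set//.
  by have := nd _ _ Nn; rewrite subsetEset; apply.
- apply: aeW => x n _; rewrite /f_ patchE; case: ifP => // _.
  by rewrite abse0; exact: abse_ge0.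
move=> H.
have E n : (\int[lebesgue_measure]_(x in D) f_ n x = (F (v n) - F (u n))%:E)%E.
  rewrite -(Rintegral_FTC (uv n) (dF n) (cf n)) /f_ -integral_mkcondr.
  by congr (integral _ _ _); apply/setIidPr => x hx; exists n.
have {}H : (F (v n) - F (u n))%:E @[n --> \oo] -->
    (\int[lebesgue_measure]_(x in D) (f x)%:E)%E.
  by apply: cvg_trans H; apply: near_eq_cvg; apply: nearW => n; rewrite -E.
have H2 : (F (v n) - F (u n))%:E @[n --> \oo] --> (l1 - l0)%:E.
  by apply: cvg_EFin; [exact: nearW|exact: cvgB].
rewrite /Rintegral -/D; have -> := cvg_unique _ H H2; by [].
Qed.

Lemma drv_powR (R : realType) (p x : R) : 0 < x ->
  deriv_at (fun y => y `^ p) x (p * x `^ (p - 1)).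
Proof. by move=> x0; exact: is_derive1_powR. Qed.

Lemma powR_le_1DX (R : realType) (p x : R) m : 0 <= p -> p <= m%:R -> 0 <= x ->
  x `^ p <= 1 + x ^+ m.
Proof.
move=> p0 pm x0; have [x1|/ltW x1] := leP x 1.
  have h : x `^ p <= 1 `^ p by apply: ge0_ler_powR => //; rewrite nnegrE.
  rewrite powR1 in h.
  by apply: (le_trans h); rewrite lerDl exprn_ge0.
rewrite -powR_mulrn//; apply: (le_trans (ler_powR x1 pm)).
by rewrite lerDr.
Qed.

Lemma powR_expRN_le (R : realType) (p c : R) : 0 <= p -> 0 < c ->
  exists2 K : R, 0 < K & forall x, 0 <= x -> x `^ p * expR (- (c * x)) <= K.
Proof.
move=> p0 c0; pose m := (Num.truncn p).+1.
have [K K0 HK] := expRN_pow_le R m.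
have h0 : 0 < K / c ^+ m by rewrite divr_gt0// exprn_gt0.
exists (1 + K / c ^+ m) => [|x x0]; first by lra.
have pm : p <= m%:R by apply: ltW; exact: truncnS_gt.
apply: (le_trans (ler_wpM2r (expR_ge0 _) (powR_le_1DX p0 pm x0))).
rewrite mulrDl mul1r lerD//.
  by rewrite expR_le1 oppr_le0 mulr_ge0// ltW.
rewrite ler_pdivlMr ?exprn_gt0//.
have cx : 0 <= c * x by rewrite mulr_ge0// ltW.
by apply: le_trans (HK _ cx); rewrite exprMn; lra.
Qed.

(** The exhaustion stays away from 0, where real powers need not be differentiable. *)
Lemma harmonic_itv_bigcup (R : realType) :
  \bigcup_n `[(n.+1%:R)^-1, n.+1%:R]%classic = `]0, +oo[%classic :> set R.
Proof.
apply/seteqP; split => [x [n _]|x] /=; rewrite !in_itv/= ?andbT.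
  by move=> /andP[h _]; apply: lt_le_trans h; rewrite invr_gt0.
move=> x0; pose n := maxn (Num.truncn x) (Num.truncn x^-1).
exists n => //=; rewrite in_itv/=; apply/andP; split.
  rewrite -[leRHS]invrK lef_pV2 ?posrE ?invr_gt0//.
  by apply: (le_trans (ltW (truncnS_gt _))); rewrite ler_nat ltnS leq_maxr.
by apply: (le_trans (ltW (truncnS_gt _))); rewrite ler_nat ltnS leq_maxl.
Qed.

Lemma harmonic_itv_nd (R : realType) :
  nondecreasing_seq (fun n => `[(n.+1%:R)^-1, n.+1%:R]%classic : set R).
Proof.
move=> m n mn; rewrite subsetEset => x /=; rewrite !in_itv/= => /andP[h1 h2].
rewrite (le_trans _ h1) ?(le_trans h2) ?ler_nat//.
by rewrite lef_pV2 ?posrE// ler_nat.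
Qed.

Lemma harmonic_itv_le (R : realType) n : (n.+1%:R : R)^-1 <= n.+1%:R.
Proof. by apply: (@le_trans _ _ 1); rewrite ?invf_le1 ?ler1n. Qed.

Lemma laguerre_weight_ge0 (R : realType) (b x : R) : 0 <= laguerre_weight b x.
Proof. by rewrite /laguerre_weight mulr_ge0 ?powR_ge0 ?expR_ge0. Qed.

Lemma measurable_laguerre_weight (R : realType) (b : R) (D : set R) :
  measurable_fun D (laguerre_weight b).
Proof.
apply: measurable_funTS; apply: measurable_funM; first exact: measurable_powR.
by apply: measurableT_comp; [exact: measurable_expR|exact: oppr_measurable].
Qed.

Lemma drv_expRN (R : realType) (c x : R) :
  deriv_at (fun y => expR (- (c * y))) x (- c * expR (- (c * x))).
Proof.
apply: drv_eq; first by apply: drv_exp; apply: drvN; apply: drvZ; exact: drv_id.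
by ring.
Qed.

Lemma powRS (R : realType) (b x : R) : 0 < x -> x `^ (b + 1) = x `^ b * x.
Proof.
move=> x0; rewrite powRD; last by rewrite (gt_eqF x0) implybT.
by rewrite powRr1// ltW.
Qed.

Lemma integrable_laguerre_weight (R : realType) (b : R) : -1 < b ->
  lebesgue_measure.-integrable `[0, +oo[ (EFin \o laguerre_weight b).
Proof.
move=> b1; have p0 : 0 <= b + 1 by lra.
have h0 : 0 < (2^-1 : R) by rewrite invr_gt0.
have [K K0 HK] := powR_expRN_le p0 h0.
have k0 : 0 < 2 / (b + 1) by rewrite divr_gt0//; lra.
(* Differentiating x^(b+1) e^{-x} produces the unwanted term - x^(b+1) e^{-x}; since [K] bounds
   x^(b+1) e^{-x/2}, the derivative of the second term compensates it, and half of the main term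
   still suffices to dominate the weight. *)
pose F (x : R) := 2 / (b + 1) * (x `^ (b + 1) * expR (- (1 * x))
   - 2 * K * expR (- (2^-1 * x))).
pose h (x : R) := 2 / (b + 1) * (x `^ b * expR (- (1 * x)) * (b + 1 - x)
   + K * expR (- (2^-1 * x))).
have dF n x : (n.+1%:R)^-1 <= x <= n.+1%:R -> deriv_at F x (h x).
  move=> /andP[h1 _]; have x0 : 0 < x by apply: lt_le_trans h1; rewrite invr_gt0.
  apply: drv_eq.
    apply: drvZ; apply: drvB; last by apply: drvZ; exact: drv_expRN.
    by apply: drvM; [exact: drv_powR|exact: drv_expRN].
  by rewrite /h addrK powRS//; field; lra.
have half x : expR (- (1 * x)) = expR (- (2^-1 * x)) * expR (- (2^-1 * x)) :> R.
  by rewrite -expRD; congr expR; field.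
apply/integrableP; split.
  by apply/measurable_EFinP; exact: measurable_laguerre_weight.
rewrite -integral_itv_obnd_cbnd; last first.
  apply: measurableT_comp => //.
  by apply/measurable_EFinP; exact: measurable_laguerre_weight.
rewrite -harmonic_itv_bigcup; apply: (@le_lt_trans _ _ (2 / (b + 1) * (3 * K))%:E); last first.
  exact: ltry.
under eq_integral => x _.
  rewrite /= ger0_norm; last exact: laguerre_weight_ge0.
  over.
apply: (exhaustion_integral_le (h := h) (F := F)) => //.
- exact: harmonic_itv_le.
- exact: harmonic_itv_nd.
- move=> n; apply: continuous_in_subspaceT => x; rewrite inE/= in_itv/= => /andP[h1 _].
  have x0 : 0 < x by apply: lt_le_trans h1; rewrite invr_gt0.
  eapply derive_continuous; apply: drvZ; apply: drvD.
    apply: drvM; last by apply: drvB; [exact: drvC|exact: drv_id].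
    by apply: drvM; [exact: drv_powR|exact: drv_expRN].
  by apply: drvZ; exact: drv_expRN.
- move=> n x /andP[h1 _]; have x0 : 0 < x by apply: lt_le_trans h1; rewrite invr_gt0.
  rewrite laguerre_weight_ge0 /= /laguerre_weight /h -[x in expR (- x)]mul1r.
  have := HK x (ltW x0); rewrite powRS// half.
  have := expR_gt0 (- (2^-1 * x)); set E := expR _ => E0 H.
  have -> : 2 / (b + 1) * (x `^ b * (E * E) * (b + 1 - x) + K * E) =
     x `^ b * (E * E) + 2 / (b + 1) * (E * (K - x `^ b * x * E) + x `^ b * (E * E) * ((b + 1) / 2)).
    by field; lra.
  rewrite lerDl; apply: mulr_ge0; first exact: ltW.
  apply: addr_ge0; first by rewrite mulr_ge0 ?(ltW E0) ?subr_ge0.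
  by rewrite !mulr_ge0 ?powR_ge0 ?(ltW E0)//; lra.
- by move=> n; exact: measurable_laguerre_weight.
- move=> n; rewrite /F -mulrBr ler_pM2l//.
  have u0 : 0 <= (n.+1%:R)^-1 :> R by rewrite invr_ge0.
  have v0 : 0 <= n.+1%:R :> R by [].
  have := HK _ v0; rewrite !half.
  move: (n.+1%:R) v0 u0 => v v0 u0.
  have := mulr_ge0 (powR_ge0 v^-1 (b + 1)) (mulr_ge0 (expR_ge0 (- (2^-1 * v^-1))) (expR_ge0 (- (2^-1 * v^-1)))).
  have e1 : expR (- (2^-1 * v)) <= 1 by rewrite expR_le1 oppr_le0 mulr_ge0//; lra.
  have e2 : expR (- (2^-1 * v^-1)) <= 1 by rewrite expR_le1 oppr_le0 mulr_ge0//; lra.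
  have e3 := expR_ge0 (- (2^-1 * v)).
  move: e1 e2 e3; set E1 := expR (- (2^-1 * v)); set E2 := expR _ => e1 e2 e3 q1 q2.
  have q3 : v `^ (b + 1) * (E1 * E1) <= K * 1 by rewrite mulrA ler_pM// mulr_ge0// powR_ge0.
  have q4 : K * E2 <= K * 1 by rewrite ler_pM2l.
  have q5 : 0 <= K * E1 by rewrite mulr_ge0// ltW.
  lra.
Qed.

Lemma laguerre_weightS (R : realType) (a : R) k (x : R) : 0 < x ->
  laguerre_weight (a + k%:R) x = laguerre_weight a x * x ^+ k.
Proof.
move=> x0; rewrite /laguerre_weight powRD; last by rewrite (gt_eqF x0) implybT.
by rewrite powR_mulrn ?(ltW x0)// mulrAC.
Qed.

Lemma integrable_weightM (R : realType) (a C : R) k (phi : R -> R) : -1 < a ->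
  measurable_fun `[(0:R), +oo[ phi ->
  (forall x, 0 <= x -> `|phi x| <= C * (1 + x ^+ k)) ->
  lebesgue_measure.-integrable `[(0:R), +oo[
    (EFin \o (fun x => laguerre_weight a x * phi x)).
Proof.
move=> a1 mphi hphi.
have m1 : measurable_fun `[(0:R), +oo[ (fun x => laguerre_weight a x * phi x).
  by apply: measurable_funM => //; exact: measurable_laguerre_weight.
have ak : -1 < a + k%:R by have := ler0n R k; lra.
(* The open half-line is used because [laguerre_weightS] requires [0 < x]; the endpoint is a null
   set. *)
have i1 : lebesgue_measure.-integrable `](0:R), +oo[
    (fun x => (C * (laguerre_weight a x + laguerre_weight (a + k%:R) x))%:E).
  have i2 : lebesgue_measure.-integrable `[(0:R), +oo[
    (fun x => C%:E * ((laguerre_weight a x)%:E + (laguerre_weight (a + k%:R) x)%:E))%E.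
    apply: integrableZl => //; apply: integrableD => //;
    exact: integrable_laguerre_weight.
  by apply: integrableS i2 => //; apply: subset_itvr; rewrite bnd_simp.
have [m2 m2'] : measurable_fun `](0:R), +oo[ (fun x => laguerre_weight a x * phi x)
   /\ measurable_fun `[(0:R), +oo[ (fun x => `|laguerre_weight a x * phi x|).
  split; last exact: measurableT_comp.
  by apply: measurable_funS m1 => //; apply: subset_itvr; rewrite bnd_simp.
have : lebesgue_measure.-integrable `](0:R), +oo[
    (EFin \o (fun x => laguerre_weight a x * phi x)).
  apply: le_integrable i1 => //; first exact/measurable_EFinP.
  move=> x /=; rewrite in_itv/= andbT => x0; rewrite lee_fin normrM.
  apply: le_trans (ler_norm _).
  rewrite laguerre_weightS// ger0_norm ?laguerre_weight_ge0//.
  have -> : C * (laguerre_weight a x + laguerre_weight a x * x ^+ k) =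
    laguerre_weight a x * (C * (1 + x ^+ k)) by ring.
  by rewrite ler_wpM2l ?laguerre_weight_ge0// hphi// ltW.
move=> /integrableP[_ H]; apply/integrableP; split; first exact/measurable_EFinP.
by rewrite -integral_itv_obnd_cbnd//; apply: measurableT_comp => //; exact/measurable_EFinP.
Qed.

Lemma integrable_mulr (R : realType) (D : set R) (f : R -> R) (c : R) :
  measurable (D : set (measurableTypeR R)) -> lebesgue_measure.-integrable D (EFin \o f) ->
  lebesgue_measure.-integrable D (EFin \o (fun x => f x * c)).
Proof.
move=> mD fi.
suff : lebesgue_measure.-integrable D (fun x => (c%:E * (f x)%:E)%E).
  by apply: eq_integrable => // x _; rewrite /= mulrC EFinM.
exact: integrableZl.
Qed.

Lemma horner_bound (R : realType) (p : {poly R}) : exists2 C : R, 0 <= C &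
  forall x, 0 <= x -> `|p.[x]| <= C * (1 + x ^+ size p).
Proof.
exists (\sum_(i < size p) `|p`_i|) => [|x x0]; first by rewrite sumr_ge0.
rewrite horner_coef (le_trans (ler_norm_sum _ _ _))// mulr_suml.
apply: ler_sum => i _; rewrite normrM ler_wpM2l// ger0_norm ?exprn_ge0//.
have [x1|/ltW x1] := leP x 1.
  by rewrite (le_trans (exprn_ile1 _ _ _))// lerDl exprn_ge0.
by rewrite (le_trans (ler_weXn2l x1 (ltnW (ltn_ord i))))// lerDr.
Qed.

Lemma measurable_horner (R : realType) (p : {poly R}) (D : set R) :
  measurable_fun D (horner p).
Proof.
by apply: measurable_funTS; apply: continuous_measurable_fun; exact: continuous_horner.
Qed.

Lemma integrable_weight_poly (R : realType) (a : R) (p : {poly R}) : -1 < a ->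
  lebesgue_measure.-integrable `[(0:R), +oo[
    (EFin \o (fun x => laguerre_weight a x * p.[x])).
Proof.
move=> a1; have [C C0 HC] := horner_bound p.
by apply: (integrable_weightM a1 _ HC); exact: measurable_horner.
Qed.

(** * Orthogonality of the Laguerre polynomials *)

Definition weight_int (R : realType) (a : R) (phi : R -> R) : R :=
  \int[lebesgue_measure]_(x in `[0, +oo[) (laguerre_weight a x * phi x).

Lemma weight_intD (R : realType) (a : R) (p q : {poly R}) : -1 < a ->
  weight_int a (horner (p + q)) = weight_int a (horner p) + weight_int a (horner q).
Proof.
move=> a1; rewrite /weight_int -RintegralD//; try exact: integrable_weight_poly.
by apply: eq_Rintegral => x _; rewrite hornerD mulrDr.
Qed.

Lemma weight_intZ (R : realType) (a c : R) (p : {poly R}) : -1 < a ->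
  weight_int a (horner (c *: p)) = c * weight_int a (horner p).
Proof.
move=> a1; rewrite /weight_int -RintegralZl//; last exact: integrable_weight_poly.
by apply: eq_Rintegral => x _; rewrite hornerZ; ring.
Qed.

(** The weighted integrand is the derivative of x^(a+1) e^{-x} q(x), which vanishes at 0 because a +
    1 > 0, and at infinity. *)
Lemma weight_int_by_parts (R : realType) (a : R) (q : {poly R}) : -1 < a ->
  weight_int a (horner ('X * q^`() + ((a + 1)%:P - 'X) * q)) = 0.
Proof.
move=> a1; set p := _ + _.
have p0 : 0 <= a + 1 by lra.
have [C C0 HC] := horner_bound q.
pose F (x : R) := x `^ (a + 1) * expR (- (1 * x)) * q.[x].
have dF (x : R) : 0 < x -> deriv_at F x (laguerre_weight a x * p.[x]).
  move=> x0; apply: drv_eq.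
    apply: drvM; last exact: is_derive_poly.
    by apply: drvM; [exact: drv_powR|exact: drv_expRN].
  rewrite /laguerre_weight /p hornerD !hornerM hornerD hornerN hornerC hornerX.
  by rewrite addrK powRS// mul1r; ring.
rewrite /weight_int -Rintegral_itv_obnd_cbnd; last first.
  apply: integrableS (integrable_weight_poly p a1) => //.
  by apply: subset_itvr; rewrite bnd_simp.
rewrite -harmonic_itv_bigcup -[RHS](subrr 0).
apply: (exhaustion_FTC (F := F)).
- exact: harmonic_itv_le.
- exact: harmonic_itv_nd.
- by move=> n x /andP[h1 _]; apply: dF; apply: lt_le_trans h1; rewrite invr_gt0.
- move=> n; apply: continuous_in_subspaceT => x; rewrite inE/= in_itv/= => /andP[h1 _].
  have x0 : 0 < x by apply: lt_le_trans h1; rewrite invr_gt0.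
  eapply derive_continuous; apply: drvM; last exact: is_derive_poly.
  apply: drvM; first exact: drv_powR.
  by apply: drv_exp; apply: drvN; exact: drv_id.
- rewrite harmonic_itv_bigcup; apply: integrableS (integrable_weight_poly p a1) => //.
  by apply: subset_itvr; rewrite bnd_simp.
- have H : F x @[x --> 0^'+] --> 0 * expR (- (1 * 0)) * q.[0].
    apply: cvgM; first apply: cvgM.
    + by apply: powR_cvg0; lra.
    + by apply: cvg_at_right_filter; exact: derive_continuous (drv_expRN _ _).
    + by apply: cvg_at_right_filter; exact: continuous_horner.
  rewrite !mul0r in H; move/cvg_at_rightP : H; apply.
  by split => [n|]; [rewrite invr_gt0|exact: cvg_harmonic].
- have h0 : 0 < (2^-1 : R) by rewrite invr_gt0.
  have pk : 0 <= a + 1 + (size q)%:R by rewrite addr_ge0.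
  have pk2 : 0 <= a + 1 + (size q)%:R + 1 by rewrite addr_ge0.
  have pk1 : 0 <= a + 1 + 1 by lra.
  have [K1 K10 HK1] := powR_expRN_le pk1 (@ltr01 R).
  have [K2 K20 HK2] := powR_expRN_le pk2 (@ltr01 R).
  apply/cvgr0Pnorm_le => e e0; near=> n.
  have v0 : 0 < n.+1%:R :> R by [].
  (* One spare power of the variable turns a bound into decay like 1/n. *)
  have HF : `|F n.+1%:R| * n.+1%:R <= C * (K1 + K2).
    have := HK1 _ (ltW v0); have := HK2 _ (ltW v0).
    rewrite /F !powRS// powRD; last by rewrite (gt_eqF v0) implybT.
    rewrite powR_mulrn ?(ltW v0)// !powRS// !normrM.
    rewrite (ger0_norm (powR_ge0 _ _)) (ger0_norm (expR_ge0 _)).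
    have := HC _ (ltW v0); have := powR_ge0 (n.+1%:R : R) a.
    have := expR_ge0 (- (1 * n.+1%:R) : R).
    set v := (n.+1%:R : R); set E := expR _; set P := _ `^ a.
    rewrite (ger0_norm (ltW v0)); set Q := `|q.[v]| => E0 P0 hQ h2 h1.
    have : P * v * E * v * Q <= P * v * E * v * (C * (1 + v ^+ size q)).
      by apply: ler_wpM2l => //; rewrite !mulr_ge0// ltW.
    have : C * (P * v * v * E + P * v * v ^+ size q * v * E) <= C * (K1 + K2).
      by apply: ler_wpM2l => //; lra.
    lra.
  rewrite -(ler_pM2r v0) (le_trans HF)// -ler_pdivrMl//.
  near: n; exists (Num.truncn (e^-1 * (C * (K1 + K2)))) => // n /= hn.
  by apply: ltW; apply: lt_le_trans (truncnS_gt _) _; rewrite ler_nat ltnS.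
Unshelve. all: by end_near. Qed.

(** Integration by parts for L_n' x^j, the differential equation removing the second derivative. *)
Lemma weight_int_laguerre_rec (R : realType) (a : R) n j : -1 < a ->
  n%:R * weight_int a (horner (laguerre n a * 'X^j)) =
  j%:R * weight_int a (horner ((laguerre n a)^`() * 'X^j)).
Proof.
move=> a1; have := weight_int_by_parts ((laguerre n a)^`() * 'X^j) a1.
have -> : 'X * ((laguerre n a)^`() * 'X^j)^`()
    + ((a + 1)%:P - 'X) * ((laguerre n a)^`() * 'X^j) =
  ('X * (laguerre n a)^`()^`() + ((a + 1)%:P - 'X) * (laguerre n a)^`()
    + n%:R *: laguerre n a) * 'X^j + (j%:R *: ((laguerre n a)^`() * 'X^j)
   + (- n%:R) *: (laguerre n a * 'X^j)).
  rewrite derivM derivXn -!mul_polyC polyCN !polyC_natr.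
  case: j => [|j]; first by rewrite mulr0n expr0; ring.
  by rewrite /= exprS -['X^j *+ _]mulr_natr; ring.
rewrite laguerre_ode// mul0r add0r weight_intD// !weight_intZ// mulNr => /eqP.
by rewrite subr_eq0 => /eqP ->.
Qed.

Lemma weight_int_laguerre_deriv (R : realType) (a : R) n j : -1 < a ->
  weight_int a (horner ((laguerre n a)^`() * 'X^(j.+1))) =
  weight_int a (horner (laguerre n a * 'X^(j.+1)))
   - (a + j.+1%:R) * weight_int a (horner (laguerre n a * 'X^j)).
Proof.
move=> a1; have := weight_int_by_parts (laguerre n a * 'X^j) a1.
have -> : 'X * (laguerre n a * 'X^j)^`()
    + ((a + 1)%:P - 'X) * (laguerre n a * 'X^j) =
  ((laguerre n a)^`() * 'X^(j.+1)) + ((-1) *: (laguerre n a * 'X^(j.+1))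
    + (a + j.+1%:R) *: (laguerre n a * 'X^j)).
  rewrite derivM derivXn -!mul_polyC polyCN polyC1 !polyCD polyC1 polyC_natr.
  case: j => [|j]; first by rewrite mulr0n !expr0 expr1; ring.
  by rewrite /= !exprS -['X^j *+ _]mulr_natr; ring.
rewrite !weight_intD// !weight_intZ// => h.
by apply/eqP; rewrite -subr_eq0 -h; apply/eqP; ring.
Qed.

(** Write M_j for the integral of L_n x^j. The two preceding relations combine to n M_{j+1} = (j+1)
    (M_{j+1} - (a+j+1) M_j), so M_j = 0 forces (n-j-1) M_{j+1} = 0. *)
Lemma weight_int_laguerreXn (R : realType) (a : R) n j : -1 < a -> (j < n)%N ->
  weight_int a (horner (laguerre n a * 'X^j)) = 0.
Proof.
move=> a1; elim: j => [|j IH] jn.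
  have := weight_int_laguerre_rec n 0 a1; rewrite mul0r => /eqP.
  by rewrite mulf_eq0 pnatr_eq0 -leqn0 leqNgt jn => /eqP.
have := weight_int_laguerre_rec n j.+1 a1; rewrite weight_int_laguerre_deriv//.
rewrite IH ?(ltnW jn)// mulr0 subr0 => /eqP; rewrite -subr_eq0 -mulrBl mulf_eq0.
by rewrite subr_eq0 eqr_nat gtn_eqF// => /eqP.
Qed.

Lemma weight_int_sum (R : realType) (a : R) (I : Type) (r : seq I)
    (p : I -> {poly R}) : -1 < a ->
  weight_int a (horner (\sum_(i <- r) p i)) =
  \sum_(i <- r) weight_int a (horner (p i)).
Proof.
move=> a1; elim: r => [|i r IH]; last by rewrite !big_cons weight_intD// IH.
rewrite !big_nil -(scale0r (0 : {poly R})) weight_intZ// mul0r//.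
Qed.

Lemma weight_int_laguerreM (R : realType) (a : R) n (q : {poly R}) :
  -1 < a -> (size q <= n)%N -> weight_int a (horner (laguerre n a * q)) = 0.
Proof.
move=> a1 qn; rewrite -[q]coefK poly_def mulr_sumr weight_int_sum// big1// => i _.
rewrite -(scalerAr _ (laguerre _ _)) weight_intZ// weight_int_laguerreXn ?mulr0//.
exact: leq_trans qn.
Qed.

(** Induction on n: [laguerre_deriv_succ] gives x L_{n+1}', and the term in L_{n+1} x^n vanishes by
    orthogonality. *)
Lemma weight_int_laguerre_lead (R : realType) (a : R) n : -1 < a ->
  weight_int a (horner (laguerre n a * 'X^n)) =
  (-1) ^+ n * n`!%:R * laguerre_norm n a * weight_int a (horner 1).
Proof.
move=> a1; elim: n => [|n IH].
  by rewrite laguerre0 /laguerre_norm pochhammer0 expr0 divr1 !mulr1 mul1r.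
have h : weight_int a (horner ((laguerre n.+1 a)^`() * 'X^(n.+1))) =
   - (n.+1%:R + a) * weight_int a (horner (laguerre n a * 'X^n)).
  rewrite exprS mulrA [_ * 'X]mulrC laguerre_deriv_succ// mulrBl.
  rewrite -!(scalerAl _ (laguerre _ _)).
  rewrite weight_intD// -(scaleN1r (_ *: _)) !weight_intZ//.
  by rewrite (@weight_int_laguerreXn _ _ n.+1)//; ring.
have := weight_int_laguerre_deriv n.+1 n a1.
rewrite h IH (@weight_int_laguerreXn _ a n.+1 n)// mulr0 subr0 => <-.
rewrite laguerre_normS factS natrM exprS.
have : n.+1%:R != 0 :> R by rewrite pnatr_eq0.
move: (n.+1%:R) => N N0; field; exact: N0.
Qed.

Lemma weight_int_laguerreM_top (R : realType) (a : R) n (q : {poly R}) :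
  -1 < a -> (size q <= n.+1)%N ->
  weight_int a (horner (laguerre n a * q)) =
  q`_n * ((-1) ^+ n * n`!%:R * laguerre_norm n a * weight_int a (horner 1)).
Proof.
move=> a1 qn; have -> : q = (q`_n) *: 'X^n + (q - (q`_n) *: 'X^n).
  by rewrite addrC subrK.
rewrite mulrDr weight_intD// -(scalerAr _ (laguerre _ _)) weight_intZ// weight_int_laguerre_lead//.
rewrite weight_int_laguerreM// ?addr0; last first.
  apply/leq_sizeP => j; rewrite leq_eqVlt => /predU1P[<-|nj].
    by rewrite coefB coefZ coefXn eqxx mulr1 subrr.
  rewrite coefB coefZ coefXn gtn_eqF// mulr0 subr0.
  by apply: (leq_sizeP _ _ qn).
by congr (_ * _); rewrite coefD coefB coefZ coefXn eqxx mulr1 subrr addr0.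
Qed.

Lemma weight_int_laguerre_sqr (R : realType) (a : R) n : -1 < a ->
  weight_int a (horner (laguerre n a ^+ 2)) =
  laguerre_norm n a * weight_int a (horner 1).
Proof.
move=> a1; rewrite expr2 weight_int_laguerreM_top ?size_laguerre//.
rewrite coef_laguerre_diag//.
have -> : (-1) ^+ n / n`!%:R * ((-1) ^+ n * n`!%:R * laguerre_norm n a * weight_int a (horner 1))
  = ((-1) ^+ n * (-1) ^+ n) * (laguerre_norm n a * weight_int a (horner 1)) :> R.
  by field; exact: natr_fact_neq0.
by rewrite -exprD addnn -mul2n exprM sqrrN expr1n expr1n mul1r.
Qed.

Lemma le_weight_int (R : realType) (a : R) (f g : R -> R) :
  lebesgue_measure.-integrable `[(0:R), +oo[
    (EFin \o (fun x => laguerre_weight a x * f x)) ->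
  lebesgue_measure.-integrable `[(0:R), +oo[
    (EFin \o (fun x => laguerre_weight a x * g x)) ->
  (forall x, 0 <= x -> f x <= g x) -> weight_int a f <= weight_int a g.
Proof.
move=> fi gi fg; apply: le_Rintegral => // x /=; rewrite in_itv/= andbT => x0.
by rewrite ler_wpM2l ?laguerre_weight_ge0// fg.
Qed.

Lemma integrable_weight_polyV (R : realType) (a u : R) (p : {poly R}) :
  -1 < a -> 0 < u ->
  lebesgue_measure.-integrable `[(0:R), +oo[
    (EFin \o (fun x => laguerre_weight a x * (p.[x] / (x + u)))).
Proof.
move=> a1 u0; have [C C0 HC] := horner_bound p.
apply: (@integrable_weightM _ _ (C / u) (size p)) => //.
  apply: measurable_funM; first exact: measurable_horner.
  apply: subspace_continuous_measurable_fun => //.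
  apply: continuous_in_subspaceT => x; rewrite inE/= in_itv/= andbT => x0.
  eapply derive_continuous; apply: drvV; first by rewrite gt_eqF// ltr_wpDl.
  by apply: drvD; [exact: drv_id|exact: drvC].
move=> x x0; rewrite normrM mulrAC ler_pM// ?HC// ger0_norm ?invr_ge0; last by lra.
by rewrite lef_pV2 ?posrE//; lra.
Qed.

(** * Decay of the integrals of L_n(x)^2 / (x + u) *)

(** What remains of the kernel L_n(x)^2 / (L_n(z)^2 (z - x)) of the Hermite remainder after
    integration in x, with z replaced by [- u] and up to the factor L_n(-u)^2. By orthogonality it
    is L_n(-u) times the function of the second kind. *)
Definition laguerre_resolvent (R : realType) n (a u : R) : R :=
  weight_int a (fun x => (laguerre n a).[x] ^+ 2 / (x + u)).

(** An a priori bound without exponential decay; it makes the remainder of the telescoping sum in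
    [laguerre_resolvent_bound] vanish in the limit. *)
Lemma laguerre_resolvent_le (R : realType) n (a u : R) : -1 < a -> 0 < u ->
  laguerre_resolvent n a u <= laguerre_norm n a * weight_int a (horner 1) / u.
Proof.
move=> a1 u0; rewrite -weight_int_laguerre_sqr// mulrC -weight_intZ//.
apply: le_weight_int; last first.
- by move=> x x0; rewrite (hornerZ _ (_ ^+ 2)) horner_exp mulrC ler_wpM2r ?sqr_ge0// lef_pV2 ?posrE//; lra.
- exact: integrable_weight_poly.
- have := @integrable_weight_polyV R a u (laguerre n a ^+ 2) a1 u0.
  by under [X in _ -> integrable _ _ (_ \o X)]eq_fun do rewrite -horner_exp.
Qed.

(** The difference of L_n/L_n(-u) and L_{n+1}/L_{n+1}(-u) vanishes at -u, so it equals (x + u) S(x)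
    with S of degree at most n. The difference of their squares, divided by x + u, is S times their
    sum; orthogonality leaves only the coefficient of x^n in S, paired with L_n. *)
Lemma laguerre_resolvent_step (R : realType) n (a u : R) : -1 < a -> 0 < u ->
  laguerre_resolvent n a u / (laguerre n a).[- u] ^+ 2 =
  laguerre_resolvent n.+1 a u / (laguerre n.+1 a).[- u] ^+ 2 +
  laguerre_norm n a * weight_int a (horner 1)
    / (n.+1%:R * (laguerre n a).[- u] * (laguerre n.+1 a).[- u]).
Proof.
move=> a1 u0.
have q0 := horner_laguerreN_gt0 n a1 (ltW u0).
have q1 := horner_laguerreN_gt0 n.+1 a1 (ltW u0).
set l0 := (laguerre n a).[- u] in q0 *; set l1 := (laguerre n.+1 a).[- u] in q1 *.
pose p := l0^-1 *: laguerre n a - l1^-1 *: laguerre n.+1 a.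
have : root p (- u).
  rewrite /root /p hornerD hornerN !(hornerZ _ (laguerre _ _)) -/l0 -/l1.
  by rewrite !mulVf ?subrr// gt_eqF.
move=> /factor_theorem[S]; rewrite polyCN opprK => pS.
have sS : (size S <= n.+1)%N.
  have [->|S0] := eqVneq S 0; first by rewrite size_poly0.
  have := congr1 (fun q : {poly R} => size q) pS; rewrite size_Mmonic ?monicXaddC//.
  rewrite size_XaddC addn2 /= => sp; rewrite -ltnS -sp.
  rewrite (leq_trans (size_polyD _ _))// geq_max size_polyN.
  by rewrite !(leq_trans (size_scale_leq _ (laguerre _ _))) ?size_laguerre.
have Sn : S`_n = - l1^-1 * ((-1) ^+ n.+1 / n.+1`!%:R).
  have <- : (S * ('X + u%:P))`_n.+1 = S`_n.
    by rewrite mulrDr coefD coefMX /= coefMC (leq_sizeP _ _ sS n.+1)// mul0r addr0.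
  rewrite -pS /p coefB !(coefZ _ (laguerre _ _)) coef_laguerre_diag//.
  by rewrite coef_laguerre_gt//; ring.
pose s := l0^-1 *: laguerre n a + l1^-1 *: laguerre n.+1 a.
have i0 m : lebesgue_measure.-integrable `[(0:R), +oo[
    (EFin \o (fun x => laguerre_weight a x * ((laguerre m a).[x] ^+ 2 / (x + u)))).
  have := @integrable_weight_polyV R a u (laguerre m a ^+ 2) a1 u0.
  by under [X in _ -> integrable _ _ (_ \o X)]eq_fun do rewrite -horner_exp.
have H : laguerre_resolvent n a u / l0 ^+ 2 - laguerre_resolvent n.+1 a u / l1 ^+ 2
   = weight_int a (horner (S * s)).
  have iZ m (c : R) : lebesgue_measure.-integrable `[(0:R), +oo[
    (EFin \o (fun x => laguerre_weight a x * ((laguerre m a).[x] ^+ 2 / (x + u)) * c)).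
    by apply: integrable_mulr => //; exact: i0.
  rewrite /laguerre_resolvent /weight_int -!RintegralZr// -RintegralB//.
  apply: eq_Rintegral => x; rewrite inE/= in_itv/= andbT => x0.
  have xu : x + u != 0 by rewrite gt_eqF// ltr_wpDl.
  have := congr1 (fun q : {poly R} => q.[x]) pS.
  rewrite /p hornerM !hornerD hornerN !(hornerZ _ (laguerre _ _)) hornerX hornerC => e.
  have Sx : S.[x] = (l0^-1 * (laguerre n a).[x] - l1^-1 * (laguerre n.+1 a).[x]) / (x + u).
    by rewrite e mulfK.
  rewrite hornerM Sx /s hornerD !(hornerZ _ (laguerre _ _)).
  by field; rewrite xu !gt_eqF.
apply/eqP; rewrite addrC -subr_eq H; apply/eqP.
rewrite /s mulrDr weight_intD// -!(scalerAr _ S (laguerre _ _)) !weight_intZ//.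
rewrite ![S * _]mulrC weight_int_laguerreM_top// weight_int_laguerreM// mulr0 addr0.
rewrite Sn factS natrM exprS.
have N0 : n.+1%:R != 0 :> R by rewrite pnatr_eq0.
have F0 := natr_fact_neq0 R n; have S0 := signr_neq0 R n.
have SS : (-1) ^+ n * (-1) ^+ n = 1 :> R.
  by rewrite -exprD addnn -mul2n exprM sqrrN expr1n expr1n.
move: (n.+1%:R) (n`!%:R) N0 F0 => N F N0 F0.
transitivity ((-1) ^+ n * (-1) ^+ n * (laguerre_norm n a * weight_int a (horner 1)
   / (N * l0 * l1))); last by rewrite SS mul1r.
by field; rewrite N0 F0 !gt_eqF.
Qed.

(** Since sqrt(n+1) - sqrt n >= 1 / (2 sqrt(n+1)), the exponential loses a proportion of order 1 /
    sqrt(n+1) at each step. *)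
Lemma expRN_sqrt_telescope (R : realType) (rho : R) n : 0 < rho ->
  expR (- (4 * rho * Num.sqrt n%:R)) / Num.sqrt n.+1%:R <=
  (1 + 2 * rho) / (2 * rho) * (expR (- (4 * rho * Num.sqrt n%:R))
     - expR (- (4 * rho * Num.sqrt n.+1%:R))).
Proof.
move=> r0; have w2 : Num.sqrt n.+1%:R ^+ 2 = Num.sqrt n%:R ^+ 2 + 1 :> R.
  by rewrite !sqr_sqrtr ?ler0n// natr1.
have v0 : 0 <= Num.sqrt n%:R :> R by exact: sqrtr_ge0.
have w1 : 1 <= Num.sqrt n.+1%:R :> R by rewrite -[leLHS]sqrtr1 ler_sqrt// ler1n.
move: (Num.sqrt n%:R) (Num.sqrt n.+1%:R) v0 w1 w2 => v w v0 w1 w2.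
have vw : v <= w by rewrite -ler_sqr ?nnegrE; lra.
have E0 := expR_gt0 (- (4 * rho * v)); set E := expR _ in E0 *.
have -> : expR (- (4 * rho * w)) = E * expR (- (4 * rho * (w - v))).
  by rewrite -expRD; congr expR; ring.
rewrite -[X in _ <= _ * (X - _)]mulr1 -mulrBr mulrCA ler_pM2l//.
have h : 2 * rho / w <= 4 * rho * (w - v).
  rewrite ler_pdivrMr; last by lra.
  have : 1 <= 2 * (w - v) * w.
    have -> : 2 * (w - v) * w = w ^+ 2 - v ^+ 2 + (w - v) ^+ 2 by ring.
    by have := sqr_ge0 (w - v); lra.
  have -> : 4 * rho * (w - v) * w = 2 * rho * (2 * (w - v) * w) by ring.
  by move=> h; rewrite -[leLHS]mulr1 ler_pM2l//; lra.
have h2 : expR (- (4 * rho * (w - v))) <= (1 + 2 * rho / w)^-1.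
  rewrite expRN lef_pV2 ?posrE ?expR_gt0//; last first.
    by rewrite addr_gt0// divr_gt0//; lra.
  by apply: le_trans (expR_ge1Dx _); lra.
have : (1 + 2 * rho) / (2 * rho) * (1 - (1 + 2 * rho / w)^-1) <=
   (1 + 2 * rho) / (2 * rho) * (1 - expR (- (4 * rho * (w - v)))).
  by apply: ler_wpM2l; [apply: divr_ge0|]; lra.
apply: le_trans.
have -> : (1 + 2 * rho) / (2 * rho) * (1 - (1 + 2 * rho / w)^-1) =
  (1 + 2 * rho) / (w + 2 * rho) by field; rewrite !gt_eqF//; lra.
rewrite ler_pdivlMr; last by lra.
rewrite mulrC ler_pdivrMr; last by lra.
have : 2 * rho * 1 <= 2 * rho * w by rewrite ler_pM2l//; lra.
lra.
Qed.

Lemma weight_int1_ge0 (R : realType) (a : R) : 0 <= weight_int a (horner 1).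
Proof.
apply: Rintegral_ge0 => x _; rewrite hornerE mulr1; exact: laguerre_weight_ge0.
Qed.

(** Let S_k be the quotient of [laguerre_resolvent] by L_k(-rho^2)^2, and E_k = e^{-4 rho sqrt k}.
    By [laguerre_resolvent_step], [laguerre_sq_growth] and [expRN_sqrt_telescope], S_k - S_{k+1} <=
    C2 (E_k - E_{k+1}). As S_k tends to 0, summation from n to infinity gives S_n <= C2 E_n. *)
Lemma laguerre_resolvent_bound (R : realType) (a rho : R) : -1 < a -> 0 < rho ->
  exists2 C : R, 0 <= C & exists n0, forall n, (n0 <= n)%N ->
    laguerre_resolvent n a (rho ^+ 2)
      <= C * expR (- (4 * rho * Num.sqrt n%:R)) * (laguerre_sq n a).[rho] ^+ 2.
Proof.
move=> a1 r0; have [C [C0 [n1 HC]]] := laguerre_sq_growth a1 r0.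
have u0 : 0 < rho ^+ 2 by rewrite exprn_gt0.
pose I1 := weight_int a (horner 1).
have I10 : 0 <= I1 by exact: weight_int1_ge0.
pose C2 := I1 * C * ((1 + 2 * rho) / (2 * rho)).
have C20 : 0 <= C2.
  by apply: mulr_ge0; [exact: mulr_ge0|apply: divr_ge0; lra].
exists C2 => //; exists (maxn n1 1) => n hn.
have n1n : (n1 <= n)%N by apply: leq_trans hn; exact: leq_maxl.
pose S k := laguerre_resolvent k a (rho ^+ 2) / (laguerre_sq k a).[rho] ^+ 2.
pose E k : R := expR (- (4 * rho * Num.sqrt k%:R)).
have norm_le k : (n1 <= k)%N -> laguerre_norm k a / (laguerre_sq k a).[rho] ^+ 2
    <= C * Num.sqrt k%:R * E k.
  move=> hk; have [h _] := HC k hk; have Q0 := laguerre_sq_gt0 k rho a1.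
  rewrite ler_pdivrMr ?exprn_gt0// /E expRN mulrAC ler_pdivlMr ?expR_gt0//.
have step k : (n1 <= k)%N -> S k - C2 * E k <= S k.+1 - C2 * E k.+1.
  move=> hk; have [_ mono] := HC k hk.
  have := laguerre_resolvent_step k a1 u0; rewrite -!horner_laguerre_sq -/(S k) -/(S k.+1) -/I1.
  have Q0 := laguerre_sq_gt0 k rho a1; have Q1 := laguerre_sq_gt0 k.+1 rho a1.
  have N0 := laguerre_norm_gt0 k a1; have nl := norm_le k hk.
  move=> ->; suff : laguerre_norm k a * I1 / (k.+1%:R * (laguerre_sq k a).[rho] * (laguerre_sq k.+1 a).[rho])
     <= C2 * (E k - E k.+1).
    have aux (x y z t : R) : y <= z - t -> x + y - z <= x - t by lra.
    by rewrite mulrBr; exact: aux.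
  have tel := expRN_sqrt_telescope k r0; rewrite -/(E k) -/(E k.+1) in tel.
  have kw : k.+1%:R = Num.sqrt k.+1%:R ^+ 2 :> R by rewrite sqr_sqrtr ?ler0n.
  have vw : Num.sqrt k%:R <= Num.sqrt k.+1%:R :> R by rewrite ler_sqrt// ?ler_nat.
  have w0 : 0 < Num.sqrt k.+1%:R :> R by rewrite sqrtr_gt0.
  rewrite kw; move: (Num.sqrt k.+1%:R) w0 vw tel => w w0 vw tel.
  apply: (@le_trans _ _ (I1 * C * (E k / w))); last first.
    by rewrite /C2 -[leRHS]mulrA ler_wpM2l ?mulr_ge0.
  apply: (@le_trans _ _ (I1 * (laguerre_norm k a / (laguerre_sq k a).[rho] ^+ 2) / w ^+ 2)).
    move: Q0 Q1 mono N0; set q := (laguerre_sq k a).[rho].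
    set q' := (laguerre_sq k.+1 a).[rho]; set N := laguerre_norm k a => Q0 Q1 mono N0.
    have -> : N * I1 / (w ^+ 2 * q * q') = I1 * N / (w ^+ 2 * q) * q'^-1.
      by field; rewrite !gt_eqF.
    have -> : I1 * (N / q ^+ 2) / w ^+ 2 = I1 * N / (w ^+ 2 * q) * q^-1.
      by field; rewrite !gt_eqF.
    apply: ler_wpM2l; last by rewrite lef_pV2.
    by apply: divr_ge0; [rewrite mulr_ge0// ltW|rewrite mulr_ge0 ?exprn_ge0// ltW].
  have -> : I1 * C * (E k / w) = I1 * (C * w * E k) / w ^+ 2.
    by field; rewrite gt_eqF.
  rewrite ler_pM2r ?invr_gt0 ?exprn_gt0// ler_wpM2l// (le_trans nl)//.
  by rewrite ler_wpM2r ?expR_ge0// ler_wpM2l.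
have mono k : (n <= k)%N -> S n - C2 * E n <= S k - C2 * E k.
  move=> hk; rewrite -(subnK hk); elim: (k - n)%N => [//|j IH].
  by rewrite addSn (le_trans IH)// step// (leq_trans n1n)// leq_addl.
have Q0 := laguerre_sq_gt0 n rho a1.
rewrite -ler_pdivrMr ?exprn_gt0// -subr_le0 -/(S n) -/(E n).
(* Passage to the limit: the a priori bound and the growth estimate give S_k <= B / sqrt k, hence
   S_k <= e for a suitable k >= n. *)
apply/ler_addgt0Pl => e e0; rewrite addr0.
have [K K0 HK] := expRN_pow_le R 2.
pose B := (I1 * C / rho ^+ 2) * (K / (16 * rho ^+ 2)).
have B0 : 0 <= B by rewrite mulr_ge0 ?divr_ge0 ?mulr_ge0// ltW// ?mulr_gt0.
have [N HN] := sqrtn_ge (1 + B / e).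
pose k := maxn N n.
have hk := HN k (leq_maxl _ _); have nk : (n <= k)%N by exact: leq_maxr.
apply: (le_trans (mono k nk)).
have Ek : 0 <= C2 * E k by rewrite mulr_ge0// expR_ge0.
suff : S k <= e by lra.
have Qk := laguerre_sq_gt0 k rho a1.
have := norm_le k (leq_trans n1n nk).
have := laguerre_resolvent_le k a1 u0; rewrite -/I1 => h1 h2.
have : S k <= I1 / rho ^+ 2 * (laguerre_norm k a / (laguerre_sq k a).[rho] ^+ 2).
  have -> : I1 / rho ^+ 2 * (laguerre_norm k a / (laguerre_sq k a).[rho] ^+ 2) =
     (laguerre_norm k a * I1 / rho ^+ 2) / (laguerre_sq k a).[rho] ^+ 2 by ring.
  by rewrite ler_pM2r// invr_gt0 exprn_gt0.
move=> h3; apply: (le_trans h3).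
have Ip : 0 <= I1 / rho ^+ 2 by rewrite divr_ge0// ltW.
apply: (le_trans (ler_wpM2l Ip h2)).
have be : 0 <= B / e by rewrite divr_ge0// ltW.
move: hk; rewrite /E; move: (Num.sqrt k%:R) => w hk.
have w0 : 0 < w by lra.
have y0 : 0 <= 4 * rho * w by rewrite !mulr_ge0// ltW.
have := HK _ y0; move: (expR _) => X hX.
have : I1 / rho ^+ 2 * (C * w * X) <= B / w.
  rewrite ler_pdivlMr// /B.
  have -> : I1 / rho ^+ 2 * (C * w * X) * w =
    (I1 * C / rho ^+ 2) * (((4 * rho * w) ^+ 2 * X) / (16 * rho ^+ 2)).
    by field; rewrite gt_eqF.
  apply: ler_wpM2l; first by apply: divr_ge0; [exact: mulr_ge0|exact: ltW].
  by rewrite ler_pM2r ?invr_gt0 ?mulr_gt0 ?exprn_gt0.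
move=> h4; apply: (le_trans h4); rewrite ler_pdivrMr// mulrC -ler_pdivrMr//; lra.
Qed.

(** * Laguerre polynomials along vertical lines Re s = r *)

Lemma log_deriv_prod (K : fieldType) (rs : seq K) (s : K) :
  all (fun r => s != r) rs ->
  let P := \prod_(r <- rs) ('X - r%:P) in
  P^`().[s] = P.[s] * \sum_(r <- rs) (s - r)^-1 /\
  P^`()^`().[s] = P.[s] * ((\sum_(r <- rs) (s - r)^-1) ^+ 2
                           - \sum_(r <- rs) (s - r)^-1 ^+ 2).
Proof.
elim: rs => [|r rs IH] /=.
  by rewrite !big_nil -polyC1 !(derivC, deriv0) !horner0 hornerC; split; ring.
move=> /andP[sr /IH /= []]; rewrite !big_cons; set P := \prod_(_ <- _) _ => H1 H2.
have s0 : s - r != 0 by rewrite subr_eq0.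
have D1 : (('X - r%:P) * P)^`() = P + ('X - r%:P) * P^`().
  by rewrite derivM derivXsubC mul1r.
rewrite D1 derivD derivM derivXsubC mul1r.
rewrite !(hornerXsubC, hornerM, hornerD) H1 H2.
by split; field.
Qed.

(** The imaginary parts of the zeros of s |-> P(-s^2), when P has the nonnegative zeros [xs]. *)
Definition strip_roots (R : realType) (xs : seq R) : seq R :=
  [seq Num.sqrt x | x <- xs] ++ [seq - Num.sqrt x | x <- xs].

(* For a polynomial [c *: \prod_(x <- xs) ('X - x%:P)] with roots [x >= 0],
   [strip_mod xs r t] is the squared modulus at [- (r + i t)^2], up to [c^2]. *)
Definition strip_mod (R : realType) (xs : seq R) (r t : R) : R :=
  \prod_(y <- strip_roots xs) (r ^+ 2 + (t - y) ^+ 2).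

Lemma strip_modE (R : realType) (xs : seq R) (r t : R) :
  strip_mod xs r t =
  \prod_(x <- xs) ((r ^+ 2 + (t - Num.sqrt x) ^+ 2) * (r ^+ 2 + (t + Num.sqrt x) ^+ 2)).
Proof.
rewrite /strip_mod /strip_roots big_cat /= !big_map -big_split /=.
by apply: eq_bigr => x _; rewrite opprK.
Qed.

Lemma strip_mod_gt0 (R : realType) (xs : seq R) (r t : R) : 0 < r ->
  0 < strip_mod xs r t.
Proof.
move=> r0; apply: prodr_gt0 => y _.
by rewrite ltr_pwDl ?sqr_ge0// exprn_gt0.
Qed.

(** At s = r + it the logarithmic derivative, the sum of 1 / (s - iy) over [strip_roots xs], is
    [strip_B - i strip_A]. Moreover [strip_A] is half the logarithmic derivative of [strip_mod] in
    t. *)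
Definition strip_A (R : realType) (xs : seq R) (r t : R) : R :=
  \sum_(y <- strip_roots xs) (t - y) / (r ^+ 2 + (t - y) ^+ 2).
Definition strip_B (R : realType) (xs : seq R) (r t : R) : R :=
  \sum_(y <- strip_roots xs) r / (r ^+ 2 + (t - y) ^+ 2).

Lemma drv_strip_mod (R : realType) (xs : seq R) (r t : R) : 0 < r ->
  deriv_at (strip_mod xs r) t (strip_mod xs r t * (2 * strip_A xs r t)).
Proof.
move=> r0; rewrite /strip_mod /strip_A; elim: (strip_roots xs) => [|y ys IH].
  rewrite !big_nil mulr0 mulr0.
  have -> : (fun t : R => \prod_(y <- [::]) (r ^+ 2 + (t - y) ^+ 2)) = (fun _ => 1).
    by apply/funext => u; rewrite big_nil.
  exact: drvC.
have -> : (fun t => \prod_(y0 <- y :: ys) (r ^+ 2 + (t - y0) ^+ 2)) =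
  (fun t => (r ^+ 2 + (t - y) ^+ 2) * \prod_(y0 <- ys) (r ^+ 2 + (t - y0) ^+ 2)).
  by apply/funext => u; rewrite big_cons.
rewrite !big_cons; apply: drv_eq.
  apply: drvM IH; apply: drvD; first exact: drvC.
  by apply: drv_X; apply: drvB; [exact: drv_id|exact: drvC].
have : r ^+ 2 + (t - y) ^+ 2 != 0.
  by rewrite gt_eqF// ltr_pwDl ?sqr_ge0// exprn_gt0.
by rewrite /= expr1 => h; field.
Qed.

Lemma strip_B_ge0 (R : realType) (xs : seq R) (r t : R) : 0 < r ->
  0 <= strip_B xs r t.
Proof.
move=> r0; apply: sumr_ge0 => y _.
by rewrite divr_ge0 ?(ltW r0)// addr_ge0 ?sqr_ge0.
Qed.

Lemma complex_sum (R : realType) (I : Type) (rs : seq I) (f g : I -> R) :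
  \sum_(i <- rs) (f i +i* g i) = (\sum_(i <- rs) f i) +i* (\sum_(i <- rs) g i).
Proof.
elim: rs => [|i rs IH]; first by rewrite !big_nil.
by rewrite !big_cons IH.
Qed.

Lemma map_laguerre_sq (R : realType) n (a c : R) (xs : seq R) :
  all (fun x => 0 <= x) xs ->
  laguerre n a = c *: \prod_(x <- xs) ('X - x%:P) ->
  map_poly (real_complex R) (laguerre_sq n a) =
  ((-1) ^+ size xs * c%:C) *: \prod_(y <- [seq 0 +i* y | y <- strip_roots xs]) ('X - y%:P).
Proof.
move=> xs0 E; rewrite /laguerre_sq E comp_polyZ map_polyZ /=.
have -> : \prod_(x <- xs) ('X - x%:P) \Po - 'X^2 =
    \prod_(x <- xs) (- ('X^2 + x%:P)).
  rewrite (big_morph _ (fun p q => comp_polyM p q (- 'X^2)) (comp_polyC _ _)).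
  apply: eq_bigr => x _.
  by rewrite comp_polyB comp_polyX comp_polyC opprD.
rewrite (mulrC _ c%:C) -!mul_polyC polyCM -mulrA; congr (_ * _).
rewrite /strip_roots map_cat big_cat /= !big_map -big_split /= {E}.
elim: xs xs0 => [_|x xs IH /= /andP[x0 xs0]].
  by rewrite !big_nil rmorph1 expr0 polyC1 mul1r.
rewrite !big_cons rmorphM /= IH// (exprS (-1)) polyCM.
have -> : map_poly (real_complex R) (- ('X^2 + x%:P)) =
   - (('X - (0 +i* Num.sqrt x)%:P) * ('X - (0 +i* - Num.sqrt x)%:P)).
  rewrite rmorphN rmorphD /= map_polyXn map_polyC /=; congr (- _).
  have -> : x%:C = - (0 +i* Num.sqrt x) ^+ 2 :> R[i].
    rewrite expr2; apply/eqP; rewrite eq_complex /=.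
    by rewrite !mul0r !mulr0 addr0 oppr0 sub0r opprK eqxx andbT -expr2 sqr_sqrtr.
  have -> : (0 +i* - Num.sqrt x) = - (0 +i* Num.sqrt x) :> R[i].
    by apply/eqP; rewrite eq_complex /= oppr0 !eqxx.
  by rewrite !polyCN polyC_exp; ring.
by rewrite polyCN polyC1; ring.
Qed.

Lemma complex_invE (R : realType) (u v : R) : 0 < u ->
  (u +i* v)^-1 = (u / (u ^+ 2 + v ^+ 2)) +i* (- v / (u ^+ 2 + v ^+ 2)).
Proof.
move=> u0; have D0 : u ^+ 2 + v ^+ 2 != 0.
  by rewrite gt_eqF// ltr_pwDl ?sqr_ge0// exprn_gt0.
have z0 : u +i* v != 0 by rewrite eq_complex /= negb_and gt_eqF.
apply: (mulfI z0); rewrite mulfV//; apply/eqP; rewrite eq_complex /=.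
by apply/andP; split; apply/eqP; field.
Qed.

(** Real and imaginary parts of m^2 + ((2a+1)/s + 2s) m = 4n + E at s = r + it, where m = B - iA and
    E = E1 + i E2 is the sum of the (s - iy)^{-2}. The latter is at most the sum of the |s -
    iy|^{-2}, which equals B / r. The quantity S comes from (a + 1/2)/s = S (r - it). *)
Lemma strip_riccati (R : realType) n (a c r t : R) (xs : seq R) : -1 < a ->
  0 < r -> c != 0 -> all (fun x => 0 <= x) xs ->
  laguerre n a = c *: \prod_(x <- xs) ('X - x%:P) ->
  let A := strip_A xs r t in let B := strip_B xs r t in
  let S := (a + 1 / 2) / (r ^+ 2 + t ^+ 2) in
  exists E1 E2, [/\ `|E1| <= B / r, `|E2| <= B / r,
    B ^+ 2 - A ^+ 2 + 2 * (r * (1 + S) * B + t * (1 - S) * A) = 4 * n%:R + E1 &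
    - 2 * (A * B) + 2 * (t * (1 - S) * B - r * (1 + S) * A) = E2].
Proof.
move=> a1 r0 c0 xs0 E A B S.
have dn0 y : 0 < r ^+ 2 + (t - y) ^+ 2 by rewrite ltr_pwDl ?sqr_ge0// exprn_gt0.
pose E1 := \sum_(y <- strip_roots xs) (r ^+ 2 - (t - y) ^+ 2) / (r ^+ 2 + (t - y) ^+ 2) ^+ 2.
pose E2 := \sum_(y <- strip_roots xs) - (2 * r * (t - y)) / (r ^+ 2 + (t - y) ^+ 2) ^+ 2.
have BE : B / r = \sum_(y <- strip_roots xs) (r ^+ 2 + (t - y) ^+ 2)^-1.
  rewrite mulr_suml; apply: eq_bigr => y _; field; rewrite !gt_eqF//.
have H : (B +i* - A) ^+ 2 + 2%:C * ((r * (1 + S)) +i* (t * (1 - S))) * (B +i* - A)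
    = (4 * n%:R + E1) +i* E2.
  pose ys := [seq 0 +i* y | y <- strip_roots xs].
  pose s := r +i* t; have s0 : s != 0 by rewrite eq_complex /= negb_and gt_eqF.
  have sy : all (fun y => s != y) ys.
    by apply/allP => y /mapP[y' _ ->]; rewrite eq_complex /= negb_and gt_eqF.
  have inv y : (s - (0 +i* y))^-1 =
     (r / (r ^+ 2 + (t - y) ^+ 2)) +i* (- ((t - y) / (r ^+ 2 + (t - y) ^+ 2))).
    rewrite (_ : s - (0 +i* y) = r +i* (t - y)); last first.
      by apply/eqP; rewrite eq_complex /= subr0 !eqxx.
    by rewrite complex_invE// mulNr.
  have mE : \sum_(y <- ys) (s - y)^-1 = B +i* - A.
    rewrite /ys big_map; under eq_bigr do rewrite inv.
    by rewrite complex_sum sumrN.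
  have eE : \sum_(y <- ys) (s - y)^-1 ^+ 2 = E1 +i* E2.
    rewrite /ys big_map -complex_sum; apply: eq_bigr => y _; rewrite inv expr2.
    have h := dn0 y; apply/eqP; rewrite eq_complex /=.
    by apply/andP; split; apply/eqP; field; rewrite gt_eqF.
  have := log_deriv_prod sy; rewrite mE eE /=; set P := \prod_(_ <- ys) _ => -[P1 P2].
  have P0 : P.[s] != 0.
    rewrite /P horner_prod prodf_seq_neq0; apply/allP => y yys /=.
    by rewrite hornerXsubC subr_eq0; exact: (allP sy).
  have := congr1 (map_poly (real_complex R)) (laguerre_sq_ode n a1).
  rewrite rmorphD !rmorphM /= -!deriv_map.
  have mX : map_poly (real_complex R) 'X = 'X by exact: map_polyX.
  rewrite mX !map_polyZ /= rmorphD (rmorphM _ 'X (laguerre_sq n a)) /= mX.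
  rewrite map_polyZ /= map_polyC map_polyXn (map_laguerre_sq xs0 E) -/ys -/P.
  set k := _ * c%:C.
  have k0 : k != 0.
    by rewrite mulf_neq0 ?expf_neq0 ?oppr_eq0 ?oner_eq0// (fmorph_eq0 (real_complex R)).
  rewrite !derivZ => /(congr1 (fun p => p.[s])).
  rewrite !(hornerD, hornerM, hornerX, hornerC, hornerXn, hornerZ) P1 P2 => ode.
  have -> : (4 * n%:R + E1) +i* E2 = (4 * n%:R)%:C + (E1 +i* E2).
    by apply/eqP; rewrite eq_complex /= add0r !eqxx.
  have hS : s * (2%:C * ((r * (1 + S)) +i* (t * (1 - S)))) = (2 * a + 1)%:C + 2%:C * (s * s).
    have h : S * (r ^+ 2 + t ^+ 2) = a + 1 / 2.
      by rewrite /S divfK// gt_eqF// ltr_pwDl ?sqr_ge0// exprn_gt0.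
    apply/eqP; rewrite eq_complex /=; apply/andP; split; apply/eqP.
      have -> : 2 * a + 1 = 2 * (S * (r ^+ 2 + t ^+ 2)) by rewrite h; field.
      by ring.
    by ring.
  have kPs : s * k * P.[s] != 0 by apply: mulf_neq0 => //; exact: mulf_neq0.
  move: ode; rewrite -[_ + 2%:C * (s * s)]/((2 * a + 1)%:C + 2%:C * (s * s)) -hS.
  set m := B +i* - A; set e := E1 +i* E2; set W := (r * (1 + S)) +i* (t * (1 - S)).
  set N := (4 * n%:R)%:C; set two := 2%:C; clearbody m e W N two => ode.
  apply: (mulfI kPs); rewrite [in RHS]mulrDr.
  have -> : s * k * P.[s] * N = N * (s * (k * P.[s])) by ring.
  by rewrite -ode; ring.
exists E1, E2; split.
- rewrite BE (le_trans (ler_norm_sum _ _ _))//; apply: ler_sum => y _.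
  rewrite normrM [X in _ * X]gtr0_norm ?invr_gt0 ?exprn_gt0//.
  rewrite ler_pdivrMr ?exprn_gt0//.
  have -> : (r ^+ 2 + (t - y) ^+ 2)^-1 * (r ^+ 2 + (t - y) ^+ 2) ^+ 2 = r ^+ 2 + (t - y) ^+ 2.
    by field; rewrite gt_eqF.
  by rewrite ler_norml; have := sqr_ge0 (t - y); have := sqr_ge0 r; lra.
- rewrite BE (le_trans (ler_norm_sum _ _ _))//; apply: ler_sum => y _.
  rewrite normrM [X in _ * X]gtr0_norm ?invr_gt0 ?exprn_gt0//.
  rewrite ler_pdivrMr ?exprn_gt0//.
  have -> : (r ^+ 2 + (t - y) ^+ 2)^-1 * (r ^+ 2 + (t - y) ^+ 2) ^+ 2 = r ^+ 2 + (t - y) ^+ 2.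
    by field; rewrite gt_eqF.
  rewrite ler_norml; have := sqr_ge0 (r - (t - y)); have := sqr_ge0 (r + (t - y)).
  by lra.
- by have := congr1 (@complex.Re R) H; rewrite expr2 /= => <-; ring.
- by have := congr1 (@complex.Im R) H; rewrite expr2 /= => <-; ring.
Qed.

Lemma strip_B_gt0 (R : realType) (xs : seq R) (r t : R) : 0 < r ->
  xs != [::] -> 0 < strip_B xs r t.
Proof.
move=> r0; case: xs => // x xs _; rewrite /strip_B /strip_roots /= big_cons.
have h y : 0 < r ^+ 2 + (t - y) ^+ 2 by rewrite ltr_pwDl ?sqr_ge0// exprn_gt0.
rewrite ltr_pwDl ?divr_gt0//; apply: sumr_ge0 => y _.
by rewrite divr_ge0 ?ltW.
Qed.

(* The imaginary part of the Riccati equation reads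
   [(B + c) A = d B - E2 / 2] with [|E2| <= B / r]. *)
Lemma strip_A_lower (R : realType) (a r : R) : -1 < a -> 0 < r ->
  exists C1 : R, 0 <= C1 /\ exists n0, forall n, (n0 <= n)%N ->
  forall (c : R) (xs : seq R), c != 0 -> all (fun x => 0 <= x) xs ->
  laguerre n a = c *: \prod_(x <- xs) ('X - x%:P) ->
  forall t, 0 <= t ->
   (t ^+ 2 <= n%:R -> t / 2 - C1 <= strip_A xs r t) /\
   (n%:R <= t ^+ 2 -> 0 <= strip_A xs r t).
Proof.
move=> a1 r0; pose q := a + 1 / 2.
pose kp := `|q| / (2 * r) + 1 / (2 * r).
have kp0 : 0 <= kp.
  by apply: addr_ge0; apply: divr_ge0 => //; lra.
pose cb := r * (1 + `|q| / r ^+ 2) + 1.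
have cb1 : 1 <= cb.
  by rewrite /cb lerDr mulr_ge0 ?addr_ge0 ?divr_ge0 ?sqr_ge0// ltW.
pose W := 8 * cb ^+ 2 + 2 * cb / r + (`|q| / (2 * r)) ^+ 2 * 2.
exists (2 * kp); split; first lra.
have [n0 Hn0] := sqrtn_ge (1 + kp + `|W|).
exists n0 => n /Hn0 hn c xs c0 xs0 E t t0.
have p1 := normr_ge0 W.
have w0 : 0 <= Num.sqrt n%:R :> R by exact: sqrtr_ge0.
have nE : n%:R = Num.sqrt n%:R ^+ 2 :> R by rewrite sqr_sqrtr ?ler0n.
have [E1 [E2 [hE1 hE2 re im]]] := strip_riccati t a1 r0 c0 xs0 E.
move: re im; rewrite -/q; set S := q / _; set A := strip_A _ _ _.
set B := strip_B _ _ _ => re im.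
have B0 : 0 <= B by exact: strip_B_ge0.
move: (Num.sqrt n%:R) w0 nE hn => w w0 nE hn.
have D0 : 0 < r ^+ 2 + t ^+ 2 by rewrite ltr_pwDl ?sqr_ge0// exprn_gt0.
pose d := t * (1 - S); pose cc := r * (1 + S).
have hS : `|S| <= `|q| / r ^+ 2.
  rewrite normrM [X in _ * X]gtr0_norm ?invr_gt0// ler_wpM2l//.
  by rewrite lef_pV2 ?posrE ?exprn_gt0// lerDl sqr_ge0.
have htS : `|t * S| <= `|q| / (2 * r).
  have -> : t * S = q * (t / (r ^+ 2 + t ^+ 2)) by rewrite /S; ring.
  rewrite normrM ler_wpM2l// ger0_norm; last by rewrite divr_ge0// ltW.
  rewrite ler_pdivrMr// mulrC ler_pdivlMr; last by lra.
  by have := sqr_ge0 (r - t); lra.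
have hd : `|d - t| <= `|q| / (2 * r).
  by rewrite (_ : d - t = - (t * S)) ?normrN// /d; ring.
have hc : `|cc| <= cb - 1.
  rewrite /cc /cb addrK normrM (gtr0_norm r0) ler_wpM2l ?(ltW r0)//.
  by rewrite (le_trans (ler_normD _ _))// normr1 lerD2l.
have {}im : (B + cc) * A = d * B - E2 / 2 by rewrite -im /d /cc; field.
have {}re : B ^+ 2 - A ^+ 2 + 2 * (cc * B + d * A) = 4 * n%:R + E1.
  by rewrite -re /d /cc; ring.
have [hE2a hE2b] : - (B / r) <= E2 /\ E2 <= B / r.
  by move: hE2; rewrite ler_norml => /andP.
have [hE1a hE1b] : - (B / r) <= E1 /\ E1 <= B / r.
  by move: hE1; rewrite ler_norml => /andP.
have [hda hdb] : t - `|q| / (2 * r) <= d /\ d <= t + `|q| / (2 * r).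
  by move: hd; rewrite ler_norml => /andP[]; lra.
have [hca hcb] : 1 - cb <= cc /\ cc <= cb - 1.
  by move: hc; rewrite ler_norml => /andP[]; lra.
pose g := d - 1 / (2 * r).
have hg : t - kp <= g by rewrite /g /kp; lra.
have hBA : B * g <= (B + cc) * A.
  rewrite im /g; have -> : B * (d - 1 / (2 * r)) = d * B - B / r / 2 by field; lra.
  lra.
split=> ht.
(* For small B the real part cannot balance: completing the square, - A^2 + 2dA <= d^2 <= 2t^2 +
   const <= 2n + const, and the terms in B are bounded, whereas the right-hand side is 4n up to a
   constant. *)
- have Bb : 2 * cb <= B.
    rewrite leNgt; apply/negP => Blt.
    have h1 : B / r <= 2 * cb / r by rewrite ler_pM2r ?invr_gt0// ltW.
    have h2 : B ^+ 2 <= 2 * cb * (2 * cb) by rewrite expr2 ler_pM// ltW.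
    have h3 : cc * B <= cb * (2 * cb).
      apply: (@le_trans _ _ (cb * B)); first by rewrite ler_wpM2r//; lra.
      by rewrite ler_wpM2l//; lra.
    have h4 : d ^+ 2 <= 2 * t ^+ 2 + 2 * (`|q| / (2 * r)) ^+ 2.
      have -> : 2 * t ^+ 2 + 2 * (`|q| / (2 * r)) ^+ 2 = (d ^+ 2 +
         2 * ((`|q| / (2 * r)) ^+ 2 - (d - t) ^+ 2)) + (d - 2 * t) ^+ 2.
        by ring.
      have h5 : (d - t) ^+ 2 <= (`|q| / (2 * r)) ^+ 2.
        rewrite -[leLHS]real_normK ?num_real// lerXn2r ?nnegrE//.
        by rewrite (le_trans _ hd).
      rewrite -addrA lerDl; apply: addr_ge0; last exact: sqr_ge0.
      by rewrite mulr_ge0// subr_ge0.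
    have h6 : W < 2 * n%:R.
      rewrite nE; apply: (le_lt_trans (ler_norm _)).
      have : w <= w ^+ 2 by rewrite expr2 ler_peMl//; lra.
      lra.
    have h7 := sqr_ge0 (A - d).
    rewrite /W in h6.
    have h8 : (A - d) ^+ 2 = A ^+ 2 - 2 * (d * A) + d ^+ 2 by ring.
    have h9 : 2 * cb * (2 * cb) = 4 * cb ^+ 2 by ring.
    have h10 : cb * (2 * cb) = 2 * cb ^+ 2 by ring.
    rewrite h8 in h7; rewrite h9 in h2; rewrite h10 in h3.
    move: re ht h1 h2 h3 h4 h6 h7 hE1a hE1b; clear.
    move: (B / r) (A ^+ 2) (d * A) (cc * B) (B ^+ 2) (cb ^+ 2) (2 * cb / r) => *.
    lra.
  have Bp : 0 < B by lra.
  have Bc0 : 0 < B + cc by lra.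
  (* [B / (B + cc)] lies between 1/2 and 2; which end is used depends on the sign of [g]. *)
  have [g0|/ltW g0] := leP 0 g.
    have : (B + cc) * (g / 2) <= (B + cc) * A.
      apply: le_trans hBA; have : cc * g <= B * g by rewrite ler_wpM2r//; lra.
      lra.
    rewrite ler_pM2l//; lra.
  have : (B + cc) * (2 * g) <= (B + cc) * A.
    apply: le_trans hBA.
    have : (B + cc) * (- (2 * g)) >= B * - g.
      have -> : (B + cc) * - (2 * g) = (2 * (B + cc)) * - g by ring.
      by rewrite ler_wpM2r ?oppr_ge0//; lra.
    by rewrite !mulrN lerN2.
  rewrite ler_pM2l//; lra.
- have wt : w <= t by rewrite -ler_sqr ?nnegrE// -nE.
  have g0 : 0 <= g by lra.
  have S1 : 0 <= 1 + S.
    have : - S <= 1.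
      have -> : - S = (- q) / (r ^+ 2 + t ^+ 2) by rewrite /S mulNr.
      rewrite ler_pdivrMr// mul1r.
      have : 1 <= t ^+ 2 by rewrite -(expr1n _ 2) ler_sqr ?nnegrE//; lra.
      by have := sqr_ge0 r; rewrite /q; lra.
    lra.
  have cc0 : 0 <= cc by rewrite mulr_ge0// ltW.
  have [xsE|xsn] := eqVneq xs [::].
    by rewrite /A xsE /strip_A /strip_roots big_nil.
  have Bp : 0 < B by exact: strip_B_gt0.
  have : 0 <= (B + cc) * A by apply: le_trans hBA; rewrite mulr_ge0.
  by rewrite pmulr_rge0//; lra.
Qed.

Lemma strip_modN (R : realType) (xs : seq R) (r t : R) :
  strip_mod xs r (- t) = strip_mod xs r t.
Proof.
rewrite !strip_modE; apply: eq_bigr => x _.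
by rewrite -opprD sqrrN (_ : - t + Num.sqrt x = - (t - Num.sqrt x)) ?sqrrN 1?mulrC//; ring.
Qed.

(** By Vieta the zeros add up to n (n + a), and none of them is negative. *)
Lemma laguerre_root_le (R : realType) n (a c : R) (xs : seq R) : -1 < a ->
  c != 0 -> all (fun x => 0 <= x) xs ->
  laguerre n a = c *: \prod_(x <- xs) ('X - x%:P) ->
  size xs = n /\ {in xs, forall x, x <= n%:R * (n%:R + a)}.
Proof.
move=> a1 c0 xs0 E.
have sE : size xs = n.
  have := size_laguerre n a1; rewrite E size_scale// size_prod_XsubC.
  by move=> -[].
split=> // x xxs; have n0 : (0 < n)%N by rewrite -sE; case: (xs) xxs.
have lc : (laguerre n a)`_n = c.
  rewrite E coefZ -[X in _`_X]sE -[size xs]/((size xs).+1.-1) -(size_prod_XsubC xs idfun).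
  by rewrite -lead_coefE (monicP (monic_prod_XsubC _ _ _)) mulr1.
have nm : n.-1.+1 = n by rewrite prednK.
have nR : n.-1%:R = n%:R - 1 :> R by rewrite -subn1 natrB.
have := coef_laguerre_rec n n.-1 a1; rewrite nm lc E coefZ nR => H.
have {}H : \sum_(x <- xs) x = n%:R * (n%:R + a).
  apply: (mulfI c0).
  have -> : \sum_(x <- xs) x = - (\prod_(x <- xs) ('X - x%:P))`_n.-1.
    rewrite -[in X in _`_X]sE; rewrite coefPn_prod_XsubC ?opprK// sE -lt0n//.
  have -> : c * (n%:R * (n%:R + a)) = c * (n%:R * (a + 1 + (n%:R - 1))) by ring.
  by rewrite H; ring.
rewrite -H (big_rem x)//= lerDl big_seq sumr_ge0// => y /mem_rem.
exact: (allP xs0).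
Qed.

(** Three ranges of t >= 0. Up to sqrt n, the bound A >= t/2 - C1 gives growth like e^{t^2/4}.
    Beyond sqrt n the modulus does not decrease, and its gain e^{n/4} at sqrt n beats any power of t
    as long as t = O(n^2). Further out, t is large compared with all zeros and the factors are
    compared one by one. *)
Lemma strip_mod_growth (R : realType) (a r : R) m : -1 < a -> 0 < r ->
  exists2 C : R, 0 < C & exists n0, forall n, (n0 <= n)%N ->
  forall (c : R) (xs : seq R), c != 0 -> all (fun x => 0 <= x) xs ->
  laguerre n a = c *: \prod_(x <- xs) ('X - x%:P) ->
  forall t, C * (1 + t ^+ 2) ^+ m * strip_mod xs r 0 <= strip_mod xs r t.
Proof.
move=> a1 r0; have [C1 [C10 [n1 H1]]] := strip_A_lower a1 r0.
have [K1 K10 HK1] := expRN_pow_le R m.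
have [K2 K20 HK2] := expRN_pow_le R (4 * m).
pose kp := r ^+ 2 + 1 + `|a|.
have kp1 : 1 <= kp by rewrite /kp; have := sqr_ge0 r; have := normr_ge0 a; lra.
pose e0 := expR (- (4 * C1 ^+ 2)).
have e00 : 0 < e0 by exact: expR_gt0.
(* The constants [c1], [c2], [c3] serve the three ranges in turn. *)
pose c1 := e0 * expR (- (1 / 4)) / (4 ^+ m * K1).
pose c2 := e0 / ((8 * kp ^+ 2) ^+ m * (4 ^+ (4 * m) * K2)).
pose c3 : R := 2 ^- m.
have c10 : 0 < c1 by rewrite divr_gt0 ?mulr_gt0 ?expR_gt0 ?exprn_gt0.
have kp0 : 0 < kp by lra.
have c20 : 0 < c2.
  have h : 0 < 8 * kp ^+ 2 by rewrite mulr_gt0// exprn_gt0.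
  by rewrite /c2 divr_gt0// mulr_gt0 ?(exprn_gt0 _ h)// mulr_gt0// exprn_gt0.
have c30 : 0 < c3 by rewrite invr_gt0 exprn_gt0.
exists (Num.min c1 (Num.min c2 c3)); first by rewrite !lt_min c10 c20 c30.
exists (maxn n1 (maxn m 1)) => n hn c xs cn0 xs0 E.
have {}H1 := H1 n (leq_trans (leq_maxl _ _) hn) c xs cn0 xs0 E.
have mn : (m <= n)%N.
  by apply: leq_trans hn; rewrite (leq_trans (leq_maxl m 1))// leq_maxr.
have n_gt0 : (0 < n)%N.
  by apply: leq_trans hn; rewrite (leq_trans (leq_maxr m 1))// leq_maxr.
have [sxs xsle] := laguerre_root_le a1 cn0 xs0 E.
suff H t : 0 <= t -> Num.min c1 (Num.min c2 c3) * (1 + t ^+ 2) ^+ m * strip_mod xs r 0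
    <= strip_mod xs r t.
  move=> t; have [/H//|/ltW t0] := leP 0 t.
  by rewrite -[strip_mod xs r t]strip_modN -[t ^+ 2]sqrrN H// oppr_ge0.
move=> t0; pose w : R := Num.sqrt n%:R.
have nE : n%:R = w ^+ 2 by rewrite sqr_sqrtr ?ler0n.
have w0 : 0 <= w by exact: sqrtr_ge0.
have M0 : 0 < strip_mod xs r 0 by exact: strip_mod_gt0.
have small u : 0 <= u -> u <= w ->
    e0 * expR (u ^+ 2 / 4) * strip_mod xs r 0 <= strip_mod xs r u.
  move=> u0 uw.
  have := @derive_ge0_le R (fun v => strip_mod xs r v * expR (- (v ^+ 2 / 2 - 2 * C1 * v)))
    (fun v => strip_mod xs r v * expR (- (v ^+ 2 / 2 - 2 * C1 * v))
       * (2 * strip_A xs r v - v + 2 * C1)) 0 u u0.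
  rewrite expr0n /= mul0r mulr0 subrr oppr0 expR0 mulr1 => h.
  have {}h : strip_mod xs r 0 <= strip_mod xs r u * expR (- (u ^+ 2 / 2 - 2 * C1 * u)).
    apply: h => v /andP[v0 vu].
      apply: drv_eq.
        apply: drvM; first exact: drv_strip_mod.
        apply: drv_exp; apply: drvN; apply: drvB; last by apply: drvZ; exact: drv_id.
        by apply: (@drvM _ (fun x => x ^+ 2) (fun _ => 2^-1));
          [apply: drv_X; exact: drv_id|exact: drvC].
      by rewrite /= expr1; field.
    rewrite mulr_ge0 ?mulr_ge0 ?expR_ge0 ?(ltW (strip_mod_gt0 _ _ _))//.
    have [h _] := H1 v v0; have : v / 2 - C1 <= strip_A xs r v.
      by apply: h; rewrite nE ler_sqr ?nnegrE// (le_trans vu).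
    lra.
  rewrite expRN ler_pdivlMr ?expR_gt0// in h.
  apply: le_trans h; rewrite mulrC ler_pM2l// /e0 -expRD ler_expR.
  by have := sqr_ge0 (u / 2 - 2 * C1); lra.
have large u v : w <= u -> u <= v -> strip_mod xs r u <= strip_mod xs r v.
  move=> wu uv; apply: (derive_ge0_le uv).
    by move=> x _; exact: drv_strip_mod.
  move=> x /andP[ux _]; have x0 : 0 <= x by lra.
  apply: mulr_ge0; first exact/ltW/strip_mod_gt0.
  apply: mulr_ge0 => //; apply: (H1 x x0).2.
  by rewrite nE ler_sqr ?nnegrE//; lra.
have min1 : Num.min c1 (Num.min c2 c3) <= c1 by rewrite ge_min lexx.
have min2 : Num.min c1 (Num.min c2 c3) <= c2 by rewrite !ge_min lexx orbT.
have min3 : Num.min c1 (Num.min c2 c3) <= c3 by rewrite !ge_min lexx !orbT.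
have P0 : 0 < (1 + t ^+ 2) ^+ m by rewrite exprn_gt0// ltr_pwDl// sqr_ge0.
have [tw|/ltW wt] := leP t w.
  apply: le_trans (small t t0 tw); rewrite ler_pM2r//.
  apply: (@le_trans _ _ (c1 * (1 + t ^+ 2) ^+ m)); first by rewrite ler_pM2r.
  have y0 : 0 <= (1 + t ^+ 2) / 4 by have := sqr_ge0 t; lra.
  have := HK1 _ y0.
  have -> : expR (- ((1 + t ^+ 2) / 4)) = expR (- (1 / 4)) * expR (- (t ^+ 2 / 4)).
    by rewrite -expRD; congr expR; field.
  rewrite expr_div_n [expR (- (t ^+ 2 / 4))]expRN => h.
  rewrite /c1 mulrAC ler_pdivrMr ?mulr_gt0 ?exprn_gt0//.
  have X0 := expR_gt0 (t ^+ 2 / 4); move: h.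
  rewrite mulrA ler_pdivrMr// mulrAC ler_pdivrMr ?exprn_gt0// => h.
  have : e0 * ((1 + t ^+ 2) ^+ m * expR (- (1 / 4))) <= e0 * (K1 * expR (t ^+ 2 / 4) * 4 ^+ m).
    by rewrite ler_pM2l.
  by rewrite !mulrA => h'; apply: le_trans (le_trans h' _); [lra|lra].
(* [V] dominates [r ^+ 2 + x] for every zero [x]; for t >= 2 V each zero then contributes to
   [strip_mod] at least t^2 times its contribution at t = 0. *)
pose V := kp * n%:R ^+ 2.
have n1' : 1 <= n%:R :> R by rewrite ler1n.
have V1 : 1 <= V.
  by rewrite /V -[leLHS]mulr1 ler_pM// exprn_ege1.
have [tV|/ltW Vt] := leP t (2 * V).
  have h1 := large w t (lexx _) wt; have h2 := small w w0 (lexx _).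
  apply: le_trans h1; apply: le_trans h2; rewrite ler_pM2r// -nE.
  apply: (@le_trans _ _ (c2 * (1 + t ^+ 2) ^+ m)); first by rewrite ler_pM2r.
  have y0 : 0 <= n%:R / 4 :> R by lra.
  have := HK2 _ y0; rewrite expr_div_n expRN.
  rewrite ler_pdivrMr ?expR_gt0// ler_pdivrMr ?exprn_gt0// => h.
  have ht : (1 + t ^+ 2) ^+ m <= (8 * kp ^+ 2) ^+ m * n%:R ^+ (4 * m).
    rewrite exprM -exprMn; apply: lerXn2r; rewrite ?nnegrE.
    - by rewrite addr_ge0 ?sqr_ge0.
    - by apply: mulr_ge0; [apply: mulr_ge0 => //; exact: sqr_ge0|exact: exprn_ge0].
    have : t ^+ 2 <= (2 * V) ^+ 2 by rewrite ler_sqr ?nnegrE//; lra.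
    have -> : 8 * kp ^+ 2 * n%:R ^+ 4 = 2 * (2 * V) ^+ 2 by rewrite /V; ring.
    have : 1 <= (2 * V) ^+ 2 by rewrite -(expr1n _ 2) ler_sqr ?nnegrE//; lra.
    lra.
  have KK : 0 < (8 * kp ^+ 2) ^+ m by rewrite exprn_gt0// mulr_gt0// exprn_gt0.
  rewrite /c2 mulrAC ler_pdivrMr; last by rewrite mulr_gt0// mulr_gt0 ?exprn_gt0.
  rewrite -[leRHS]mulrA ler_pM2l// (le_trans ht)// [leRHS]mulrCA ler_pM2l//.
  by rewrite (le_trans h)// le_eqVlt; apply/orP; left; apply/eqP; ring.
apply: (@le_trans _ _ (c3 * (1 + t ^+ 2) ^+ m * strip_mod xs r 0)).
  by rewrite !ler_pM2r.
have t1 : 1 <= t by lra.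
have t2 : 1 <= t ^+ 2 by exact: exprn_ege1.
apply: (@le_trans _ _ ((t ^+ 2) ^+ n * strip_mod xs r 0)).
  rewrite ler_pM2r//; apply: (@le_trans _ _ ((t ^+ 2) ^+ m)).
    rewrite /c3 mulrC ler_pdivrMr ?exprn_gt0// -exprMn.
    by apply: lerXn2r; rewrite ?nnegrE; lra.
  exact: ler_weXn2l.
rewrite !strip_modE -[X in _ ^+ X]sxs.
have : {in xs, forall x, 0 <= x <= n%:R * (n%:R + a)}.
  by move=> x xxs; rewrite xsle// andbT; exact: (allP xs0).
have kV : r ^+ 2 + n%:R * (n%:R + a) <= V.
  rewrite /V /kp; have := ler_norm a => ha.
  have : n%:R * a <= n%:R ^+ 2 * `|a|.
    apply: (@le_trans _ _ (n%:R * `|a|)); first by rewrite ler_wpM2l.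
    by rewrite ler_wpM2r// expr2 ler_peMl.
  have : r ^+ 2 * 1 <= r ^+ 2 * n%:R ^+ 2.
    by rewrite ler_wpM2l ?sqr_ge0// exprn_ege1.
  lra.
elim: (xs) => [_|x ys IH hx].
  by rewrite !big_nil expr0 mulr1.
rewrite !big_cons /= exprS.
have /andP[x0 xn] := hx x (mem_head _ _).
have {}IH : (t ^+ 2) ^+ size ys *
    \prod_(j <- ys) ((r ^+ 2 + (0 - Num.sqrt j) ^+ 2) * (r ^+ 2 + (0 + Num.sqrt j) ^+ 2))
  <= \prod_(j <- ys) ((r ^+ 2 + (t - Num.sqrt j) ^+ 2) * (r ^+ 2 + (t + Num.sqrt j) ^+ 2)).
  by apply: IH => y hy; apply: hx; rewrite inE hy orbT.
have -> : t ^+ 2 * (t ^+ 2) ^+ size ys * ((r ^+ 2 + (0 - Num.sqrt x) ^+ 2) * (r ^+ 2 + (0 + Num.sqrt x) ^+ 2)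
   * \prod_(j <- ys) ((r ^+ 2 + (0 - Num.sqrt j) ^+ 2) * (r ^+ 2 + (0 + Num.sqrt j) ^+ 2)))
   = (t * (r ^+ 2 + Num.sqrt x ^+ 2)) ^+ 2 * ((t ^+ 2) ^+ size ys *
   \prod_(j <- ys) ((r ^+ 2 + (0 - Num.sqrt j) ^+ 2) * (r ^+ 2 + (0 + Num.sqrt j) ^+ 2))).
  by ring.
apply: ler_pM => //; first exact: sqr_ge0.
  rewrite mulr_ge0 ?exprn_ge0 ?sqr_ge0// prodr_ge0// => y _.
  by rewrite mulr_ge0 ?addr_ge0 ?sqr_ge0.
have -> : (r ^+ 2 + (t - Num.sqrt x) ^+ 2) * (r ^+ 2 + (t + Num.sqrt x) ^+ 2)
  = (t ^+ 2 - r ^+ 2 - Num.sqrt x ^+ 2) ^+ 2 + (2 * r * t) ^+ 2 by ring.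
rewrite sqr_sqrtr//.
apply: (@le_trans _ _ ((t ^+ 2 - r ^+ 2 - x) ^+ 2)); last by rewrite lerDl sqr_ge0.
have h : t * (r ^+ 2 + x) <= t ^+ 2 - r ^+ 2 - x.
  have : (t + 1) * (r ^+ 2 + x) <= (t + 1) * V.
    by rewrite ler_wpM2l//; lra.
  have : (t + 1) * V <= (t + 1) * (t / 2) by rewrite ler_wpM2l//; lra.
  have : t <= t ^+ 2 by rewrite expr2 ler_peMl.
  lra.
have h0 : 0 <= t * (r ^+ 2 + x) by rewrite mulr_ge0// addr_ge0 ?sqr_ge0.
by rewrite ler_sqr ?nnegrE// (le_trans h0).
Qed.

(** * Complex differentiability *)

(* A wrapper that keeps unification from unfolding [derivable] on [R[i]]. *)
Variant holo (R : realType) (k : R[i] -> R[i]) (z : R[i]) : Prop :=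
  Holo of derivable (k : R[i]^o -> R[i]^o) z 1.

Lemma holo_cst (R : realType) (c z : R[i]) : holo (fun _ => c) z.
Proof. split; exact: (@derivable_cst R[i] R[i]^o R[i]^o). Qed.

Lemma holo_id (R : realType) (z : R[i]) : holo (fun w => w) z.
Proof. split; exact: (@derivable_id R[i] R[i]^o). Qed.

Lemma holoD (R : realType) (k l : R[i] -> R[i]) (z : R[i]) :
  holo k z -> holo l z -> holo (fun w => k w + l w) z.
Proof. by move=> [hk] [hl]; split; exact: (@derivableD R[i] R[i]^o R[i]^o k l z 1 hk hl). Qed.

Lemma holoN (R : realType) (k : R[i] -> R[i]) (z : R[i]) :
  holo k z -> holo (fun w => - k w) z.
Proof. by move=> [hk]; split; exact: (@derivableN R[i] R[i]^o R[i]^o k z 1 hk). Qed.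

Lemma holoM (R : realType) (k l : R[i] -> R[i]) (z : R[i]) :
  holo k z -> holo l z -> holo (fun w => k w * l w) z.
Proof. by move=> [hk] [hl]; split; exact: (@derivableM R[i] R[i]^o k l z 1 hk hl). Qed.

Lemma holoV (R : realType) (k : R[i] -> R[i]) (z : R[i]) :
  k z != 0 -> holo k z -> holo (fun w => (k w)^-1) z.
Proof. by move=> k0 [hk]; split; exact: (@derivableV R[i] R[i]^o k z 1 k0 hk). Qed.

Lemma holo_comp (R : realType) (k l : R[i] -> R[i]) (z : R[i]) :
  holo k (l z) -> holo l z -> holo (fun w => k (l w)) z.
Proof.
move=> [/derivable1_diffP hk] [/derivable1_diffP hl]; split; apply/derivable1_diffP.
exact: (@differentiable_comp R[i] R[i]^o R[i]^o R[i]^o l k z hl hk).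
Qed.

Lemma holo_horner (R : realType) (p : {poly R[i]}) (z : R[i]) :
  holo (fun w => p.[w]) z.
Proof.
elim/poly_ind: p => [|p c IH].
  rewrite (_ : (fun w => _) = (fun _ => 0)); first exact: holo_cst.
  by apply/funext => w; rewrite horner0.
rewrite (_ : (fun w => _) = (fun w => p.[w] * w + c)).
  by apply: holoD; [apply: holoM => //; exact: holo_id|exact: holo_cst].
by apply/funext => w; rewrite hornerMXaddC.
Qed.

Lemma normc_real (R : realType) (x : R) : normc (x%:C : R[i]) = `|x|.
Proof. by rewrite /normc /= expr0n addr0 sqrtr_sqr. Qed.

Lemma normcB (R : realType) (x y : R[i]) : normc (x - y) = normc (y - x).
Proof. by rewrite -normcN opprB. Qed.

Lemma normc_ge0 (R : realType) (x : R[i]) : 0 <= normc x.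
Proof. by case: x => a b; exact: sqrtr_ge0. Qed.

Lemma normc_eq0 (R : realType) (x : R[i]) : (normc x == 0) = (x == 0).
Proof.
apply/eqP/eqP => [|->]; first exact: eq0_normc.
exact: normc0.
Qed.

Lemma normc_gt0 (R : realType) (x : R[i]) : (0 < normc x) = (x != 0).
Proof. by rewrite lt_neqAle eq_sym normc_eq0 normc_ge0 andbT. Qed.

Lemma normc_normE (R : realType) (x : R[i]) : `|x| = (normc x)%:C.
Proof. by []. Qed.

Lemma Re_le_normc (R : realType) (x : R[i]) : `|complex.Re x| <= normc x.
Proof.
by case: x => a b /=; rewrite -sqrtr_sqr ler_wsqrtr// lerDl sqr_ge0.
Qed.

Lemma Im_le_normc (R : realType) (x : R[i]) : `|complex.Im x| <= normc x.
Proof.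
by case: x => a b /=; rewrite -sqrtr_sqr ler_wsqrtr// lerDr sqr_ge0.
Qed.

Lemma normc_le_ReIm (R : realType) (x : R[i]) :
  normc x <= `|complex.Re x| + `|complex.Im x|.
Proof.
case: x => a b /=; rewrite -ler_sqr ?nnegrE ?sqrtr_ge0 ?addr_ge0//.
rewrite sqr_sqrtr ?addr_ge0 ?sqr_ge0// sqrrD !real_normK ?num_real//.
have : 0 <= `|a| * `|b| by rewrite mulr_ge0.
by rewrite -mulr_natl; lra.
Qed.

Lemma sqr_normc_ReIm (R : realType) (x : R[i]) :
  normc x ^+ 2 = complex.Re x ^+ 2 + complex.Im x ^+ 2.
Proof. by case: x => a b /=; rewrite sqr_sqrtr// addr_ge0// sqr_ge0. Qed.

(* The limit in the definition of [derivable], in epsilon-delta form. *)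
Lemma holo_linear_approx (R : realType) (k : R[i] -> R[i]) (z : R[i]) :
  holo k z -> exists d : R[i], forall e : R, 0 < e ->
    exists2 dl : R, 0 < dl & forall h, normc h < dl ->
      normc (k (z + h) - k z - d * h) <= e * normc h.
Proof.
move=> [/cvg_ex[d /cvgrPdist_le H]]; exists d => e e0.
have ec : 0 < e%:C :> R[i] by rewrite ltcR.
have [dl /= dl0 Hd] := H _ ec.
have [r [r0 dlE]] : exists r : R, 0 < r /\ dl = r%:C.
  move: dl0 {H Hd}; case: dl => x y; rewrite ltcE /= => /andP[/eqP -> x0].
  by exists x.
exists r => // h hr; have [->|h0] := eqVneq h 0.
  by rewrite addr0 subrr mulr0 subrr normc0 mulr0.
have := Hd h; rewrite /ball_ /= sub0r normrN normc_normE dlE ltcR => /(_ hr h0).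
rewrite normc_normE lecR => H1.
have -> : k (z + h) - k z - d * h = - (d - h^-1 *: (k (h *: 1 + z) - k z)) * h.
  rewrite /GRing.scale /= mulr1 [h + z]addrC mulNr mulrBl opprB; congr (_ - _).
  by rewrite mulrAC mulVf// mul1r.
by rewrite normcM normcN ler_wpM2r// normc_ge0.
Qed.

(** * Integrals of complex functions over real segments *)

Definition Cint (R : realType) (phi : R -> R[i]) (a b : R) : R[i] :=
  (\int[lebesgue_measure]_(t in `[a, b]) complex.Re (phi t)) +i*
  (\int[lebesgue_measure]_(t in `[a, b]) complex.Im (phi t)).

(** Two-sided continuity at every point of the closed segment, endpoints included, which is what
    complex differentiability at these points provides. *)
Definition cont_on (R : realType) (phi : R -> R[i]) (a b : R) : Prop :=
  forall t, a <= t <= b -> {for t, continuous (fun t => complex.Re (phi t))} /\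
                           {for t, continuous (fun t => complex.Im (phi t))}.

Lemma cont_onS (R : realType) (phi : R -> R[i]) (a b c d : R) :
  a <= c -> d <= b -> cont_on phi a b -> cont_on phi c d.
Proof. by move=> ac db H t /andP[h1 h2]; apply: H; lra. Qed.

Lemma pointwise_within (R : realType) (f : R -> R) (a b : R) :
  (forall t, a <= t <= b -> {for t, continuous f}) -> {within `[a, b], continuous f}.
Proof.
move=> H; apply: continuous_in_subspaceT => t; rewrite inE /= in_itv /=; exact: H.
Qed.

Lemma pointwise_integrable (R : realType) (f : R -> R) (a b : R) :
  (forall t, a <= t <= b -> {for t, continuous f}) ->
  lebesgue_measure.-integrable `[a, b] (EFin \o f).
Proof.
move=> H; apply: continuous_compact_integrable; first exact: segment_compact.
exact: pointwise_within.
Qed.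

Lemma cont_on_integrable (R : realType) (phi : R -> R[i]) (a b : R) :
  cont_on phi a b ->
  lebesgue_measure.-integrable `[a, b] (EFin \o (fun t => complex.Re (phi t))) /\
  lebesgue_measure.-integrable `[a, b] (EFin \o (fun t => complex.Im (phi t))).
Proof.
by move=> H; split; apply: pointwise_integrable => t /H[].
Qed.

Lemma cont_onD (R : realType) (f g : R -> R[i]) (a b : R) :
  cont_on f a b -> cont_on g a b -> cont_on (fun t => f t + g t) a b.
Proof.
move=> hf hg t ht; have [f1 f2] := hf t ht; have [g1 g2] := hg t ht; split.
  rewrite (_ : (fun _ => _) = (fun t => complex.Re (f t)) \+ (fun t => complex.Re (g t))).
    exact: cvgD.
  by apply/funext => u /=; case: (f u); case: (g u).
rewrite (_ : (fun _ => _) = (fun t => complex.Im (f t)) \+ (fun t => complex.Im (g t))).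
  exact: cvgD.
by apply/funext => u /=; case: (f u); case: (g u).
Qed.

Lemma cont_onM (R : realType) (f g : R -> R[i]) (a b : R) :
  cont_on f a b -> cont_on g a b -> cont_on (fun t => f t * g t) a b.
Proof.
move=> hf hg t ht; have [f1 f2] := hf t ht; have [g1 g2] := hg t ht; split.
  rewrite (_ : (fun _ => _) =
    (fun t => complex.Re (f t) * complex.Re (g t) - complex.Im (f t) * complex.Im (g t))).
    by apply: cvgB; apply: cvgM.
  by apply/funext => u /=; case: (f u); case: (g u).
rewrite (_ : (fun _ => _) =
  (fun t => complex.Re (f t) * complex.Im (g t) + complex.Im (f t) * complex.Re (g t))).
  by apply: cvgD; apply: cvgM.
by apply/funext => u /=; case: (f u); case: (g u).
Qed.

Lemma cont_on_cst (R : realType) (c : R[i]) (a b : R) : cont_on (fun _ => c) a b.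
Proof. by move=> t _; split; exact: cvg_cst. Qed.

Lemma CintD (R : realType) (f g : R -> R[i]) (a b : R) :
  cont_on f a b -> cont_on g a b ->
  Cint (fun t => f t + g t) a b = Cint f a b + Cint g a b.
Proof.
move=> /cont_on_integrable[f1 f2] /cont_on_integrable[g1 g2].
rewrite /Cint; apply/eqP; rewrite eq_complex /= -!RintegralD//.
by apply/andP; split; apply/eqP; apply: eq_Rintegral => t _; case: (f t); case: (g t).
Qed.

Lemma CintZ (R : realType) (c : R[i]) (f : R -> R[i]) (a b : R) :
  cont_on f a b -> Cint (fun t => c * f t) a b = c * Cint f a b.
Proof.
move=> /cont_on_integrable[f1 f2]; case: c => c1 c2.
have iZ (r : R) (h : R -> R) : lebesgue_measure.-integrable `[a, b] (EFin \o h) ->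
   lebesgue_measure.-integrable `[a, b] (EFin \o (fun x => r * h x)).
  move=> hi; rewrite (_ : (fun x => r * h x) = (fun x => h x * r)).
    exact: integrable_mulr.
  by apply/funext => x; rewrite mulrC.
rewrite /Cint; apply/eqP; rewrite eq_complex /=; apply/andP; split; apply/eqP.
  rewrite -!RintegralZl// -RintegralB//; last 2 first.
  - exact: iZ.
  - exact: iZ.
  by apply: eq_Rintegral => t _; case: (f t).
rewrite -!RintegralZl// -RintegralD//; last 2 first.
- exact: iZ.
- exact: iZ.
by apply: eq_Rintegral => t _; case: (f t).
Qed.

Lemma CintN (R : realType) (f : R -> R[i]) (a b : R) :
  cont_on f a b -> Cint (fun t => - f t) a b = - Cint f a b.
Proof.
move=> hf; rewrite -mulN1r -CintZ//; congr Cint.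
by apply/funext => t; rewrite mulN1r.
Qed.

Lemma CintB (R : realType) (f g : R -> R[i]) (a b : R) :
  cont_on f a b -> cont_on g a b ->
  Cint (fun t => f t - g t) a b = Cint f a b - Cint g a b.
Proof.
move=> hf hg; rewrite -CintN// -CintD//.
rewrite (_ : (fun t => - g t) = (fun t => -1 * g t)).
  by apply: cont_onM => //; exact: cont_on_cst.
by apply/funext => t; rewrite mulN1r.
Qed.

Lemma eq_Cint (R : realType) (f g : R -> R[i]) (a b : R) :
  (forall t, a <= t <= b -> f t = g t) -> Cint f a b = Cint g a b.
Proof.
move=> fg; rewrite /Cint; congr (_ +i* _); apply: eq_Rintegral => t;
by rewrite inE/= in_itv/= => ht; rewrite fg.
Qed.

Lemma Rintegral_chasles (R : realType) (f : R -> R) (a b c : R) : a <= c -> c <= b ->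
  lebesgue_measure.-integrable `[a, b] (EFin \o f) ->
  \int[lebesgue_measure]_(t in `[a, b]) f t =
  \int[lebesgue_measure]_(t in `[a, c]) f t + \int[lebesgue_measure]_(t in `[c, b]) f t.
Proof.
move=> ac cb fi; apply/eqP; rewrite addrC -subr_eq; apply/eqP.
rewrite Rintegral_itvB ?bnd_simp// Rintegral_itv_obnd_cbnd//.
by apply: integrableS fi => //; apply: subset_itvr; rewrite bnd_simp.
Qed.

Lemma Cint_chasles (R : realType) (f : R -> R[i]) (a b c : R) : a <= c -> c <= b ->
  cont_on f a b -> Cint f a b = Cint f a c + Cint f c b.
Proof.
move=> ac cb /cont_on_integrable[f1 f2]; rewrite /Cint.
by rewrite (Rintegral_chasles ac cb f1) (Rintegral_chasles ac cb f2).
Qed.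

Lemma Cint_FTC (R : realType) (f : R -> R[i]) (F1 F2 : R -> R) (a b : R) :
  a <= b -> cont_on f a b ->
  (forall t, a <= t <= b -> deriv_at F1 t (complex.Re (f t))) ->
  (forall t, a <= t <= b -> deriv_at F2 t (complex.Im (f t))) ->
  Cint f a b = (F1 b - F1 a) +i* (F2 b - F2 a).
Proof.
move=> ab hf h1 h2; rewrite /Cint /Rintegral.
rewrite (Rintegral_FTC ab h1); last by apply: pointwise_within => t /hf[].
by rewrite (Rintegral_FTC ab h2)//; apply: pointwise_within => t /hf[].
Qed.

(* Rotating the integral onto the positive real axis. *)
Lemma normc_Cint_le (R : realType) (f : R -> R[i]) (G g : R -> R) (a b : R) :
  a <= b -> cont_on f a b ->
  (forall t, a <= t <= b -> deriv_at G t (g t)) ->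
  (forall t, a <= t <= b -> {for t, continuous g}) ->
  (forall t, a <= t <= b -> normc (f t) <= g t) ->
  normc (Cint f a b) <= G b - G a.
Proof.
move=> ab hf hG hg fg; set I := Cint f a b.
have [I0|I0] := eqVneq I 0.
  rewrite I0 normc0 subr_ge0; apply: (derive_ge0_le ab hG) => t ht.
  by apply: le_trans (fg t ht); exact: normc_ge0.
pose c := (normc I)%:C / I.
have nI : normc I != 0 by rewrite normc_eq0.
have nc : normc c = 1.
  by rewrite normcM normc_real normcV ger0_norm ?normc_ge0// mulfV.
have cf : cont_on (fun t => c * f t) a b.
  by apply: cont_onM => //; exact: cont_on_cst.
have : Cint (fun t => c * f t) a b = (normc I)%:C.
  by rewrite CintZ// -/I /c divfK.
move=> /(congr1 (@complex.Re R)) /= <-.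
have gE : G b - G a = \int[lebesgue_measure]_(t in `[a, b]) g t.
  by rewrite /Rintegral (Rintegral_FTC ab hG)//; exact: pointwise_within.
rewrite gE; apply: le_Rintegral => //.
- by have [] := cont_on_integrable cf.
- exact: pointwise_integrable.
move=> t; rewrite /= in_itv/= => ht; rewrite (le_trans _ (fg t ht))//.
by rewrite (le_trans (ler_norm _))// (le_trans (Re_le_normc _))// normcM nc mul1r.
Qed.

Lemma normc_Cint_le_cst (R : realType) (f : R -> R[i]) (M a b : R) :
  a <= b -> cont_on f a b -> (forall t, a <= t <= b -> normc (f t) <= M) ->
  normc (Cint f a b) <= M * (b - a).
Proof.
move=> ab hf fM; rewrite mulrBr.
apply: (normc_Cint_le (G := fun t => M * t) (g := fun _ => M)) => //.
- move=> t _; apply: drv_eq; first by apply: drvZ; exact: drv_id.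
  by rewrite mulr1.
- by move=> t _; exact: cvg_cst.
Qed.

Lemma Cint_oppr (R : realType) (f : R -> R[i]) (a : R) : 0 <= a ->
  cont_on f (- a) a ->
  Cint (fun t => f (- t)) (- a) a = Cint f (- a) a.
Proof.
move=> a0 hf; have na : - a <= a by lra.
have H (g : R -> R) : (forall t, - a <= t <= a -> {for t, continuous g}) ->
   \int[lebesgue_measure]_(t in `[- a, a]) g (- t) = \int[lebesgue_measure]_(t in `[- a, a]) g t.
  move=> hg; have := @integration_by_substitution_oppr R g (- a) a na.
  rewrite opprK => E; rewrite /Rintegral E//.
  exact: pointwise_within.
by rewrite /Cint (H _ (fun t ht => (hf t ht).1)) (H _ (fun t ht => (hf t ht).2)).
Qed.

Lemma normcD_le (R : realType) (x y : R[i]) : normc (x + y) <= normc x + normc y.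
Proof. by have := ler_normD x y; rewrite !normc_normE -rmorphD /= lecR. Qed.

Lemma near_dist_lt (R : realType) (t e : R) : 0 < e -> \forall u \near t, `|u - t| < e.
Proof.
move=> e0; apply/nbhs_ballP; exists e => // u.
by rewrite /ball /= distrC.
Qed.

Lemma holo_near_bound (R : realType) (k : R[i] -> R[i]) (z : R[i]) :
  holo k z -> exists2 dl : R, 0 < dl & exists2 D : R, 0 < D &
    forall w, normc (w - z) < dl -> normc (k w - k z) <= D * normc (w - z).
Proof.
move=> /holo_linear_approx[d /(_ 1 ltr01)[dl dl0 H]]; exists dl => //.
exists (1 + normc d) => [|w hw]; first by have := normc_ge0 d; lra.
have := H _ hw; rewrite [z + _]addrC subrK mul1r.
set X := _ - k z; set Y := w - z => h2.
rewrite -[leLHS]/(normc X) -(subrK (d * Y) X) (le_trans (normcD_le _ _))// normcM mulrDl mul1r.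
by rewrite lerD2r.
Qed.

Lemma holo_cont_line (R : realType) (k : R[i] -> R[i]) (p v : R[i]) (a b : R) :
  (forall t, a <= t <= b -> holo k (p + t%:C * v)) ->
  cont_on (fun t => k (p + t%:C * v)) a b.
Proof.
move=> hk t ht; have [dl dl0 [D D0 H]] := holo_near_bound (hk t ht).
pose V := normc v + 1.
have V0 : 0 < V by rewrite /V; have := normc_ge0 v; lra.
have key e : 0 < e -> \forall u \near t,
    normc (k (p + u%:C * v) - k (p + t%:C * v)) < e.
  move=> e0; near=> u.
  have E : p + u%:C * v - (p + t%:C * v) = (u - t)%:C * v by rewrite rmorphB /=; ring.
  have h0 : normc ((u - t)%:C * v) <= `|u - t| * V.
    by rewrite normcM normc_real ler_wpM2l// /V; lra.
  have h1 : normc ((u - t)%:C * v) < dl.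
    apply: le_lt_trans h0 _; rewrite -ltr_pdivlMr//; near: u.
    by apply: near_dist_lt; exact: divr_gt0.
  have := H (p + u%:C * v); rewrite E => /(_ h1) h2.
  apply: le_lt_trans h2 _.
  apply: (@le_lt_trans _ _ (D * (`|u - t| * V))); first by rewrite ler_wpM2l// ltW.
  rewrite -ltr_pdivlMl// -ltr_pdivlMr//; near: u.
  by apply: near_dist_lt; do 2?apply: divr_gt0 => //; apply: mulr_gt0 => //; rewrite invr_gt0.
split; apply/cvgrPdist_lt => e e0; near=> u.
  apply: (@le_lt_trans _ _ (normc (k (p + u%:C * v) - k (p + t%:C * v)))).
    by rewrite distrC; apply: le_trans (Re_le_normc _); case: (k _) => x1 x2; case: (k _) => y1 y2.
  by near: u; exact: key.
apply: (@le_lt_trans _ _ (normc (k (p + u%:C * v) - k (p + t%:C * v)))).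
  by rewrite distrC; apply: le_trans (Im_le_normc _); case: (k _) => x1 x2; case: (k _) => y1 y2.
by near: u; exact: key.
Unshelve. all: by end_near.
Qed.

Lemma holo_cont_hor (R : realType) (k : R[i] -> R[i]) (a b c : R) :
  (forall t, a <= t <= b -> holo k (t +i* c)) -> cont_on (fun t => k (t +i* c)) a b.
Proof.
have E t : t +i* c = (0 +i* c) + t%:C * 1 :> R[i].
  by apply/eqP; rewrite eq_complex /=; apply/andP; split; apply/eqP; ring.
move=> h; rewrite (_ : (fun t => k (t +i* c)) = (fun t => k ((0 +i* c) + t%:C * 1))).
  by apply: holo_cont_line => t ht; rewrite -E; exact: h.
by apply/funext => t; rewrite E.
Qed.

Lemma holo_cont_ver (R : realType) (k : R[i] -> R[i]) (a c d : R) :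
  (forall t, c <= t <= d -> holo k (a +i* t)) -> cont_on (fun t => k (a +i* t)) c d.
Proof.
have E t : a +i* t = a%:C + t%:C * (0 +i* 1) :> R[i].
  by apply/eqP; rewrite eq_complex /=; apply/andP; split; apply/eqP; ring.
move=> h; rewrite (_ : (fun t => k (a +i* t)) = (fun t => k (a%:C + t%:C * (0 +i* 1)))).
  by apply: holo_cont_line => t ht; rewrite -E; exact: h.
by apply/funext => t; rewrite E.
Qed.

(** * Goursat's theorem and Cauchy's formula for rectangles *)

Definition hint (R : realType) (k : R[i] -> R[i]) (a b c : R) : R[i] :=
  Cint (fun t => k (t +i* c)) a b.

Definition vint (R : realType) (k : R[i] -> R[i]) (a c d : R) : R[i] :=
  Cint (fun t => k (a +i* t)) c d.

(* The contour integral over the boundary of [a, b] x [c, d]. *)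
Definition rint (R : realType) (k : R[i] -> R[i]) (a b c d : R) : R[i] :=
  hint k a b c - hint k a b d + (0 +i* 1) * (vint k b c d - vint k a c d).

Lemma rint_hsplit (R : realType) (k : R[i] -> R[i]) (a b c d m : R) :
  a <= m -> m <= b ->
  (forall t, a <= t <= b -> holo k (t +i* c)) ->
  (forall t, a <= t <= b -> holo k (t +i* d)) ->
  rint k a b c d = rint k a m c d + rint k m b c d.
Proof.
move=> am mb hc hd; rewrite /rint /hint (Cint_chasles am mb (holo_cont_hor hc)).
by rewrite (Cint_chasles am mb (holo_cont_hor hd)); ring.
Qed.

Lemma rint_vsplit (R : realType) (k : R[i] -> R[i]) (a b c d m : R) :
  c <= m -> m <= d ->
  (forall t, c <= t <= d -> holo k (a +i* t)) ->
  (forall t, c <= t <= d -> holo k (b +i* t)) ->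
  rint k a b c d = rint k a b c m + rint k a b m d.
Proof.
move=> cm md ha hb; rewrite /rint /vint (Cint_chasles cm md (holo_cont_ver ha)).
by rewrite (Cint_chasles cm md (holo_cont_ver hb)); ring.
Qed.

(** Differentiability is asked for on the boundary only, because the integrands of interest have
    poles inside. *)
Lemma rintD (R : realType) (k l : R[i] -> R[i]) (a b c d : R) : a <= b -> c <= d ->
  (forall z, a <= complex.Re z <= b -> c <= complex.Im z <= d ->
     [|| complex.Re z == a, complex.Re z == b, complex.Im z == c | complex.Im z == d] ->
     holo k z /\ holo l z) ->
  rint (fun z => k z + l z) a b c d = rint k a b c d + rint l a b c d.
Proof.
move=> ab cd H; rewrite /rint /hint /vint.
have C1 e : e = c \/ e = d -> cont_on (fun t => k (t +i* e)) a b /\ cont_on (fun t => l (t +i* e)) a b.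
  move=> he; have h1 : c <= e <= d by case: he => ->; rewrite ?lexx ?cd.
  have h2 : (e == c) || (e == d) by case: he => ->; rewrite eqxx ?orbT.
  have K t : a <= t <= b -> holo k (t +i* e) /\ holo l (t +i* e).
    have h3 : [|| t == a, t == b, e == c | e == d] by rewrite h2 !orbT.
    by move=> ht; exact: (H (t +i* e) ht h1 h3).
  by split; apply: holo_cont_hor => t /K[].
have C2 e : e = a \/ e = b -> cont_on (fun t => k (e +i* t)) c d /\ cont_on (fun t => l (e +i* t)) c d.
  move=> he; have h1 : a <= e <= b by case: he => ->; rewrite ?lexx ?ab.
  have h2 : (e == a) || (e == b) by case: he => ->; rewrite eqxx ?orbT.
  have K t : c <= t <= d -> holo k (e +i* t) /\ holo l (e +i* t).
    have h3 : [|| e == a, e == b, t == c | t == d] by rewrite orbA h2.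
    by move=> ht; exact: (H (e +i* t) h1 ht h3).
  by split; apply: holo_cont_ver => t /K[].
have [x1 y1] := C1 c (or_introl erefl); have [x2 y2] := C1 d (or_intror erefl).
have [x3 y3] := C2 a (or_introl erefl); have [x4 y4] := C2 b (or_intror erefl).
by rewrite !CintD//; ring.
Qed.

Lemma Cint_linear (R : realType) (p q : R[i]) (a b : R) : a <= b ->
  Cint (fun t => p + q * t%:C) a b = (b - a)%:C * (p + q * ((a + b) / 2)%:C).
Proof.
move=> ab; case: p => p1 p2; case: q => q1 q2.
rewrite (@Cint_FTC _ _ (fun t => p1 * t + q1 / 2 * (t * t)) (fun t => p2 * t + q2 / 2 * (t * t)))//.
- by apply/eqP; rewrite eq_complex /=; apply/andP; split; apply/eqP; field.
- rewrite (_ : (fun t => _) = (fun t => (fun z => (p1 +i* p2) + (q1 +i* q2) * z) (t +i* 0)))//.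
  apply: (@holo_cont_hor _ (fun z => (p1 +i* p2) + (q1 +i* q2) * z)) => t _.
  by apply: holoD; [exact: holo_cst|apply: holoM; [exact: holo_cst|exact: holo_id]].
- move=> t _; apply: drv_eq.
    by apply: drvD; apply: drvZ; [exact: drv_id|apply: drvM; exact: drv_id].
  by rewrite /=; field.
- move=> t _; apply: drv_eq.
    by apply: drvD; apply: drvZ; [exact: drv_id|apply: drvM; exact: drv_id].
  by rewrite /=; field.
Qed.

(** In Goursat's argument this removes the first order Taylor polynomial. *)
Lemma rint_linear (R : realType) (p q : R[i]) (a b c d : R) : a <= b -> c <= d ->
  rint (fun z => p + q * z) a b c d = 0.
Proof.
move=> ab cd; rewrite /rint /hint /vint.
have H e : Cint (fun t => p + q * (t +i* e)) a b =
    (b - a)%:C * (p + q * (0 +i* e) + q * ((a + b) / 2)%:C).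
  rewrite -Cint_linear//; congr Cint; apply/funext => t.
  have -> : t +i* e = (0 +i* e) + t%:C by apply/eqP; rewrite eq_complex /= add0r addr0 !eqxx.
  by ring.
have V e : Cint (fun t => p + q * (e +i* t)) c d =
    (d - c)%:C * (p + q * e%:C + q * (0 +i* 1) * ((c + d) / 2)%:C).
  rewrite -Cint_linear//; congr Cint; apply/funext => t.
  have -> : e +i* t = e%:C + (0 +i* 1) * t%:C.
    by apply/eqP; rewrite eq_complex /=; apply/andP; split; apply/eqP; ring.
  by ring.
rewrite !H !V; case: p {H V} => p1 p2; case: q => q1 q2.
by apply/eqP; rewrite eq_complex /=; apply/andP; split; apply/eqP; field.
Qed.

Definition holo_on (R : realType) (k : R[i] -> R[i]) (a b c d : R) : Prop :=
  forall z, a <= complex.Re z <= b -> c <= complex.Im z <= d -> holo k z.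

Lemma holo_onS (R : realType) (k : R[i] -> R[i]) (a b c d a' b' c' d' : R) :
  a <= a' -> b' <= b -> c <= c' -> d' <= d -> holo_on k a b c d -> holo_on k a' b' c' d'.
Proof. by move=> h1 h2 h3 h4 H z /andP[? ?] /andP[? ?]; apply: H; lra. Qed.

Lemma normc_rint_le (R : realType) (k : R[i] -> R[i]) (a b c d M : R) :
  a <= b -> c <= d ->
  (forall z, a <= complex.Re z <= b -> c <= complex.Im z <= d ->
     [|| complex.Re z == a, complex.Re z == b, complex.Im z == c | complex.Im z == d] ->
     holo k z /\ normc (k z) <= M) ->
  normc (rint k a b c d) <= 2 * M * ((b - a) + (d - c)).
Proof.
move=> ab cd H.
have Hh e : e = c \/ e = d -> normc (hint k a b e) <= M * (b - a).
  move=> he; have h1 : c <= e <= d by case: he => ->; rewrite ?lexx ?cd.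
  have h2 : (e == c) || (e == d) by case: he => ->; rewrite eqxx ?orbT.
  have K t : a <= t <= b -> holo k (t +i* e) /\ normc (k (t +i* e)) <= M.
    have h3 : [|| t == a, t == b, e == c | e == d] by rewrite h2 !orbT.
    by move=> ht; exact: (H (t +i* e) ht h1 h3).
  by apply: normc_Cint_le_cst => // [|t /K[]//]; apply: holo_cont_hor => t /K[].
have Hv e : e = a \/ e = b -> normc (vint k e c d) <= M * (d - c).
  move=> he; have h1 : a <= e <= b by case: he => ->; rewrite ?lexx ?ab.
  have h2 : (e == a) || (e == b) by case: he => ->; rewrite eqxx ?orbT.
  have K t : c <= t <= d -> holo k (e +i* t) /\ normc (k (e +i* t)) <= M.
    have h3 : [|| e == a, e == b, t == c | t == d] by rewrite orbA h2.
    by move=> ht; exact: (H (e +i* t) h1 ht h3).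
  by apply: normc_Cint_le_cst => // [|t /K[]//]; apply: holo_cont_ver => t /K[].
have n1 : normc (0 +i* 1 : R[i]) = 1 by rewrite /= expr0n expr1n add0r sqrtr1.
have := Hh c (or_introl erefl); have := Hh d (or_intror erefl).
have := Hv a (or_introl erefl); have := Hv b (or_intror erefl).
rewrite /rint; set x1 := hint k a b c; set x2 := hint k a b d.
set x3 := vint k b c d; set x4 := vint k a c d => e3 e4 e2 e1.
have := normcD_le (x1 - x2) ((0 +i* 1) * (x3 - x4)).
have := normcD_le x1 (- x2); have := normcD_le x3 (- x4).
by rewrite normcM n1 mul1r !normcN; lra.
Qed.

Lemma rint_quarter (R : realType) (k : R[i] -> R[i]) (a b c d p q : R) :
  a <= p <= b -> c <= q <= d -> holo_on k a b c d ->
  rint k a b c d = rint k a p c q + rint k p b c q + (rint k a p q d + rint k p b q d).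
Proof.
move=> /andP[ap pb] /andP[cq qd] H.
have ab := le_trans ap pb; have cd := le_trans cq qd.
have Hh e : c <= e <= d -> forall t, a <= t <= b -> holo k (t +i* e).
  by move=> he t ht; apply: H.
have Hv e : a <= e <= b -> forall t, c <= t <= d -> holo k (e +i* t).
  by move=> he t ht; apply: H.
rewrite (@rint_vsplit _ k a b c d q)//; last 2 first.
- by apply: Hv; rewrite lexx ab.
- by apply: Hv; rewrite lexx ab.
rewrite (@rint_hsplit _ k a b c q p)//; last 2 first.
- by apply: Hh; rewrite lexx cd.
- by apply: Hh; rewrite cq qd.
rewrite (@rint_hsplit _ k a b q d p)//.
- by apply: Hh; rewrite cq qd.
- by apply: Hh; rewrite lexx cd.
Qed.

Lemma nested_segments (R : realType) (u l : nat -> R) :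
  (forall j, u j <= u j.+1) -> (forall j, l j.+1 <= l j) -> (forall j, u j <= l j) ->
  exists x, forall j, u j <= x <= l j.
Proof.
move=> hu hl hul.
have mu i j : (i <= j)%N -> u i <= u j.
  move=> /subnK <-; elim: (j - i)%N => [//|m IH]; rewrite addSn.
  exact: le_trans IH (hu _).
have ml i j : (i <= j)%N -> l j <= l i.
  move=> /subnK <-; elim: (j - i)%N => [//|m IH]; rewrite addSn.
  exact: le_trans (hl _) IH.
have mul i j : u i <= l j.
  apply: (le_trans (mu _ _ (leq_maxl i j))); apply: (le_trans (hul _)).
  by apply: ml; exact: leq_maxr.
have ub j : ubound (range u) (l j) by move=> _ [i _ <-]; exact: mul.
exists (sup (range u)) => j; apply/andP; split.
  by apply: ub_le_sup; [exists (l 0%N); exact: ub|exists j].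
by apply: ge_sup => //; exists (u 0%N), 0%N.
Qed.

(** If all four quarters were below [e / 4], the whole would be below [e]. *)
Lemma goursat_quarter (R : realType) (k : R[i] -> R[i]) (a b w h e : R) :
  0 <= w -> 0 <= h -> holo_on k a (a + w) b (b + h) ->
  e <= normc (rint k a (a + w) b (b + h)) ->
  exists a' b', [/\ a <= a', a' + w / 2 <= a + w, b <= b', b' + h / 2 <= b + h &
    e / 4 <= normc (rint k a' (a' + w / 2) b' (b' + h / 2))].
Proof.
move=> w0 h0 H he.
have E1 : a + w = (a + w / 2) + w / 2 by field.
have E2 : b + h = (b + h / 2) + h / 2 by field.
have E := @rint_quarter _ k a (a + w) b (b + h) (a + w / 2) (b + h / 2) _ _ H.
have [C1|C1] := lerP (e / 4) (normc (rint k a (a + w / 2) b (b + h / 2))).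
  by exists a, b; split=> //; clear -w0 h0; lra.
have [C2|C2] := lerP (e / 4) (normc (rint k (a + w / 2) (a + w) b (b + h / 2))).
  by exists (a + w / 2), b; rewrite -E1; split=> //; clear -w0 h0; lra.
have [C3|C3] := lerP (e / 4) (normc (rint k a (a + w / 2) (b + h / 2) (b + h))).
  by exists a, (b + h / 2); rewrite -E2; split=> //; clear -w0 h0; lra.
have [C4|C4] := lerP (e / 4) (normc (rint k (a + w / 2) (a + w) (b + h / 2) (b + h))).
  by exists (a + w / 2), (b + h / 2); rewrite -E1 -E2; split=> //; clear -w0 h0; lra.
suff : normc (rint k a (a + w) b (b + h)) < e by rewrite ltNge he.
rewrite E; [|by apply/andP; split; clear -w0 h0; lra..].
apply: le_lt_trans (normcD_le _ _) _.
have -> : e = (e / 4 + e / 4) + (e / 4 + e / 4) by field.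
by apply: ltrD; (apply: le_lt_trans (normcD_le _ _) _; exact: ltrD).
Qed.

(** Repeated quartering yields nested rectangles on which the integral is at least e / 4^j. They
    shrink to a point where [k] is linear up to ep |z - z0|; the linear part integrates to 0 and the
    rest to at most a multiple of ep / 4^j, too little for small ep. *)
Lemma goursat (R : realType) (k : R[i] -> R[i]) (a b c d : R) : a <= b -> c <= d ->
  holo_on k a b c d -> rint k a b c d = 0.
Proof.
move=> ab cd H; apply/eqP; rewrite -normc_eq0; apply/negPn/negP => n0.
set e := normc (rint k a b c d) in n0.
have e0 : 0 < e by rewrite lt_neqAle eq_sym n0 normc_ge0.
pose w := b - a; pose h := d - c.
have w0 : 0 <= w by rewrite subr_ge0.
have h0 : 0 <= h by rewrite subr_ge0.
pose W j := w / 2 ^+ j; pose V j := h / 2 ^+ j.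
have p2 j : 0 < (2 : R) ^+ j by exact: exprn_gt0.
have W0 j : 0 <= W j by apply: divr_ge0 => //; exact: ltW.
have V0 j : 0 <= V j by apply: divr_ge0 => //; exact: ltW.
have WS j : W j.+1 = W j / 2 by rewrite /W exprSr invfM mulrA.
have VS j : V j.+1 = V j / 2 by rewrite /V exprSr invfM mulrA.
pose I j (x : R * R) := [/\ a <= x.1, x.1 + W j <= b, c <= x.2, x.2 + V j <= d &
   e / 4 ^+ j <= normc (rint k x.1 (x.1 + W j) x.2 (x.2 + V j))].
(* The successor is chosen for every pair of a level and a corner, with the default [(0, 0)] where
   the invariant fails, so that the sequence can be defined by plain recursion. *)
have [nx Hnx] : {nx : nat * (R * R) -> R * R & forall x, I x.1 x.2 ->
    [/\ I x.1.+1 (nx x), x.2.1 <= (nx x).1, (nx x).1 + W x.1.+1 <= x.2.1 + W x.1,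
        x.2.2 <= (nx x).2 & (nx x).2 + V x.1.+1 <= x.2.2 + V x.1]}.
  apply: (@choice _ _ (fun x y => I x.1 x.2 -> [/\ I x.1.+1 y, x.2.1 <= y.1,
     y.1 + W x.1.+1 <= x.2.1 + W x.1, x.2.2 <= y.2 & y.2 + V x.1.+1 <= x.2.2 + V x.1])).
  move=> [j [x y]] /=; have [[i1 i2 i3 i4 i5]|nI] := pselect (I j (x, y)); last by exists (0, 0).
  move: i1 i2 i3 i4 i5 => /= i1 i2 i3 i4 i5.
  have [x' [y' [j1 j2 j3 j4 j5]]] := goursat_quarter (W0 j) (V0 j) (holo_onS i1 i2 i3 i4 H) i5.
  exists (x', y') => _; rewrite /I /= WS VS; split=> //; split=> //.
  - exact: le_trans j1.
  - exact: le_trans i2.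
  - exact: le_trans j3.
  - exact: le_trans i4.
  - by rewrite exprSr invfM mulrA.
pose s := fix s j := if j is i.+1 then nx (i, s i) else (a, c).
have Is j : I j (s j).
  elim: j => [|j IH]; last by have [] := Hnx (j, s j) IH.
  by rewrite /I /= /W /V expr0 !divr1 /w /h !subrKC; split.
have [x hx] := @nested_segments _ (fun j => (s j).1) (fun j => (s j).1 + W j)
  (fun j => let: And5 _ h1 _ _ _ := Hnx (j, s j) (Is j) in h1)
  (fun j => let: And5 _ _ h1 _ _ := Hnx (j, s j) (Is j) in h1)
  (fun j => ltac:(by rewrite lerDl)).
have [y hy] := @nested_segments _ (fun j => (s j).2) (fun j => (s j).2 + V j)
  (fun j => let: And5 _ _ _ h1 _ := Hnx (j, s j) (Is j) in h1)
  (fun j => let: And5 _ _ _ _ h1 := Hnx (j, s j) (Is j) in h1)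
  (fun j => ltac:(by rewrite lerDl)).
have hz : holo k (x +i* y).
  apply: H => /=.
    have := hx 0%N; rewrite /= /W expr0 divr1 /w subrKC; exact.
  have := hy 0%N; rewrite /= /V expr0 divr1 /h subrKC; exact.
have [D HD] := holo_linear_approx hz.
pose S := w + h + 1.
have S1 : 0 < S by rewrite /S; lra.
(* [S / 2 ^+ j] dominates the half-perimeter at level j, so the final bound is
   [2 * ep * (S / 2 ^+ j) ^+ 2], half of [e / 4 ^+ j]. *)
pose ep := e / (4 * S ^+ 2).
have ep0 : 0 < ep by apply: divr_gt0 => //; apply: mulr_gt0 => //; exact: exprn_gt0.
have [dl dl0 Hdl] := HD _ ep0.
have [j hj] : exists j, S / 2 ^+ j < dl.
  exists (Num.truncn (S / dl)).+1; rewrite ltr_pdivrMr// -ltr_pdivrMl// mulrC.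
  apply: (@lt_trans _ _ (Num.truncn (S / dl)).+1%:R); first exact: truncnS_gt.
  by rewrite -natrX ltr_nat ltn_expl.
have [i1 i2 i3 i4] := Is j; have := hy j; have := hx j; move: i1 i2 i3 i4.
set u := (s j).1; set v := (s j).2 => i1 i2 i3 i4 /andP[x1 x2] /andP[y1 y2].
apply/negP; rewrite -ltNge.
have Hj := holo_onS i1 i2 i3 i4 H.
have WSj : W j + V j <= S / 2 ^+ j.
  rewrite /W /V -mulrDl; apply: ler_wpM2r; last by rewrite /S; lra.
  by rewrite invr_ge0 ltW.
have u1 : u <= u + W j by rewrite lerDl.
have v1 : v <= v + V j by rewrite lerDl.
pose z0 : R[i] := x +i* y; pose p := k z0 - D * z0.
pose l z := k z + - (p + D * z).
have hl z : holo k z -> holo l z.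
  move=> hk; apply: (holoD hk); apply: holoN; apply: holoD; first exact: holo_cst.
  by apply: holoM; [exact: holo_cst|exact: holo_id].
have hlin z : holo (fun z => p + D * z) z.
  apply: holoD; first exact: holo_cst.
  by apply: holoM; [exact: holo_cst|exact: holo_id].
have -> : rint k u (u + W j) v (v + V j) = rint l u (u + W j) v (v + V j).
  rewrite (_ : k = fun z => l z + (p + D * z)); last by apply/funext => z; rewrite /l subrK.
  rewrite rintD//; last by move=> z hz1 hz2 _; split => //; apply: hl; exact: Hj.
  by rewrite rint_linear// addr0; congr rint; apply/funext => z; rewrite /l subrK.
have lM z : u <= complex.Re z <= u + W j -> v <= complex.Im z <= v + V j ->
    normc (l z) <= ep * (S / 2 ^+ j).
  move=> /andP[a1 a2] /andP[b1 b2].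
  have hn : normc (z - z0) <= S / 2 ^+ j.
    apply: le_trans (normc_le_ReIm _) _; apply: le_trans WSj.
    case: z a1 a2 b1 b2 => z1 z2 /= a1 a2 b1 b2.
    by apply: lerD; rewrite ler_norml; apply/andP; split; lra.
  have := Hdl (z - z0) (le_lt_trans hn hj).
  rewrite addrC [z0 + _]addrC subrK => hh.
  rewrite /l (_ : k z + _ = - (D * (z - z0)) + (k z - k z0)); last by rewrite /p; ring.
  by apply: le_trans hh _; rewrite ler_wpM2l// ltW.
apply: le_lt_trans (normc_rint_le u1 v1 _) _.
  by move=> z hz1 hz2 _; split; [apply: hl; exact: Hj|exact: lM].
have -> : u + W j - u + (v + V j - v) = W j + V j by ring.
apply: (@le_lt_trans _ _ (2 * (ep * (S / 2 ^+ j)) * (S / 2 ^+ j))).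
  rewrite ler_wpM2l//; apply: mulr_ge0 => //; apply: mulr_ge0; first exact: ltW.
  by apply: divr_ge0; exact: ltW.
have -> : 2 * (ep * (S / 2 ^+ j)) * (S / 2 ^+ j) = e / 4 ^+ j / 2.
  have -> : (4 : R) ^+ j = 2 ^+ j * 2 ^+ j by rewrite -exprMn; congr (_ ^+ _); ring.
  by rewrite /ep; field; rewrite !gt_eqF.
rewrite ltr_pdivrMr// ltr_pMr ?ltr1n//; apply: divr_gt0 => //; exact: exprn_gt0.
Qed.

Lemma rintZ (R : realType) (e : R[i]) (k : R[i] -> R[i]) (a b c d : R) : a <= b -> c <= d ->
  (forall z, a <= complex.Re z <= b -> c <= complex.Im z <= d ->
     [|| complex.Re z == a, complex.Re z == b, complex.Im z == c | complex.Im z == d] ->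
     holo k z) ->
  rint (fun z => e * k z) a b c d = e * rint k a b c d.
Proof.
move=> ab cd H; rewrite /rint /hint /vint.
have Hh y : y = c \/ y = d -> cont_on (fun t => k (t +i* y)) a b.
  move=> he; have h1 : c <= y <= d by case: he => ->; rewrite ?lexx ?cd.
  have h2 : (y == c) || (y == d) by case: he => ->; rewrite eqxx ?orbT.
  apply: holo_cont_hor => t ht.
  have h3 : [|| t == a, t == b, y == c | y == d] by rewrite h2 !orbT.
  exact: (H (t +i* y) ht h1 h3).
have Hv y : y = a \/ y = b -> cont_on (fun t => k (y +i* t)) c d.
  move=> he; have h1 : a <= y <= b by case: he => ->; rewrite ?lexx ?ab.
  have h2 : (y == a) || (y == b) by case: he => ->; rewrite eqxx ?orbT.
  apply: holo_cont_ver => t ht.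
  have h3 : [|| y == a, y == b, t == c | t == d] by rewrite orbA h2.
  exact: (H (y +i* t) h1 ht h3).
rewrite (CintZ e (Hh c (or_introl erefl))) (CintZ e (Hh d (or_intror erefl))).
rewrite (CintZ e (Hv a (or_introl erefl))) (CintZ e (Hv b (or_intror erefl))).
by ring.
Qed.

(** The four rectangles between the large boundary and the small square do not contain [w], so
    Goursat's theorem applies to each of them. *)
Lemma rint_deform (R : realType) (k : R[i] -> R[i]) (a b c d : R) (w : R[i]) (e : R) :
  0 < e -> a <= complex.Re w - e -> complex.Re w + e <= b ->
  c <= complex.Im w - e -> complex.Im w + e <= d ->
  (forall z, a <= complex.Re z <= b -> c <= complex.Im z <= d -> z != w -> holo k z) ->
  rint k a b c d = rint k (complex.Re w - e) (complex.Re w + e)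
                          (complex.Im w - e) (complex.Im w + e).
Proof.
move=> e0 h1 h2 h3 h4 H; set p := complex.Re w in h1 h2 *; set q := complex.Im w in h3 h4 *.
have Nw x y : (x != p) || (y != q) -> x +i* y != w.
  by move=> h; apply: contraTneq h => E; rewrite negb_or !negbK /p /q -E /= !eqxx.
have K x y : a <= x <= b -> c <= y <= d -> (x != p) || (y != q) -> holo k (x +i* y).
  by move=> hx hy hn; apply: H => //; exact: Nw.
have G x1 x2 y1 y2 : a <= x1 -> x1 <= x2 -> x2 <= b -> c <= y1 -> y1 <= y2 -> y2 <= d ->
    [|| x2 < p, p < x1, y2 < q | q < y1] -> rint k x1 x2 y1 y2 = 0.
  move=> i1 i2 i3 i4 i5 i6 i7; apply: goursat => // -[x y] /= /andP[x3 x4] /andP[y3 y4].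
  apply: K.
  - by rewrite (le_trans i1)// (le_trans x4).
  - by rewrite (le_trans i4)// (le_trans y4).
  case/or4P: i7 => h; apply/orP.
  - by left; rewrite lt_eqF// (le_lt_trans x4).
  - by left; rewrite gt_eqF// (lt_le_trans h).
  - by right; rewrite lt_eqF// (le_lt_trans y4).
  - by right; rewrite gt_eqF// (lt_le_trans h).
have pe : p - e < p by rewrite gtrBl.
have pe' : p < p + e by rewrite ltrDl.
have qe : q - e < q by rewrite gtrBl.
have qe' : q < q + e by rewrite ltrDl.
have cq : c < q := le_lt_trans h3 qe.
have qd : q < d := lt_le_trans qe' h4.
have pp := ltW (lt_trans pe pe'); have qq := ltW (lt_trans qe qe').
have ppb := le_trans pp h2; have cd := ltW (lt_trans cq qd); have cqe := le_trans h3 qq.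
rewrite (@rint_hsplit _ k a b c d (p - e))//; last 2 first.
- by move=> t ht; apply: K; rewrite ?lexx ?cd// (lt_eqF cq) orbT.
- by move=> t ht; apply: K; rewrite ?lexx ?cd// (gt_eqF qd) orbT.
rewrite G ?pe ?lexx//.
rewrite add0r (@rint_hsplit _ k (p - e) b c d (p + e))//; last 2 first.
- move=> t /andP[t1 t2]; apply: K; rewrite ?lexx ?cd ?t2 ?andbT ?(le_trans h1 t1)//.
  by rewrite (lt_eqF cq) orbT.
- move=> t /andP[t1 t2]; apply: K; rewrite ?lexx ?cd ?t2 ?andbT ?(le_trans h1 t1)//.
  by rewrite (gt_eqF qd) orbT.
rewrite [X in _ + X]G ?pe' ?orbT ?lexx ?(le_trans h1 pp)//.
rewrite addr0 (@rint_vsplit _ k (p - e) (p + e) c d (q - e))//; last first.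
- move=> t ht; apply: K => //; first by rewrite h2 (le_trans h1 pp).
  by rewrite (gt_eqF pe').
- move=> t ht; apply: K => //; first by rewrite h1 ppb.
  by rewrite (lt_eqF pe).
- exact: le_trans qq h4.
rewrite G ?qe ?orbT ?lexx ?(le_trans h1 pp) ?(le_trans qq h4)//.
rewrite add0r (@rint_vsplit _ k (p - e) (p + e) (q - e) d (q + e))//; last 2 first.
- move=> t /andP[t1 t2]; apply: K; first by rewrite h1 ppb.
    by rewrite t2 (le_trans h3 t1).
  by rewrite (lt_eqF pe).
- move=> t /andP[t1 t2]; apply: K; first by rewrite h2 (le_trans h1 pp).
    by rewrite t2 (le_trans h3 t1).
  by rewrite (gt_eqF pe').
by rewrite [X in _ + X]G ?qe' ?orbT ?lexx// addr0.
Qed.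

(** After deformation to a square of half-side [e] around [w], the integral is O(e). *)
Lemma rint_removable (R : realType) (k : R[i] -> R[i]) (a b c d : R) (w : R[i]) (r M : R) :
  a < complex.Re w < b -> c < complex.Im w < d ->
  (forall z, a <= complex.Re z <= b -> c <= complex.Im z <= d -> z != w -> holo k z) ->
  0 < r -> (forall z, z != w -> normc (z - w) < r -> normc (k z) <= M) ->
  rint k a b c d = 0.
Proof.
move=> /andP[aw wb] /andP[cw wd] H r0 kM.
apply/eqP; rewrite -normc_eq0; apply/negPn/negP => n0.
set I := normc _ in n0.
have I0 : 0 < I by rewrite lt_neqAle eq_sym n0 normc_ge0.
pose N := `|M| + 1.
have N0 : 0 < N by rewrite /N; have := normr_ge0 M; lra.
have [e [e0 e1 e2 e3 [e4 e5 e6]]] : exists e, [/\ 0 < e, e <= complex.Re w - a, e <= b - complex.Re w,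
    e <= complex.Im w - c & [/\ e <= d - complex.Im w, e <= r / 3 & e <= I / N / 16]].
  exists (Num.min (complex.Re w - a) (Num.min (b - complex.Re w) (Num.min (complex.Im w - c)
    (Num.min (d - complex.Im w) (Num.min (r / 3) (I / N / 16)))))).
  have x0 : 0 < I / N / 16 by do 2?apply: divr_gt0.
  have x1 : 0 < r / 3 by exact: divr_gt0.
  split; [by rewrite !lt_min !subr_gt0 aw wb cw wd x0 x1|by rewrite !ge_min lexx ?orbT..|].
  by split; rewrite !ge_min lexx ?orbT.
have E := @rint_deform _ k a b c d w e e0 _ _ _ _ H.
have {E} : normc (rint k a b c d) <= 2 * N * (4 * e).
  rewrite E; [|clear -e1 e2 e3 e4; lra..].
  have -> : 4 * e = (complex.Re w + e - (complex.Re w - e)) + (complex.Im w + e - (complex.Im w - e)) by ring.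
  apply: normc_rint_le; [clear -e0; lra..|].
  move=> z /andP[z1 z2] /andP[z3 z4] zb.
  have zw : z != w.
    apply/negP => /eqP zE; move: zb; rewrite zE; clear -e0.
    by case/or4P => /eqP; lra.
  split; first by apply: H => //; apply/andP; split; clear -e1 e2 e3 e4 z1 z2 z3 z4; lra.
  apply: (@le_trans _ _ M); last by rewrite /N; have := ler_norm M; clear; lra.
  apply: kM => //; apply: le_lt_trans (normc_le_ReIm _) _.
  apply: (@le_lt_trans _ _ (e + e)); last by clear -e5 e0; lra.
  move: {zw zb} z1 z2 z3 z4; clear -e0; case: z => zx zy; case: w => wx wy /= z1 z2 z3 z4.
  by apply: lerD; rewrite ler_norml; apply/andP; split; lra.
rewrite -/I; apply/negP; rewrite -ltNge.
have -> : 2 * N * (4 * e) = 8 * N * e by ring.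
apply: (@le_lt_trans _ _ (8 * N * (I / N / 16))).
  by apply: ler_wpM2l => //; apply: mulr_ge0 => //; exact: ltW.
have -> : 8 * N * (I / N / 16) = I / 2 by field; rewrite gt_eqF.
by clear -I0; lra.
Qed.

Lemma holo_kernel (R : realType) (z w : R[i]) : z != w -> holo (fun z => (z - w)^-1) z.
Proof.
move=> zw; apply: (@holoV _ (fun z => z - w)); first by rewrite subr_eq0.
by apply: holoD; [exact: holo_id|exact: holo_cst].
Qed.

(** On a square centred at [w], each pair of opposite sides combines to the integral of 2e / ((t -
    y)^2 + e^2), whose value is 4 atan 1 = pi. *)
Lemma rint_kernel (R : realType) (a b c d : R) (w : R[i]) :
  a < complex.Re w < b -> c < complex.Im w < d ->
  rint (fun z => (z - w)^-1) a b c d = 0 +i* (2 * pi).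
Proof.
move=> /andP[aw wb] /andP[cw wd].
have [e [e0 e1 e2 e3 e4]] : exists e, [/\ 0 < e, e <= complex.Re w - a, e <= b - complex.Re w,
    e <= complex.Im w - c & e <= d - complex.Im w].
  exists (Num.min (complex.Re w - a) (Num.min (b - complex.Re w) (Num.min (complex.Im w - c)
    (d - complex.Im w)))).
  by split; [rewrite !lt_min !subr_gt0 aw wb cw wd|rewrite !ge_min lexx ?orbT..].
rewrite (@rint_deform _ _ a b c d w e e0); first last.
- by move=> z _ _; exact: holo_kernel.
- by clear -e4; lra.
- by clear -e3; lra.
- by clear -e2; lra.
- by clear -e1; lra.
case: w {aw wb cw wd e1 e2 e3 e4} => p q /=.
have [he ve] : (forall t f, `|f| = e -> holo (fun z => (z - (p +i* q))^-1) (t +i* (q + f))) /\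
   (forall t f, `|f| = e -> holo (fun z => (z - (p +i* q))^-1) ((p + f) +i* t)).
  split => t f fe; apply: holo_kernel; rewrite eq_complex /= negb_and.
    by rewrite -(subr_eq0 (q + f)) [q + f]addrC addrK -(normr_eq0 f) fe (gt_eqF e0) orbT.
  by rewrite -(subr_eq0 (p + f)) [p + f]addrC addrK -(normr_eq0 f) fe (gt_eqF e0).
have ne : `|- e| = e by rewrite normrN gtr0_norm.
have pe : `|e| = e by rewrite gtr0_norm.
have dA y t : deriv_at (fun t => 2 * atan ((t - y) / e)) t (2 * e / ((t - y) ^+ 2 + e ^+ 2)).
  apply: drv_eq; first apply: drvZ.
    apply: (@drv_comp _ atan (fun t => (t - y) / e)).
      exact: is_derive1_atan.
    apply: drvM; last exact: drvC.
    by apply: drvB; [exact: drv_id|exact: drvC].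
  rewrite subr0 mulr0 addr0; field; rewrite (gt_eqF e0) andbT gt_eqF//.
  by rewrite ltr_wpDl ?sqr_ge0// exprn_gt0.
have ab y : y - e <= y + e by clear -e0; lra.
have vA y : 2 * atan ((y + e - y) / e) - 2 * atan ((y - e - y) / e) = 4 * atan 1.
  have -> : (y + e - y) / e = 1 by field; rewrite gt_eqF.
  have -> : (y - e - y) / e = -1 by field; rewrite gt_eqF.
  by rewrite atanN; ring.
rewrite /rint /hint /vint -!CintB; first last.
- by apply: (@holo_cont_hor _ (fun z => (z - (p +i* q))^-1)) => t _; exact: he.
- by apply: (@holo_cont_hor _ (fun z => (z - (p +i* q))^-1)) => t _; rewrite -[q - e]/(q + - e); exact: he.
- by apply: (@holo_cont_ver _ (fun z => (z - (p +i* q))^-1)) => t _; rewrite -[p - e]/(p + - e); exact: ve.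
- by apply: (@holo_cont_ver _ (fun z => (z - (p +i* q))^-1)) => t _; exact: ve.
set A := fun t => _ - _; set B := fun t => _ - _.
have iE (x y : R) : x ^+ 2 + y ^+ 2 != 0 ->
    (x +i* y)^-1 = (x / (x ^+ 2 + y ^+ 2)) +i* (- y / (x ^+ 2 + y ^+ 2)).
  move=> D0; have z0 : x +i* y != 0.
    by apply: contraNneq D0 => -[-> ->]; rewrite expr0n addr0.
  apply: (mulfI z0); rewrite mulfV//; apply/eqP; rewrite eq_complex /=.
  by apply/andP; split; apply/eqP; field.
have d0 (t y : R) : (t - y) ^+ 2 + e ^+ 2 != 0.
  by rewrite gt_eqF// ltr_wpDl ?sqr_ge0// exprn_gt0.
have d1 (t y : R) : (t - y) ^+ 2 + (- e) ^+ 2 != 0 by rewrite sqrrN.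
have d2 (t y : R) : e ^+ 2 + (t - y) ^+ 2 != 0 by rewrite addrC.
have d3 (t y : R) : (- e) ^+ 2 + (t - y) ^+ 2 != 0 by rewrite addrC.
have AE t : A t = 0 +i* (2 * e / ((t - p) ^+ 2 + e ^+ 2)).
  rewrite /A; have -> : t +i* (q - e) - (p +i* q) = (t - p) +i* - e.
    by apply/eqP; rewrite eq_complex /=; apply/andP; split; apply/eqP; ring.
  have -> : t +i* (q + e) - (p +i* q) = (t - p) +i* e.
    by apply/eqP; rewrite eq_complex /=; apply/andP; split; apply/eqP; ring.
  rewrite !iE// sqrrN; apply/eqP; rewrite eq_complex /=.
  by apply/andP; split; apply/eqP; field.
have BE t : B t = (2 * e / ((t - q) ^+ 2 + e ^+ 2)) +i* 0.
  rewrite /B; have -> : (p + e) +i* t - (p +i* q) = e +i* (t - q).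
    by apply/eqP; rewrite eq_complex /=; apply/andP; split; apply/eqP; ring.
  have -> : (p - e) +i* t - (p +i* q) = - e +i* (t - q).
    by apply/eqP; rewrite eq_complex /=; apply/andP; split; apply/eqP; ring.
  rewrite !iE// sqrrN addrC; apply/eqP; rewrite eq_complex /=.
  by apply/andP; split; apply/eqP; field.
have cA : cont_on A (p - e) (p + e).
  rewrite /A; apply: cont_onD; first by apply: (@holo_cont_hor _ (fun z => (z - (p +i* q))^-1)) => t _; rewrite -[q - e]/(q + - e); exact: he.
  apply: (@holo_cont_hor _ (fun z => - (z - (p +i* q))^-1)) => t _; apply: holoN; exact: he.
have cB : cont_on B (q - e) (q + e).
  rewrite /B; apply: cont_onD; first by apply: (@holo_cont_ver _ (fun z => (z - (p +i* q))^-1)) => t _; exact: ve.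
  apply: (@holo_cont_ver _ (fun z => - (z - (p +i* q))^-1)) => t _; apply: holoN.
  by rewrite -[p - e]/(p + - e); exact: ve.
rewrite (@Cint_FTC _ A (fun _ => 0) (fun t => 2 * atan ((t - p) / e)))//; last 2 first.
- by move=> t _; rewrite AE; exact: drvC.
- by move=> t _; rewrite AE; exact: dA.
rewrite (@Cint_FTC _ B (fun t => 2 * atan ((t - q) / e)) (fun _ => 0))//; last 2 first.
- by move=> t _; rewrite BE; exact: dA.
- by move=> t _; rewrite BE; exact: drvC.
by rewrite !vA atan1; apply/eqP; rewrite eq_complex /=; apply/andP; split; apply/eqP; field.
Qed.

(** The difference quotient of [k] at [w] is bounded near [w], so its integral vanishes by
    [rint_removable], and k(w) times the kernel remains. *)
Lemma cauchy_formula (R : realType) (k : R[i] -> R[i]) (a b c d : R) (w : R[i]) :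
  a < complex.Re w < b -> c < complex.Im w < d -> holo_on k a b c d ->
  rint (fun z => k z / (z - w)) a b c d = k w * (0 +i* (2 * pi)).
Proof.
move=> hw1 hw2 H; have /andP[w1 w2] := hw1; have /andP[w3 w4] := hw2.
have kw : holo k w by apply: H; rewrite !ltW.
have [dl dl0 [D D0 HD]] := holo_near_bound kw.
pose q z := (k z - k w) / (z - w).
have ab := ltW (lt_trans w1 w2); have cd := ltW (lt_trans w3 w4).
have hq z : a <= complex.Re z <= b -> c <= complex.Im z <= d -> z != w -> holo q z.
  move=> h1 h2 h3; apply: holoM; last exact: holo_kernel.
  by apply: holoD; [exact: H|exact: holo_cst].
have bd z : [|| complex.Re z == a, complex.Re z == b, complex.Im z == c | complex.Im z == d] ->
    z != w.
  apply: contraL => /eqP ->.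
  by rewrite !negb_or (gt_eqF w1) (lt_eqF w2) (gt_eqF w3) (lt_eqF w4).
have -> : (fun z => k z / (z - w)) = (fun z => q z + k w * (z - w)^-1).
  by apply/funext => z; rewrite /q -mulrDl subrK.
rewrite rintD//; last first.
  move=> z h1 h2 /bd h3; split; first exact: hq.
  by apply: holoM; [exact: holo_cst|exact: holo_kernel].
rewrite rintZ//; last by move=> z h1 h2 /bd h3; exact: holo_kernel.
rewrite rint_kernel// (@rint_removable _ q a b c d w dl D)// ?add0r// => z zw zd.
have zw0 : 0 < normc (z - w) by rewrite normc_gt0 subr_eq0.
by rewrite /q normcM normcV ler_pdivrMr//; exact: HD.
Qed.

(** * The Hermite interpolation remainder *)

(** The divided difference is displayed as a polynomial in [x] of degree less than [D]: after
    integration in [z] it stays one, and becomes the interpolant. *)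
Lemma divided_difference (F : comNzRingType) (D : nat) (p : {poly F}) : (size p <= D.+1)%N ->
  exists q : nat -> {poly F}, forall z x : F,
    p.[z] - p.[x] = (z - x) * \sum_(j < D) (q j).[z] * x ^+ j.
Proof.
elim: D p => [|D IH] p sp.
  exists (fun _ => 0) => z x; rewrite big_ord0 mulr0 (size1_polyC sp) !hornerC.
  exact: subrr.
elim/poly_ind: p sp => [|p c _] sp.
  exists (fun _ => 0) => z x; rewrite !horner0 subrr big1 ?mulr0// => i _.
  by rewrite mul0r.
have /IH[q Hq] : (size p <= D.+1)%N.
  have [->|p0] := eqVneq p 0; first by rewrite size_poly0.
  by move: sp; rewrite size_MXaddC (negPf p0).
exists (fun j => if j is i.+1 then q i else p) => z x.
rewrite !hornerMXaddC big_ord_recl /= expr0 mulr1.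
have -> : \sum_(i < D) (q i).[z] * x ^+ bump 0 i = x * \sum_(i < D) (q i).[z] * x ^+ i.
  by rewrite mulr_sumr; apply: eq_bigr => i _; rewrite /bump leq0n add1n exprS; ring.
by rewrite mulrDr mulrCA -Hq; ring.
Qed.

Lemma eq_rint (R : realType) (k l : R[i] -> R[i]) (a b c d : R) : a <= b -> c <= d ->
  (forall z, a <= complex.Re z <= b -> c <= complex.Im z <= d ->
     [|| complex.Re z == a, complex.Re z == b, complex.Im z == c | complex.Im z == d] ->
     k z = l z) ->
  rint k a b c d = rint l a b c d.
Proof.
move=> ab cd H; rewrite /rint /hint /vint.
have Hh y : y = c \/ y = d -> forall t, a <= t <= b -> k (t +i* y) = l (t +i* y).
  move=> he t ht; have h1 : c <= y <= d by case: he => ->; rewrite ?lexx ?cd.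
  have h2 : (y == c) || (y == d) by case: he => ->; rewrite eqxx ?orbT.
  have h3 : [|| t == a, t == b, y == c | y == d] by rewrite h2 !orbT.
  exact: (H (t +i* y) ht h1 h3).
have Hv y : y = a \/ y = b -> forall t, c <= t <= d -> k (y +i* t) = l (y +i* t).
  move=> he t ht; have h1 : a <= y <= b by case: he => ->; rewrite ?lexx ?ab.
  have h2 : (y == a) || (y == b) by case: he => ->; rewrite eqxx ?orbT.
  have h3 : [|| y == a, y == b, t == c | t == d] by rewrite orbA h2.
  exact: (H (y +i* t) h1 ht h3).
rewrite (eq_Cint (Hh c (or_introl erefl))) (eq_Cint (Hh d (or_intror erefl))).
by rewrite (eq_Cint (Hv a (or_introl erefl))) (eq_Cint (Hv b (or_intror erefl))).
Qed.

Lemma rint_sum (R : realType) (K : nat -> R[i] -> R[i]) (x : R[i]) (a b c d : R) (D : nat) :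
  a <= b -> c <= d ->
  (forall z, a <= complex.Re z <= b -> c <= complex.Im z <= d ->
     [|| complex.Re z == a, complex.Re z == b, complex.Im z == c | complex.Im z == d] ->
     forall j, holo (K j) z) ->
  (forall z, a <= complex.Re z <= b -> c <= complex.Im z <= d ->
     [|| complex.Re z == a, complex.Re z == b, complex.Im z == c | complex.Im z == d] ->
     holo (fun z => \sum_(j < D) K j z * x ^+ j) z) /\
  rint (fun z => \sum_(j < D) K j z * x ^+ j) a b c d =
    \sum_(j < D) rint (K j) a b c d * x ^+ j.
Proof.
move=> ab cd H; elim: D => [|D [IH1 IH2]].
  rewrite (_ : (fun z => _) = fun _ => 0).
    split; first by move=> z _ _ _; exact: holo_cst.
    rewrite big_ord0 -[in LHS](_ : (fun z : R[i] => 0 * 0) = fun _ => 0); last first.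
      by apply/funext => z; rewrite mul0r.
    rewrite (@rintZ _ 0 (fun _ => 0))// ?mul0r// => z _ _ _; exact: holo_cst.
  by apply/funext => z; rewrite big_ord0.
rewrite (_ : (fun z => _) = fun z => \sum_(j < D) K j z * x ^+ j + x ^+ D * K D z); last first.
  by apply/funext => z; rewrite big_ord_recr /= [K D z * _]mulrC.
have H2 z : a <= complex.Re z <= b -> c <= complex.Im z <= d ->
     [|| complex.Re z == a, complex.Re z == b, complex.Im z == c | complex.Im z == d] ->
     holo (fun z => x ^+ D * K D z) z.
  by move=> h1 h2 h3; apply: holoM; [exact: holo_cst|exact: H].
split; first by move=> z h1 h2 h3; apply: holoD; [exact: IH1|exact: H2].
rewrite rintD//; last by move=> z h1 h2 h3; split; [exact: IH1|exact: H2].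
rewrite IH2 rintZ//; last by move=> z h1 h2 h3; exact: H.
by rewrite big_ord_recr /= [_ * x ^+ D]mulrC.
Qed.

(** With w = i sqrt x, the kernel is 1/(s - w) + 1/(s + w), and each pole contributes 2 pi i f(x).
    In this form the coalescence of the poles at x = 0 needs no separate treatment. *)
Lemma cauchy_formula_sqr (R : realType) (f : R[i] -> R[i]) (rho T x : R) :
  0 < rho -> 0 <= x -> Num.sqrt x < T ->
  holo_on (fun s => f (- s ^+ 2)) (- rho) rho (- T) T ->
  rint (fun s => f (- s ^+ 2) * (2 * s) / (s ^+ 2 + x%:C)) (- rho) rho (- T) T =
  (0 +i* (4 * pi)) * f x%:C.
Proof.
move=> r0 x0 xT H; set r := Num.sqrt x in xT.
have rr : r ^+ 2 = x by rewrite sqr_sqrtr.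
have r_ge0 : 0 <= r by exact: sqrtr_ge0.
pose w : R[i] := 0 +i* r.
have wE : - w ^+ 2 = x%:C.
  by apply/eqP; rewrite eq_complex /= -rr; apply/andP; split; apply/eqP; ring.
have sE s : s ^+ 2 + x%:C = (s - w) * (s - - w) by rewrite -wE; ring.
pose g s := f (- s ^+ 2).
have rb : - rho <= rho by clear -r0; lra.
have Tb : - T <= T by clear -r_ge0 xT; lra.
have bd z : [|| complex.Re z == - rho, complex.Re z == rho, complex.Im z == - T | complex.Im z == T] ->
    z != w /\ z != - w.
  move=> hz; split; apply: contraTneq hz => ->; rewrite /= !negb_or.
    by apply/and4P; split; apply/eqP; clear -r0 r_ge0 xT; lra.
  by apply/and4P; split; apply/eqP; clear -r0 r_ge0 xT; lra.
have hk v z : - rho <= complex.Re z <= rho -> - T <= complex.Im z <= T -> z != v ->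
    holo (fun s => g s / (s - v)) z.
  by move=> h1 h2 h3; apply: holoM; [exact: H|exact: holo_kernel].
transitivity (rint (fun s => g s / (s - w) + g s / (s - - w)) (- rho) rho (- T) T).
  apply: eq_rint => // z _ _ /bd[n1 n2]; rewrite sE -/(g _).
  have -> : 2 * z = (z - w) + (z - - w) by ring.
  rewrite -subr_eq0 in n1; rewrite -subr_eq0 in n2; move: n1 n2.
  by move: (z - w) (z - - w) (g z) => u v y n1 n2; field; rewrite n1 n2.
rewrite rintD//; last by move=> z h1 h2 /bd[n1 n2]; split; exact: hk.
rewrite !cauchy_formula//=; last 4 first.
- by clear -r0; apply/andP; split; lra.
- by clear -r_ge0 xT; apply/andP; split; lra.
- by clear -r0; apply/andP; split; lra.
- by clear -r_ge0 xT; apply/andP; split; lra.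
rewrite /g sqrrN wE; move: (f _) => [u v].
by apply/eqP; rewrite eq_complex /=; apply/andP; split; apply/eqP; ring.
Qed.

Lemma holo_hornerM2 (R : realType) (p : {poly R[i]}) (z : R[i]) :
  holo (fun s => p.[- s ^+ 2]) z.
Proof.
apply: (@holo_comp _ (horner p) (fun s => - s ^+ 2)); first exact: holo_horner.
by apply: holoN; apply: holoM; exact: holo_id.
Qed.

Lemma sqrD_eq0 (R : realType) (z : R[i]) (x : R) : 0 <= x -> z ^+ 2 + x%:C = 0 ->
  complex.Re z = 0 /\ `|complex.Im z| = Num.sqrt x.
Proof.
case: z => a b x0 /eqP; rewrite eq_complex /= => /andP[/eqP h1 /eqP h2].
have a0 : a = 0.
  apply/eqP; apply: contraT => na; have b0 : b = 0.
    by apply: (mulfI na); clear -h2; lra.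
  have : 0 < a * a by rewrite -expr2 lt0r sqrf_eq0 na sqr_ge0.
  by move: h1; rewrite b0; clear -x0; lra.
split => //; rewrite -sqrtr_sqr; congr Num.sqrt.
by move: h1; rewrite a0 expr2; clear; lra.
Qed.

(* The Hermite interpolant at the zeros of [p], as a contour integral.  It does
   not depend on [T] because the zeros of [p (- s ^+ 2)] have [|Im s| < T1]. *)
Lemma hermite_remainder (R : realType) (f : R[i] -> R[i]) (rho T1 : R) (D : nat)
    (p : {poly R[i]}) :
  0 < rho -> 0 < T1 -> (size p <= D.+1)%N ->
  (forall s, - rho <= complex.Re s <= rho -> holo (fun s => f (- s ^+ 2)) s) ->
  (forall s, (complex.Re s != 0) || (T1 <= `|complex.Im s|) -> p.[- s ^+ 2] != 0) ->
  exists H : {poly R[i]}, (size H <= D)%N /\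
    forall x T, 0 <= x -> T1 <= T -> Num.sqrt x < T ->
      (0 +i* (4 * pi)) * (f x%:C - H.[x%:C]) = p.[x%:C] *
        rint (fun s => f (- s ^+ 2) * (2 * s) / (p.[- s ^+ 2] * (s ^+ 2 + x%:C)))
          (- rho) rho (- T) T.
Proof.
move=> r0 T10 sp hf hp; have [q Hq] := divided_difference sp.
pose g s := f (- s ^+ 2).
(* The integral of [K j] is, up to 4 pi i, the coefficient of x^j in the interpolant: with z = -s^2
   the factor z - x is - (s^2 + x), whence the sign. *)
pose K j s := - (g s * (2 * s) * (q j).[- s ^+ 2] / p.[- s ^+ 2]).
have hK j s : - rho <= complex.Re s <= rho -> p.[- s ^+ 2] != 0 -> holo (K j) s.
  move=> h1 h2; apply: holoN; apply: holoM; last first.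
    by apply: (@holoV _ (fun s => p.[- s ^+ 2])) => //; exact: holo_hornerM2.
  apply: holoM; last exact: holo_hornerM2.
  by apply: holoM; [exact: hf|apply: holoM; [exact: holo_cst|exact: holo_id]].
have rb : - rho <= rho by clear -r0; lra.
have bd T z : T1 <= T ->
    [|| complex.Re z == - rho, complex.Re z == rho, complex.Im z == - T | complex.Im z == T] ->
    p.[- z ^+ 2] != 0.
  move=> hT hz; apply: hp; case/or4P: hz => /eqP ->.
  - by rewrite oppr_eq0 (gt_eqF r0).
  - by rewrite (gt_eqF r0).
  - by rewrite normrN (le_trans hT) ?orbT// ler_norm.
  - by rewrite (le_trans hT) ?orbT// ler_norm.
pose c j := rint (K j) (- rho) rho (- T1) T1.
have cT j T : T1 <= T -> rint (K j) (- rho) rho (- T) T = c j.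
  move=> hT.
  have Hl y : y = - rho \/ y = rho -> forall t, holo (K j) (y +i* t).
    move=> he t; apply: hK => /=; first by case: he => ->; rewrite ?lexx ?rb.
    by apply: hp => /=; case: he => ->; rewrite ?oppr_eq0 (gt_eqF r0).
  have Hl1 := Hl _ (or_introl erefl); have Hl2 := Hl _ (or_intror erefl).
  rewrite (@rint_vsplit _ (K j) _ _ (- T) T (- T1))//; [|clear -T10 hT; lra..].
  rewrite goursat//; last 2 first.
  - by clear -T10 hT; lra.
  - move=> z hz /andP[z1 z2]; apply: hK => //; apply: hp.
    by rewrite ler_normr [T1 <= - _]lerNr z2 !orbT.
  rewrite add0r (@rint_vsplit _ (K j) _ _ (- T1) T T1)//; [|clear -T10 hT; lra..].
  rewrite [X in _ + X]goursat ?addr0//.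
  move=> z hz /andP[z1 z2]; apply: hK => //; apply: hp.
  by rewrite ler_normr z1 orbT.
have L0 : 0 +i* (4 * pi) != 0 :> R[i].
  by rewrite eq_complex /= eqxx /= mulf_neq0// gt_eqF// pi_gt0.
exists ((0 +i* (4 * pi))^-1 *: \poly_(j < D) c j); split.
  by rewrite (leq_trans (size_scale_leq _ _))// size_poly.
move=> x T x0 hT xT; rewrite hornerZ mulrBr mulVKf// horner_poly.
have Tb : - T <= T by clear -T10 hT; lra.
pose Phi s := g s * (2 * s) / (p.[- s ^+ 2] * (s ^+ 2 + x%:C)).
have s0 z : [|| complex.Re z == - rho, complex.Re z == rho, complex.Im z == - T | complex.Im z == T] ->
   z ^+ 2 + x%:C != 0.
  move=> h; apply/negP => /eqP /(sqrD_eq0 x0)[e1 e2]; have := sqrtr_ge0 x => s_ge0.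
  case/or4P: h => /eqP h; move: e1 e2; rewrite h.
  - by clear -r0; lra.
  - by clear -r0; lra.
  - by rewrite normrN ger0_norm => [_|]; clear -xT s_ge0; lra.
  - by rewrite ger0_norm => [_|]; clear -xT s_ge0; lra.
have hPhi z : - rho <= complex.Re z <= rho -> p.[- z ^+ 2] != 0 -> z ^+ 2 + x%:C != 0 -> holo Phi z.
  move=> h1 h2 h3; apply: holoM.
    by apply: holoM; [exact: hf|apply: holoM; [exact: holo_cst|exact: holo_id]].
  apply: (@holoV _ (fun s => p.[- s ^+ 2] * (s ^+ 2 + x%:C))); first exact: mulf_neq0.
  apply: holoM; first exact: holo_hornerM2.
  by apply: holoD; [apply: holoM; exact: holo_id|exact: holo_cst].
have [hS ES] := @rint_sum _ K x%:C (- rho) rho (- T) T D rb Tb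
  (fun z h1 h2 h3 j => hK j z h1 (bd T z hT h3)).
rewrite -(@cauchy_formula_sqr _ f rho T x)//; last by move=> z h1 _; exact: hf.
transitivity (rint (fun s => \sum_(j < D) K j s * x%:C ^+ j + p.[x%:C] * Phi s) (- rho) rho (- T) T
   - \sum_(i < D) c i * x%:C ^+ i).
  congr (_ - _); apply: eq_rint => // z h1 h2 h3.
  have pz := bd _ _ hT h3; have zx := s0 _ h3.
  have -> : \sum_(j < D) K j z * x%:C ^+ j =
      - (g z * (2 * z) / p.[- z ^+ 2]) * \sum_(j < D) (q j).[- z ^+ 2] * x%:C ^+ j.
    by rewrite mulr_sumr; apply: eq_bigr => i _; rewrite /K; ring.
  have -> : \sum_(j < D) (q j).[- z ^+ 2] * x%:C ^+ j =
      - (p.[- z ^+ 2] - p.[x%:C]) / (z ^+ 2 + x%:C).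
    by rewrite Hq; field.
  by rewrite /Phi -/(g z); field; rewrite pz zx.
rewrite rintD//; last first.
  move=> z h1 h2 h3; split; first exact: hS.
  apply: holoM; first exact: holo_cst.
  by apply: hPhi => //; [exact: bd h3|exact: s0].
rewrite ES rintZ//; last by move=> z h1 h2 h3; apply: hPhi => //; [exact: bd h3|exact: s0].
under eq_bigr => j _ do rewrite cT//.
by rewrite addrAC subrr add0r.
Qed.

(** * Estimates of the contour integral, uniform in n *)

Lemma vint_le_atan (R : realType) (k : R[i] -> R[i]) (r a b K : R) : a <= b ->
  (forall t, a <= t <= b -> holo k (r +i* t) /\ normc (k (r +i* t)) <= K / (1 + t ^+ 2)) ->
  normc (vint k r a b) <= K * (atan b - atan a).
Proof.
move=> ab H; rewrite mulrBr.
have d1 (t : R) : deriv_at (fun t => K * atan t) t (K / (1 + t ^+ 2)).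
  by apply: drvZ; exact: is_derive1_atan.
have n0 (t : R) : 1 + t ^+ 2 != 0 by rewrite gt_eqF// ltr_pwDl ?sqr_ge0.
apply: (@normc_Cint_le _ _ (fun t => K * atan t) (fun t => K / (1 + t ^+ 2))) => //.
- by apply: holo_cont_ver => t /H[].
- move=> t _; apply: (@derive_continuous _ _ _ (K * (- (2 * t) / (1 + t ^+ 2) ^+ 2))).
  apply: drvZ; apply: drv_eq.
    apply: drvV; first exact: n0.
    apply: (@drvD _ (fun _ => 1) (fun t => t * t)); first exact: drvC.
    by apply: drvM; exact: drv_id.
  by move=> /=; rewrite add0r mul1r mulr1 -mulr2n mulr_natl.
- by move=> t /H[].
Qed.

(** For odd [Phi] the two vertical sides contribute equally. On the right side the part |t| <= T0 is
    moved to Re s = rho + d: [K1] bounds the two tails, [K2] the short horizontal connections, [K3]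
    the shifted segment, and [h] the horizontal sides at height T. *)
Lemma contour_bound (R : realType) (Phi : R[i] -> R[i]) (rho d T0 T K1 K2 K3 h : R) :
  0 < rho -> 0 <= d -> 0 <= T0 -> T0 <= T -> 0 <= K3 ->
  (forall s, Phi (- s) = - Phi s) ->
  holo_on Phi rho (rho + d) (- T0) T0 ->
  (forall t, T0 <= `|t| <= T -> holo Phi (rho +i* t)) ->
  (forall s, - rho <= complex.Re s <= rho -> `|complex.Im s| = T -> holo Phi s) ->
  (forall t, T0 <= `|t| <= T -> normc (Phi (rho +i* t)) <= K1 / (1 + t ^+ 2)) ->
  (forall s, rho <= complex.Re s <= rho + d -> `|complex.Im s| = T0 -> normc (Phi s) <= K2) ->
  (forall t, - T0 <= t <= T0 -> normc (Phi ((rho + d) +i* t)) <= K3 / (1 + t ^+ 2)) ->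
  (forall s, - rho <= complex.Re s <= rho -> `|complex.Im s| = T -> normc (Phi s) <= h) ->
  normc (rint Phi (- rho) rho (- T) T) <=
    4 * rho * h + 2 * (2 * (K1 * (pi / 2 - atan T0)) + 2 * (d * K2) + K3 * pi).
Proof.
move=> r0 d0 T00 T0T K30 odd hbox hr hh bK1 bK2 bK3 bh.
have T_ge0 := le_trans T00 T0T.
have nT0 : - T0 <= T0 by clear -T00; lra.
have nT : - T <= T by clear -T_ge0; lra.
have rd : rho <= rho + d by clear -d0; lra.
have hv t : - T <= t <= T -> holo Phi (rho +i* t).
  move=> /andP[t1 t2]; have [tT|tT] := lerP T0 `|t|.
    by apply: hr; rewrite tT /= ler_norml t1.
  have /ltW := tT; rewrite ler_norml => hT.
  by apply: hbox => //=; rewrite lexx.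
have cv := holo_cont_ver hv.
have K1_ge0 : 0 <= K1 / (1 + T0 ^+ 2).
  by apply: le_trans (normc_ge0 _) (bK1 T0 _); rewrite ger0_norm// lexx.
have left_right : vint Phi (- rho) (- T) T = - vint Phi rho (- T) T.
  have E t : Phi (- rho +i* t) = - Phi (rho +i* - t).
    by rewrite -odd; congr Phi; apply/eqP; rewrite eq_complex /= opprK !eqxx.
  rewrite /vint (@eq_Cint _ _ (fun t => (fun t => - Phi (rho +i* t)) (- t))); last first.
    by move=> t _; rewrite E.
  rewrite (@Cint_oppr _ (fun t => - Phi (rho +i* t)) T T_ge0); first exact: CintN.
  rewrite (_ : (fun t => - _) = (fun t => (- 1) * Phi (rho +i* t))).
    by apply: cont_onM => //; exact: cont_on_cst.
  by apply/funext => t; rewrite mulN1r.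
have bh' y : `|y| = T -> normc (hint Phi (- rho) rho y) <= 2 * rho * h.
  move=> hy; rewrite (_ : 2 * rho * h = h * (rho - - rho)); last by ring.
  apply: normc_Cint_le_cst; first by clear -r0; lra.
    by apply: holo_cont_hor => t ht; exact: hh.
  by move=> t ht; exact: bh.
have b2 y : `|y| = T0 -> normc (hint Phi rho (rho + d) y) <= d * K2.
  move=> hy; rewrite (_ : d * K2 = K2 * (rho + d - rho)); last by ring.
  apply: normc_Cint_le_cst => //.
    apply: holo_cont_hor => t ht; apply: hbox => //=.
    by rewrite -ler_norml hy.
  by move=> t ht; exact: bK2.
have b3 : normc (vint Phi (rho + d) (- T0) T0) <= K3 * pi.
  apply: (@le_trans _ _ (K3 * (atan T0 - atan (- T0)))).
    apply: vint_le_atan => // t ht; split; last exact: bK3.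
    by apply: hbox => //=; rewrite lexx rd.
  apply: ler_wpM2l => //; rewrite atanN.
  by have := atan_ltpi2 T0; lra.
have K1_ge0' : 0 <= K1.
  by move: K1_ge0; rewrite pmulr_lge0// invr_gt0 ltr_pwDl ?sqr_ge0.
have b1 a b : a <= b -> (forall t, a <= t <= b -> T0 <= `|t| <= T) ->
    atan b - atan a <= pi / 2 - atan T0 ->
    normc (vint Phi rho a b) <= K1 * (pi / 2 - atan T0).
  move=> ab h1 h2; apply: (@le_trans _ _ (K1 * (atan b - atan a))).
    by apply: vint_le_atan => // t /h1 ht; split; [exact: hr|exact: bK1].
  exact: ler_wpM2l.
have b1p : normc (vint Phi rho T0 T) <= K1 * (pi / 2 - atan T0).
  apply: b1 => //.
    by move=> t /andP[t1 t2]; rewrite ger0_norm ?(le_trans T00)// t1.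
  by have := atan_ltpi2 T; lra.
have b1n : normc (vint Phi rho (- T) (- T0)) <= K1 * (pi / 2 - atan T0).
  apply: b1.
  - by rewrite lerN2.
  - move=> t /andP[t1 t2]; rewrite ler0_norm; last by clear -t2 T00; lra.
    by apply/andP; split; clear -t1 t2; lra.
  - by rewrite !atanN; have := atan_ltpi2 T; lra.
have n1 : normc (0 +i* 1 : R[i]) = 1 by rewrite /= expr0n expr1n add0r sqrtr1.
have bm : normc (vint Phi rho (- T0) T0) <= 2 * (d * K2) + K3 * pi.
  have := goursat rd nT0 hbox; rewrite /rint => E.
  have {E} : (0 +i* 1) * vint Phi rho (- T0) T0 = hint Phi rho (rho + d) (- T0) -
     hint Phi rho (rho + d) T0 + (0 +i* 1) * vint Phi (rho + d) (- T0) T0.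
    by apply/eqP; rewrite -subr_eq0 -oppr_eq0 -E; apply/eqP; ring.
  move=> /(congr1 (@normc R)); rewrite normcM n1 mul1r => ->.
  apply: le_trans (normcD_le _ _) _; rewrite normcM n1 mul1r; apply: lerD => //.
  apply: le_trans (normcD_le _ _) _; rewrite normcN mulr_natl mulr2n.
  by apply: lerD; apply: b2; rewrite ?normrN ger0_norm.
have bv : normc (vint Phi rho (- T) T) <= 2 * (K1 * (pi / 2 - atan T0)) + (2 * (d * K2) + K3 * pi).
  rewrite /vint (@Cint_chasles _ _ (- T) T (- T0))//; last 2 first.
  - by rewrite lerN2.
  - by clear -T00 T0T; lra.
  rewrite (@Cint_chasles _ _ (- T0) T T0)//; last first.
    by apply: cont_onS cv; rewrite ?lerN2.
  set P := K1 * _ in b1 b1p b1n *; set M := _ + K3 * pi in bm *.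
  rewrite (_ : 2 * P + M = P + (M + P)); last by ring.
  apply: le_trans (normcD_le _ _) _; apply: lerD => //.
  by apply: le_trans (normcD_le _ _) _; apply: lerD.
rewrite /rint left_right.
apply: le_trans (normcD_le _ _) _; rewrite normcM n1 mul1r; apply: lerD.
  apply: le_trans (normcD_le _ _) _; rewrite normcN.
  by rewrite (_ : 4 * rho * h = 2 * rho * h + 2 * rho * h); [apply: lerD; apply: bh'; rewrite ?normrN ger0_norm|ring].
apply: le_trans (normcD_le _ _) _; rewrite opprK mulr_natl mulr2n; apply: lerD; rewrite -addrA//.
Qed.

(** The zeros [xs] count twice, which makes the interpolant a Hermite interpolant and leads to the
    square of the Laguerre polynomial; [e] is the multiplicity of the additional node 0. *)
Definition node_poly (R : realType) (e : nat) (xs : seq R) : {poly R[i]} :=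
  map_poly (real_complex R) ('X^e * (\prod_(x <- xs) ('X - x%:P)) ^+ 2).

Lemma size_node_poly (R : realType) (e : nat) (xs : seq R) :
  size (node_poly e xs) = (2 * size xs + e).+1.
Proof.
rewrite /node_poly size_map_poly mulrC expr2 -big_cat size_mulXn.
  by rewrite size_prod_XsubC size_cat addnS addnC mul2n addnn.
by rewrite monic_neq0// monic_prod_XsubC.
Qed.

Lemma normc_sqrD (R : realType) (r t x : R) : 0 <= x ->
  normc ((r +i* t) ^+ 2 + x%:C) ^+ 2 =
  (r ^+ 2 + (t - Num.sqrt x) ^+ 2) * (r ^+ 2 + (t + Num.sqrt x) ^+ 2).
Proof.
move=> x0; rewrite sqr_normc_ReIm /= -[in LHS](sqr_sqrtr x0).
by move: (Num.sqrt x) => y; ring.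
Qed.

Lemma normcX (R : realType) (z : R[i]) n : normc (z ^+ n) = normc z ^+ n.
Proof.
elim: n => [|n IH]; first by rewrite !expr0 /= expr0n expr1n addr0 sqrtr1.
by rewrite !exprS normcM IH.
Qed.

Lemma horner_map_node_prod (R : realType) (xs : seq R) (s : R[i]) :
  all (fun x => 0 <= x) xs ->
  normc (map_poly (real_complex R) (\prod_(x <- xs) ('X - x%:P))).[- s ^+ 2] ^+ 2 =
  strip_mod xs (complex.Re s) (complex.Im s).
Proof.
rewrite strip_modE rmorph_prod /= horner_prod; elim: xs => [|x xs IH].
  by rewrite !big_nil /= expr0n expr1n addr0 sqrtr1 expr1n.
move=> /= /andP[x0 /IH E]; rewrite !big_cons normcM exprMn E; congr (_ * _).
rewrite rmorphB /= map_polyX map_polyC /= hornerXsubC -opprD normcN.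
by case: s {E IH} => r t; exact: normc_sqrD.
Qed.

Lemma normc_node_poly (R : realType) (e : nat) (xs : seq R) (s : R[i]) :
  all (fun x => 0 <= x) xs ->
  normc (node_poly e xs).[- s ^+ 2] =
  normc s ^+ (2 * e) * strip_mod xs (complex.Re s) (complex.Im s).
Proof.
move=> xs0; rewrite /node_poly rmorphM rmorphXn /= map_polyX hornerM hornerXn.
rewrite rmorphXn /= horner_exp normcM !normcX horner_map_node_prod// normcN normcX.
by rewrite exprM.
Qed.

Lemma strip_mod_mono (R : realType) (xs : seq R) (r r' t : R) : 0 <= r -> r <= r' ->
  strip_mod xs r t <= strip_mod xs r' t.
Proof.
move=> r0 rr; rewrite /strip_mod; apply: ler_prod => y _.
apply/andP; split; first by apply: addr_ge0; exact: sqr_ge0.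
by rewrite lerD2r lerXn2r// nnegrE (le_trans r0).
Qed.

(** Bounds the Cauchy denominator from below, uniformly in t, at the price of a factor |s|. Keeping
    [x + r ^+ 2] is essential: integration in x then produces [laguerre_resolvent]. *)
Lemma sqrD_lower (R : realType) (r t x : R) : 0 < r -> 0 <= x ->
  r / 2 * (x + r ^+ 2) <= normc ((r +i* t) ^+ 2 + x%:C) * normc (r +i* t).
Proof.
move=> r0 x0; rewrite -ler_sqr ?nnegrE; last 2 first.
- by apply: mulr_ge0; [lra|apply: addr_ge0 => //; exact: sqr_ge0].
- by apply: mulr_ge0; exact: normc_ge0.
rewrite [X in _ <= X]exprMn normc_sqrD// sqr_normc_ReIm /=.
have y0 := sqrtr_ge0 x; rewrite -{1}(sqr_sqrtr x0); move: (Num.sqrt x) y0 => y y0.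
have key (A B y2 : R) : r ^+ 2 <= A -> r ^+ 2 <= B -> y2 <= 2 * (A + B) - 4 * r ^+ 2 ->
    (r / 2) ^+ 2 * (y2 + r ^+ 2) <= A * B.
  move=> hA hB hy; have r2 : 0 < r ^+ 2 by exact: exprn_gt0.
  have -> : (r / 2) ^+ 2 = r ^+ 2 / 4 by field.
  set q := r ^+ 2 in hA hB hy r2 *.
  have : 0 <= (A - q) * (B - q) by apply: mulr_ge0; lra.
  nra.
have key2 (u : R) : 0 <= u * y -> (r / 2 * (y ^+ 2 + r ^+ 2)) ^+ 2 <=
    (r ^+ 2 + (u - y) ^+ 2) * (r ^+ 2 + (u + y) ^+ 2) * (r ^+ 2 + u ^+ 2).
  move=> uy; rewrite [X in _ <= X]mulrAC.
  rewrite (_ : (_ * (_ + _)) ^+ 2 = (r / 2) ^+ 2 * (y ^+ 2 + r ^+ 2) * (y ^+ 2 + r ^+ 2)); last by ring.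
  apply: ler_pM; rewrite ?addr_ge0 ?sqr_ge0//.
  - by apply: mulr_ge0; [exact: sqr_ge0|apply: addr_ge0; exact: sqr_ge0].
  - apply: key; rewrite ?lerDl ?sqr_ge0//.
    by have := sqr_ge0 (u - 2 * y); have := sqr_ge0 (2 * u - y); rewrite !expr2; nra.
  - by have := sqr_ge0 u; rewrite !expr2; nra.
have [ty|ty] := lerP 0 (t * y); first exact: key2.
have := key2 (- t); rewrite sqrrN => /(_ ltac:(rewrite mulNr; lra)).
rewrite (_ : - t - y = - (t + y)) ?sqrrN; last by ring.
rewrite (_ : - t + y = - (t - y)) ?sqrrN; last by ring.
by rewrite [X in _ <= X * _]mulrC.
Qed.

Lemma node_kernel_bound (R : realType) (e : nat) (xs : seq R) (g : R[i]) (r t x : R) :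
  all (fun x => 0 <= x) xs -> 0 < r -> 0 <= x ->
  normc (g * (2 * (r +i* t)) /
    ((node_poly e xs).[- (r +i* t) ^+ 2] * ((r +i* t) ^+ 2 + x%:C))) <=
  normc g * (4 * (r ^+ 2 + t ^+ 2)) / (r ^+ (2 * e).+1 * ((x + r ^+ 2) * strip_mod xs r t)).
Proof.
move=> xs0 r0 x0; set s : R[i] := r +i* t.
have s2 : normc s ^+ 2 = r ^+ 2 + t ^+ 2 by rewrite sqr_normc_ReIm.
have sr : r <= normc s.
  by apply: le_trans (Re_le_normc s); rewrite /= ler_norm.
have S0 := strip_mod_gt0 xs t r0.
have xr : 0 < x + r ^+ 2 by rewrite ltr_wpDl// exprn_gt0.
have low := sqrD_lower t r0 x0; rewrite -/s in low.
rewrite normcM normcV !normcM normc_node_poly// -mulrA -[X in _ <= X]mulrA.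
apply: ler_wpM2l; first exact: normc_ge0.
have n2 : normc (2 : R[i]) = 2.
  by rewrite (_ : 2 = 2%:C :> R[i]) ?normc_real ?ger0_norm// rmorph_nat.
rewrite -[complex.Re s]/r -[complex.Im s]/t n2 -s2; set u := normc s in sr low *; set v := normc (s ^+ 2 + _) in low *.
have u0 : 0 < u := lt_le_trans r0 sr.
have v0 : 0 < v.
  rewrite -(pmulr_lgt0 _ u0); apply: lt_le_trans low.
  by apply: mulr_gt0 => //; apply: divr_gt0.
have ue : r ^+ (2 * e) <= u ^+ (2 * e) by rewrite lerXn2r// nnegrE ltW.
have re : 0 < r ^+ (2 * e) by exact: exprn_gt0.
have ue0 : 0 < u ^+ (2 * e) by exact: exprn_gt0.
rewrite ler_pdivlMr; last by apply: mulr_gt0; [exact: exprn_gt0|exact: mulr_gt0].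
rewrite mulrAC ler_pdivrMr; last by apply: mulr_gt0 => //; exact: mulr_gt0.
set S := strip_mod _ _ _ in S0 *; rewrite exprS.
have -> : 2 * u * (r * r ^+ (2 * e) * ((x + r ^+ 2) * S)) =
  (4 * u * S) * (r ^+ (2 * e) * (r / 2 * (x + r ^+ 2))) by field.
have -> : 4 * u ^+ 2 * (u ^+ (2 * e) * S * v) = (4 * u * S) * (u ^+ (2 * e) * (v * u)) by ring.
apply: ler_wpM2l; first by apply: mulr_ge0; [apply: mulr_ge0|]; exact: ltW.
apply: ler_pM => //; first exact: ltW.
by apply: mulr_ge0; [apply: divr_ge0; [exact: ltW|]|exact: ltW].
Qed.

Lemma strip_mod_far (R : realType) (xs : seq R) (r t : R) :
  all (fun x => 0 <= x) xs -> all (fun x => 2 * Num.sqrt x <= `|t|) xs ->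
  (`|t| / 2) ^+ (4 * size xs) <= strip_mod xs r t.
Proof.
move=> xs0 xst; rewrite strip_modE; elim: xs xs0 xst => [|x xs IH] /=.
  by rewrite big_nil muln0 expr0.
move=> /andP[x0 xs0] /andP[xt xst]; rewrite big_cons mulnS exprD.
have y0 := sqrtr_ge0 x; move: (Num.sqrt x) y0 xt => y y0 yt.
have key (w : R) : `|t| / 2 <= `|w| -> (`|t| / 2) ^+ 2 <= r ^+ 2 + w ^+ 2.
  move=> h; apply: (@le_trans _ _ (w ^+ 2)); last by rewrite lerDr sqr_ge0.
  by rewrite -[w ^+ 2]real_normK ?num_real// lerXn2r// nnegrE divr_ge0.
apply: ler_pM; [exact: exprn_ge0|exact: exprn_ge0| |exact: IH].
rewrite (_ : 4 = 2 + 2)%N// exprD; apply: ler_pM; rewrite ?sqr_ge0//; apply: key.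
  by have := ler_normD (t - y) y; rewrite subrK (ger0_norm y0); lra.
by have := ler_normB (t + y) y; rewrite addrK (ger0_norm y0); lra.
Qed.

(** On the horizontal sides the node polynomial, of large enough degree, absorbs the growth of [g];
    the decay 1/T lets these sides be sent to infinity. *)
Lemma node_kernel_far (R : realType) (e m : nat) (xs : seq R) (g s : R[i]) (rho T x G : R) :
  all (fun x => 0 <= x) xs -> all (fun x => 2 * Num.sqrt x <= T) xs ->
  (m <= size xs)%N -> 0 <= x -> 0 <= G -> 6 <= T -> rho <= T -> 2 * (rho ^+ 2 + x) <= T ^+ 2 ->
  `|complex.Re s| <= rho -> `|complex.Im s| = T -> normc g <= G * (1 + T ^+ 2) ^+ m ->
  normc (g * (2 * s) / ((node_poly e xs).[- s ^+ 2] * (s ^+ 2 + x%:C))) <= 8 * G / T.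
Proof.
move=> xs0 xsT mN x0 G0 T6 rT xT sr sT gG; rewrite normcM normcV !normcM normc_node_poly//.
have T0 : 0 < T by lra.
set u := normc s; set v := normc (s ^+ 2 + _).
have uT : T <= u by rewrite -sT Im_le_normc.
have u2 : u <= 2 * T by have := normc_le_ReIm s; rewrite -/u sT; lra.
have vT : T ^+ 2 / 2 <= v.
  apply: le_trans (Re_le_normc _).
  have r2 : complex.Re s ^+ 2 <= rho ^+ 2.
    rewrite -[complex.Re s ^+ 2]real_normK ?num_real// lerXn2r// nnegrE.
    exact: le_trans sr.
  have t2 : complex.Im s ^+ 2 = T ^+ 2 by rewrite -sT real_normK ?num_real.
  rewrite ler_normr; apply/orP; right.
  case: s {gG sr sT u uT u2 v} r2 t2 => a b /= r2 t2.
  by rewrite -!expr2 t2; have := sqr_ge0 T; lra.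
have n2 : normc (2 : R[i]) = 2.
  by rewrite (_ : 2 = 2%:C :> R[i]) ?normc_real ?ger0_norm// rmorph_nat.
have SN : (1 + T ^+ 2) ^+ m <= strip_mod xs (complex.Re s) (complex.Im s).
  apply: le_trans (strip_mod_far _ xs0 _); rewrite sT//.
  apply: (@le_trans _ _ ((T / 2) ^+ (4 * m))).
    rewrite exprM; apply: lerXn2r; rewrite ?nnegrE; last first.
    - rewrite (_ : (T / 2) ^+ 4 = T ^+ 2 * T ^+ 2 / 16); last by field.
      have : 36 <= T ^+ 2 by rewrite expr2; nra.
      by move: (T ^+ 2) => q q36; nra.
    - by apply: exprn_ge0; apply: divr_ge0 => //; exact: ltW.
    - by rewrite addr_ge0 ?sqr_ge0.
  by rewrite ler_weXn2l ?leq_mul2l//; lra.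
rewrite n2; set S := strip_mod _ _ _ in SN *; set P := (1 + T ^+ 2) ^+ m in gG SN.
have P0 : 0 < P by apply: exprn_gt0; rewrite ltr_pwDl ?sqr_ge0.
have ue : 1 <= u ^+ (2 * e) by apply: exprn_ege1; lra.
have T2 : 0 < T ^+ 2 / 2 by apply: divr_gt0 => //; exact: exprn_gt0.
apply: (@le_trans _ _ (G * P * (2 * (2 * T)) / (1 * P * (T ^+ 2 / 2)))).
  apply: ler_pM.
  - by apply: mulr_ge0; [exact: normc_ge0|apply: mulr_ge0 => //; exact: normc_ge0].
  - rewrite invr_ge0; apply: mulr_ge0; last exact: normc_ge0.
    by apply: mulr_ge0; [exact/exprn_ge0/normc_ge0|exact: le_trans (ltW P0) SN].
  - apply: ler_pM => //; [exact: normc_ge0|by apply: mulr_ge0 => //; exact: normc_ge0|].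
    by rewrite ler_wpM2l.
  - rewrite lef_pV2 ?posrE; last 2 first.
    + apply: mulr_gt0; last by lra.
      by apply: mulr_gt0; [lra|exact: lt_le_trans SN].
    + by apply: mulr_gt0 => //; apply: mulr_gt0.
    + by apply: ler_pM => //; [apply: mulr_ge0 => //; exact: ltW|exact: ltW|apply: ler_pM => //; exact: ltW].
by rewrite le_eqVlt; apply/orP; left; apply/eqP; field; rewrite !gt_eqF.
Qed.

Lemma atan_near_pi2 (R : realType) (eta : R) : 0 < eta ->
  exists2 T0 : R, 0 <= T0 & pi / 2 - atan T0 <= eta.
Proof.
move=> eta0; have /cvgrPdist_lt/(_ _ eta0)[M [_ HM]] := @cvgy_atan R.
exists (`|M| + 1); first by rewrite addr_ge0.
have /HM : M < `|M| + 1 by rewrite (le_lt_trans (ler_norm M))// ltrDl.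
by move=> /ltW /(le_trans (ler_norm _)).
Qed.

(** Of the m + 2 powers of 1 + t^2 gained from [strip_mod_growth], m absorb the growth of [g], one
    absorbs the factor r^2 + t^2, and the last one makes the bound integrable. *)
Lemma node_kernel_growth (R : realType) (e m : nat) (xs : seq R) (g : R[i]) (r t x G C : R) :
  all (fun x => 0 <= x) xs -> 0 < r -> 0 <= x -> 0 < C ->
  normc g <= G * (1 + t ^+ 2) ^+ m ->
  C * (1 + t ^+ 2) ^+ (m + 2) * strip_mod xs r 0 <= strip_mod xs r t ->
  normc (g * (2 * (r +i* t)) /
    ((node_poly e xs).[- (r +i* t) ^+ 2] * ((r +i* t) ^+ 2 + x%:C))) <=
  G * (4 * (r ^+ 2 + 1)) / (r ^+ (2 * e).+1 * C) / (strip_mod xs r 0 * (x + r ^+ 2)) / (1 + t ^+ 2).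
Proof.
move=> xs0 r0 x0 C0 gG mC; apply: le_trans (node_kernel_bound e g t xs0 r0 x0) _.
have S0 := strip_mod_gt0 xs 0 r0; have St := strip_mod_gt0 xs t r0.
set S := strip_mod xs r 0 in mC S0 *; set U := strip_mod xs r t in mC St *.
have q0 : 0 < 1 + t ^+ 2 by rewrite ltr_pwDl ?sqr_ge0.
have P0 : 0 < (1 + t ^+ 2) ^+ m by exact: exprn_gt0.
have re : 0 < r ^+ (2 * e).+1 by exact: exprn_gt0.
have xr : 0 < x + r ^+ 2 by rewrite ltr_wpDl// exprn_gt0.
rewrite exprD in mC; set P := (1 + t ^+ 2) ^+ m in gG mC P0.
set q := 1 + t ^+ 2 in q0 mC *.
have CS : 0 < C * (P * q ^+ 2) * S.
  by apply: mulr_gt0 => //; apply: mulr_gt0 => //; apply: mulr_gt0 => //; exact: exprn_gt0.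
apply: (@le_trans _ _ (G * P * (4 * ((r ^+ 2 + 1) * q)) /
    (r ^+ (2 * e).+1 * ((x + r ^+ 2) * (C * (P * q ^+ 2) * S))))).
  apply: ler_pM.
  - apply: mulr_ge0; first exact: normc_ge0.
    by apply: mulr_ge0 => //; apply: addr_ge0; exact: sqr_ge0.
  - by rewrite invr_ge0 ltW// mulr_gt0// mulr_gt0.
  - apply: ler_pM => //; first exact: normc_ge0.
      by apply: mulr_ge0 => //; apply: addr_ge0; exact: sqr_ge0.
    apply: ler_wpM2l => //; rewrite /q.
    have -> : (r ^+ 2 + 1) * (1 + t ^+ 2) = r ^+ 2 + t ^+ 2 + (1 + r ^+ 2 * t ^+ 2) by ring.
    by rewrite lerDl addr_ge0// mulr_ge0// sqr_ge0.
  - rewrite lef_pV2 ?posrE; [|exact: mulr_gt0 (mulr_gt0 xr _)..].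
    by do 2?[apply: ler_wpM2l; first exact: ltW].
rewrite le_eqVlt; apply/orP; left; apply/eqP; field.
by rewrite (gt_eqF xr) (gt_eqF q0) (gt_eqF S0) (gt_eqF P0) (gt_eqF C0) (gt_eqF re).
Qed.

(** For the horizontal connections between Re s = rho and Re s = r': [strip_mod] increases with the
    real part, so the comparison with its value on the line Re s = rho still holds. *)
Lemma node_kernel_right (R : realType) (e m : nat) (xs : seq R) (g : R[i]) (rho r t x M C : R) :
  all (fun x => 0 <= x) xs -> 0 < rho -> rho <= r <= rho + 1 -> 0 <= x -> 0 < C ->
  normc g <= M ->
  C * (1 + t ^+ 2) ^+ m * strip_mod xs rho 0 <= strip_mod xs rho t ->
  normc (g * (2 * (r +i* t)) /
    ((node_poly e xs).[- (r +i* t) ^+ 2] * ((r +i* t) ^+ 2 + x%:C))) <=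
  M * (4 * ((rho + 1) ^+ 2 + t ^+ 2)) / (rho ^+ (2 * e).+1 * C)
    / (strip_mod xs rho 0 * (x + rho ^+ 2)).
Proof.
move=> xs0 rho0 /andP[r1 r2] x0 C0 gM mC; have r0 : 0 < r := lt_le_trans rho0 r1.
apply: le_trans (node_kernel_bound e g t xs0 r0 x0) _.
have S0 := strip_mod_gt0 xs 0 rho0.
have St := strip_mod_mono xs t (ltW rho0) r1.
set S := strip_mod xs rho 0 in mC S0 *; set U := strip_mod xs r t in St *.
have re : 0 < rho ^+ (2 * e).+1 by exact: exprn_gt0.
have xr : 0 < x + rho ^+ 2 by rewrite ltr_wpDl// exprn_gt0.
have SU : C * S <= U.
  apply: le_trans St; apply: le_trans mC; rewrite ler_wpM2r ?(ltW S0)// ler_peMr ?(ltW C0)//.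
  by apply: exprn_ege1; rewrite lerDl sqr_ge0.
have CS : 0 < C * S by exact: mulr_gt0.
have r2' : rho ^+ 2 <= r ^+ 2 by rewrite lerXn2r// nnegrE ltW.
have r3' : r ^+ 2 <= (rho + 1) ^+ 2 by rewrite lerXn2r// nnegrE ?(ltW r0)// (le_trans (ltW r0)).
have r4' : rho ^+ (2 * e).+1 <= r ^+ (2 * e).+1 by rewrite lerXn2r// nnegrE ltW.
rewrite -[X in _ <= X]mulrA -invfM.
apply: ler_pM.
- apply: mulr_ge0; first exact: normc_ge0.
  by apply: mulr_ge0 => //; apply: addr_ge0; exact: sqr_ge0.
- rewrite invr_ge0; apply: mulr_ge0; first exact: le_trans (ltW re) r4'.
  by apply: mulr_ge0; [apply: addr_ge0 => //; exact: sqr_ge0|exact: le_trans (ltW CS) SU].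
- apply: ler_pM => //; first exact: normc_ge0.
    by apply: mulr_ge0 => //; apply: addr_ge0; exact: sqr_ge0.
  by rewrite ler_wpM2l// lerD2r.
have -> : rho ^+ (2 * e).+1 * C * (S * (x + rho ^+ 2)) =
    rho ^+ (2 * e).+1 * ((x + rho ^+ 2) * (C * S)) by ring.
have W0 : 0 < rho ^+ (2 * e).+1 * ((x + rho ^+ 2) * (C * S)) by do 2?apply: mulr_gt0 => //.
have W1 : rho ^+ (2 * e).+1 * ((x + rho ^+ 2) * (C * S)) <= r ^+ (2 * e).+1 * ((x + r ^+ 2) * U).
  apply: ler_pM => //; first exact: ltW.
    by apply: mulr_ge0; exact: ltW.
  by apply: ler_pM => //; [exact: ltW|exact: ltW|rewrite lerD2l].
by rewrite lef_pV2 ?posrE//; exact: lt_le_trans W1.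
Qed.

Lemma laguerre_sq_strip (R : realType) n (a c r : R) (xs : seq R) :
  all (fun x => 0 <= x) xs -> c != 0 ->
  laguerre n a = c *: \prod_(x <- xs) ('X - x%:P) ->
  strip_mod xs r 0 = ((laguerre_sq n a).[r] / c) ^+ 2.
Proof.
move=> xs0 c0 E.
have := @horner_map_node_prod R xs r%:C xs0; rewrite -[complex.Re _]/r -[complex.Im _]/(0 : R) => <-.
rewrite -rmorphXn -rmorphN /= horner_map normc_real real_normK ?num_real//.
by rewrite horner_laguerre_sq E hornerZ mulrAC mulfV// mul1r.
Qed.

Lemma node_poly_horner (R : realType) n (a c : R) e (xs : seq R) (x : R) : c != 0 ->
  laguerre n a = c *: \prod_(x <- xs) ('X - x%:P) ->
  (node_poly e xs).[x%:C] = (x ^+ e * ((laguerre n a).[x] / c) ^+ 2)%:C.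
Proof.
move=> c0 E; rewrite /node_poly horner_map; congr (_%:C).
rewrite hornerM hornerXn horner_exp E hornerZ.
by rewrite [c * _ / c]mulrAC mulfV// mul1r.
Qed.

Lemma node_poly_neq0 (R : realType) e (xs : seq R) (s : R[i]) :
  all (fun x => 0 <= x) xs -> s != 0 ->
  (complex.Re s != 0) || (1 + 2 * \sum_(x <- xs) Num.sqrt x <= `|complex.Im s|) ->
  (node_poly e xs).[- s ^+ 2] != 0.
Proof.
move=> xs0 s0 h; rewrite -normc_eq0 normc_node_poly// mulf_neq0//.
  by rewrite expf_neq0// normc_eq0.
case: s {s0} h => r t /= /orP[r0|ht].
  rewrite gt_eqF//; apply: prodr_gt0 => y _.
  by rewrite ltr_pwDl ?sqr_ge0// lt0r sqrf_eq0 r0 sqr_ge0.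
have S0 (ys : seq R) : 0 <= \sum_(x <- ys) Num.sqrt x.
  by apply: sumr_ge0 => y _; exact: sqrtr_ge0.
have t0 : 0 < `|t| by apply: lt_le_trans ht; have := S0 xs; lra.
rewrite gt_eqF//; apply: lt_le_trans (strip_mod_far r xs0 _).
  by apply: exprn_gt0; exact: divr_gt0.
apply/allP => x xxs; apply: le_trans ht.
have : Num.sqrt x <= \sum_(x <- xs) Num.sqrt x.
  by rewrite (big_rem x)//= lerDl.
by lra.
Qed.

(** The small factor [eps] comes from splitting the contour. Far out on Re s = rho, the kernel has a
    small tail uniformly in n; on the compact part the contour moves to Re s = r', where the
    denominator L_n(-r'^2)^2 is exponentially larger, so the size of [K] does not matter. *)
Lemma contour_error (R : realType) (f : R[i] -> R[i]) (a rho G : R) (e m : nat) :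
  -1 < a -> 0 < rho ->
  (forall s, - rho <= complex.Re s <= rho -> holo (fun s => f (- s ^+ 2)) s /\
     normc (f (- s ^+ 2)) <= G * (1 + complex.Im s ^+ 2) ^+ m) ->
  (forall T0, exists2 d0, 0 < d0 & exists M, forall s,
     rho <= complex.Re s <= rho + d0 -> `|complex.Im s| <= T0 ->
     holo (fun s => f (- s ^+ 2)) s /\ normc (f (- s ^+ 2)) <= M) ->
  forall eps, 0 < eps -> exists2 r', rho < r' & exists2 K, 0 <= K & exists n0,
    forall n, (n0 <= n)%N -> forall (c : R) (xs : seq R), c != 0 ->
    all (fun x => 0 <= x) xs -> laguerre n a = c *: \prod_(x <- xs) ('X - x%:P) ->
    exists2 H : {poly R[i]}, (size H <= 2 * n + e)%N & forall x, 0 <= x ->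
      normc (f x%:C - H.[x%:C]) <= x ^+ e * (laguerre n a).[x] ^+ 2 *
        (eps / ((laguerre_sq n a).[rho] ^+ 2 * (x + rho ^+ 2)) +
         K / ((laguerre_sq n a).[r'] ^+ 2 * (x + r' ^+ 2))).
Proof.
move=> a1 r0 hf hbox eps eps0.
have G0 : 0 <= G.
  have h0 : - rho <= complex.Re (0 : R[i]) <= rho by rewrite /= oppr_le0 !ltW.
  have [_] := hf 0 h0.
  move=> /(le_trans (normc_ge0 _)); rewrite pmulr_lge0//.
  by rewrite exprn_gt0// ltr_pwDl ?sqr_ge0.
have [C C0 [n1 H1]] := strip_mod_growth (m + 2) a1 r0.
have re : 0 < rho ^+ (2 * e).+1 by exact: exprn_gt0.
pose K1 := G * (4 * (rho ^+ 2 + 1)) / (rho ^+ (2 * e).+1 * C).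
have K10 : 0 <= K1.
  apply: divr_ge0; last by apply: ltW; exact: mulr_gt0.
  by apply: mulr_ge0 => //; apply: mulr_ge0 => //; apply: addr_ge0 => //; exact: sqr_ge0.
(* [T0] is fixed before the width [d]: it makes the tails cost at most [eps / 2], and the margin of
   analyticity on the right is available only for bounded imaginary part. *)
have [T0 T00 hT0] : exists2 T0 : R, 0 <= T0 & pi / 2 - atan T0 <= eps / (4 * (K1 + 1)).
  by apply: atan_near_pi2; apply: divr_gt0 => //; lra.
have [d0 d00 [M hM]] := hbox T0.
have M0 : 0 <= M.
  have h1 : rho <= complex.Re (rho +i* T0) <= rho + d0 by rewrite /= lexx lerDl ltW.
  have h2 : `|complex.Im (rho +i* T0)| <= T0 by rewrite /= ger0_norm.
  have [_] := hM _ h1 h2.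
  by apply: le_trans (normc_ge0 _).
pose K2 := M * (4 * ((rho + 1) ^+ 2 + T0 ^+ 2)) / (rho ^+ (2 * e).+1 * C).
have K20 : 0 <= K2.
  apply: divr_ge0; last by apply: ltW; exact: mulr_gt0.
  by apply: mulr_ge0 => //; apply: mulr_ge0 => //; apply: addr_ge0 => //; exact: sqr_ge0.
(* Besides staying in the domain of analyticity, [d] is so small that the horizontal connections
   cost at most [eps / 2]. *)
have [d [dp dd0 d1 dK]] : exists d : R, [/\ 0 < d, d <= d0, d <= 1 & d <= eps / (4 * (K2 + 1))].
  exists (Num.min d0 (Num.min 1 (eps / (4 * (K2 + 1))))).
  have : 0 < eps / (4 * (K2 + 1)) by apply: divr_gt0 => //; clear -K20; lra.
  by move=> p0; split; [rewrite !lt_min d00 ltr01 p0|rewrite !ge_min lexx ?orbT..].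
pose r' := rho + d.
have rr' : rho < r' by rewrite /r' ltrDl.
have r'0 : 0 < r' by exact: lt_trans rr'.
have [C' C'0 [n2 H2]] := strip_mod_growth 2 a1 r'0.
have re' : 0 < r' ^+ (2 * e).+1 by exact: exprn_gt0.
pose K3 := M * (4 * (r' ^+ 2 + 1)) / (r' ^+ (2 * e).+1 * C').
have K30 : 0 <= K3.
  apply: divr_ge0; last by apply: ltW; exact: mulr_gt0.
  by apply: mulr_ge0 => //; apply: mulr_ge0 => //; apply: addr_ge0 => //; exact: sqr_ge0.
have EE : 2 * (K1 * (pi / 2 - atan T0)) + 2 * (d * K2) <= eps.
  have key (K y : R) : 0 <= K -> y <= eps / (4 * (K + 1)) -> 2 * (K * y) <= eps / 2.
    move=> K_ge0 hy; have K1_gt0 : 0 < K + 1 by clear -K_ge0; lra.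
    apply: (@le_trans _ _ (2 * (K * (eps / (4 * (K + 1)))))).
      by rewrite ler_wpM2l// ler_wpM2l.
    have -> : 2 * (K * (eps / (4 * (K + 1)))) = K / (K + 1) * (eps / 2) by field; rewrite gt_eqF.
    rewrite ler_piMl//; first by clear -eps0; lra.
    by rewrite ler_pdivrMr// mul1r; clear; lra.
  have := key _ _ K10 hT0; have := key _ _ K20 dK; rewrite [d * K2]mulrC.
  by clear; lra.
exists r' => //; exists (K3 * pi); first by rewrite mulr_ge0 ?pi_ge0.
exists (maxn m (maxn n1 n2)) => n hn c xs c0 xs0 Exs.
have mn : (m <= n)%N by apply: leq_trans hn; exact: leq_maxl.
have n1n : (n1 <= n)%N by apply: leq_trans hn; rewrite leq_max leq_maxl orbT.
have n2n : (n2 <= n)%N by apply: leq_trans hn; rewrite leq_max leq_maxr orbT.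
have [sxs _] := laguerre_root_le a1 c0 xs0 Exs.
have S1 := H1 n n1n c xs c0 xs0 Exs; have S2 := H2 n n2n c xs c0 xs0 Exs.
pose T1 := 1 + 2 * \sum_(x <- xs) Num.sqrt x.
have T11 : 1 <= T1.
  by rewrite lerDl mulr_ge0// sumr_ge0// => x _; exact: sqrtr_ge0.
have T1x : all (fun x => 2 * Num.sqrt x <= T1) xs.
  apply/allP => x xxs; rewrite /T1 (big_rem x)//=.
  have : 0 <= \sum_(y <- rem x xs) Num.sqrt y by apply: sumr_ge0 => y _; exact: sqrtr_ge0.
  by clear; lra.
have T10 : 0 < T1 by exact: lt_le_trans T11.
have sP : (size (node_poly e xs) <= (2 * n + e).+1)%N by rewrite size_node_poly sxs.
have pN0 s : (complex.Re s != 0) || (T1 <= `|complex.Im s|) -> (node_poly e xs).[- s ^+ 2] != 0.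
  move=> hs; apply: node_poly_neq0 => //; apply: contraTneq hs => ->.
  by rewrite /= eqxx normr0 /= -ltNge.
have [H [sH HH]] := hermite_remainder r0 T10 sP (fun s hs => (hf s hs).1) pN0.
exists H => // x x0.
pose S := strip_mod xs rho 0; pose S' := strip_mod xs r' 0.
have S0 : 0 < S by exact: strip_mod_gt0.
have S'0 : 0 < S' by exact: strip_mod_gt0.
have xr : 0 < x + rho ^+ 2 by rewrite ltr_wpDl// exprn_gt0.
have xr' : 0 < x + r' ^+ 2 by rewrite ltr_wpDl// exprn_gt0.
pose U := S * (x + rho ^+ 2); pose U' := S' * (x + r' ^+ 2).
have U0 : 0 < U by exact: mulr_gt0.
have U'0 : 0 < U' by exact: mulr_gt0.
pose B := 2 * (K1 / U * (pi / 2 - atan T0)) + 2 * (d * (K2 / U)) + K3 / U' * pi.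
pose Phi s := f (- s ^+ 2) * (2 * s) / ((node_poly e xs).[- s ^+ 2] * (s ^+ 2 + x%:C)).
have B_ge0 : 0 <= B.
  have t0 : 0 <= pi / 2 - atan T0 by rewrite subr_ge0 ltW// atan_ltpi2.
  have [U_ge0 U'_ge0] := (ltW U0, ltW U'0).
  apply: addr_ge0; last by apply: mulr_ge0; [exact: divr_ge0|exact: pi_ge0].
  apply: addr_ge0; apply: mulr_ge0 => //; apply: mulr_ge0 => //; try exact: divr_ge0.
  exact: ltW.
have main T : [/\ 6 <= T, rho <= T, T1 <= T & T0 <= T] -> Num.sqrt x < T ->
    2 * (rho ^+ 2 + x) <= T ^+ 2 ->
    normc (rint Phi (- rho) rho (- T) T) <= 4 * rho * (8 * G / T) + 2 * B.
  move=> [T6 rT T1T T0T] xT xT2; have T_gt0 : 0 < T by exact: lt_le_trans T6.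
  have hPhi s : holo (fun s => f (- s ^+ 2)) s -> (complex.Re s != 0) || (`|complex.Im s| == T) ->
      holo Phi s.
    move=> hs hs0; apply: holoM.
      by apply: (holoM hs); apply: holoM; [exact: holo_cst|exact: holo_id].
    apply: (@holoV _ (fun s => (node_poly e xs).[- s ^+ 2] * (s ^+ 2 + x%:C))).
      apply: mulf_neq0.
        by apply: pN0; case/orP: hs0 => [->//|/eqP ->]; rewrite T1T orbT.
      apply/negP => /eqP /(sqrD_eq0 x0)[e1 e2]; move: hs0; rewrite e1 e2 eqxx /=.
      by rewrite lt_eqF.
    apply: holoM; first exact: holo_hornerM2.
    by apply: holoD; [apply: holoM; exact: holo_id|exact: holo_cst].
  have hb s : rho <= complex.Re s <= rho + d -> `|complex.Im s| <= T0 ->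
      holo (fun s => f (- s ^+ 2)) s /\ normc (f (- s ^+ 2)) <= M.
    move=> /andP[s1 s2]; apply: hM; rewrite s1 (le_trans s2)//.
    by rewrite lerD2l.
  have fr t : - rho <= complex.Re (rho +i* t) <= rho by rewrite /= lexx andbT; clear -r0; lra.
  apply: (@contour_bound _ Phi rho d T0 T (K1 / U) (K2 / U) (K3 / U') (8 * G / T)) => //.
  - exact: ltW.
  - by rewrite divr_ge0// ltW.
  - by move=> s; rewrite /Phi sqrrN !mulrN mulNr.
  - move=> s s1; rewrite -ler_norml => s2; apply: hPhi; first exact: (hb s s1 s2).1.
    by case/andP: s1 => s1 _; rewrite gt_eqF// (lt_le_trans r0).
  - move=> t _; apply: hPhi; first exact: (hf _ (fr t)).1.
    by rewrite /= gt_eqF.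
  - move=> s s1 s2; apply: hPhi; first exact: (hf _ s1).1.
    by rewrite s2 eqxx orbT.
  - move=> t _; apply: node_kernel_growth => //; exact: (hf _ (fr t)).2.
  - move=> [r t] s1 s2; have [s11 s12] := andP s1.
    rewrite /K2 -s2 /= real_normK ?num_real//.
    apply: (@node_kernel_right _ _ (m + 2)) => //; last first.
    + by apply: (hb (r +i* t) s1 _).2; rewrite s2.
    + by move: s11 s12 => /= -> /= s12; rewrite (le_trans s12)// lerD2l.
  - move=> t t1; apply: (@node_kernel_growth _ _ 0%N) => //.
    rewrite expr0 mulr1; apply: (hb (r' +i* t) _ _).2; last by rewrite ler_norml.
    by rewrite /= lexx andbT ltW.
  - move=> s s1 s2; apply: (@node_kernel_far _ _ m _ _ _ rho) => //.
    + by apply/allP => y /(allP T1x) /le_trans; apply.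
    + by rewrite sxs.
    + by rewrite ler_norml.
    + by rewrite -s2 real_normK ?num_real//; exact: (hf _ s1).2.
pose p := x ^+ e * ((laguerre n a).[x] / c) ^+ 2.
have p0 : 0 <= p by apply: mulr_ge0; [exact: exprn_ge0|exact: sqr_ge0].
have fin : normc (f x%:C - H.[x%:C]) <= p * B.
  apply/ler_addgt0Pr => eta eta0.
  (* For fixed [x], [T] exceeds every threshold, and its last summand keeps the contribution of the
     horizontal sides to the error below [eta]. *)
  pose T := 6 + rho + T1 + T0 + Num.sqrt x + 2 * (rho ^+ 2 + x) + 16 * rho * G * p / eta.
  have y0 := sqrtr_ge0 x; have rx : 0 <= 2 * (rho ^+ 2 + x).
    by rewrite mulr_ge0// addr_ge0// sqr_ge0.
  have q0 : 0 <= 16 * rho * G * p / eta.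
    apply: divr_ge0; last exact: ltW.
    by apply: mulr_ge0 => //; apply: mulr_ge0 => //; apply: mulr_ge0 => //; exact: ltW.
  have T6 : 6 <= T by rewrite /T; clear -r0 T11 T00 y0 rx q0; lra.
  have T_gt0 : 0 < T by exact: lt_le_trans T6.
  have hT : [/\ 6 <= T, rho <= T, T1 <= T & T0 <= T].
    by split => //; rewrite /T; clear -r0 T11 T00 y0 rx q0; lra.
  have xT : Num.sqrt x < T by rewrite /T; clear -r0 T11 T00 y0 rx q0; lra.
  have xT2 : 2 * (rho ^+ 2 + x) <= T ^+ 2.
    apply: (@le_trans _ _ T); first by rewrite /T; clear -r0 T11 T00 y0 rx q0; lra.
    by rewrite expr2 ler_peMl ?(ltW T_gt0)//; clear -T6; lra.
  have [_ _ T1T _] := hT.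
  have := HH x T x0 T1T xT; move=> /(congr1 (@normc R)); rewrite !normcM -/Phi.
  rewrite (node_poly_horner e x c0 Exs) normc_real -/p (ger0_norm p0).
  have -> : normc (0 +i* (4 * pi) : R[i]) = 4 * pi.
    by rewrite /normc expr0n /= add0r sqrtr_sqr ger0_norm// mulr_ge0// pi_ge0.
  have := main T hT xT xT2; set Z := normc (rint _ _ _ _ _); set N := normc _ => hZ E.
  have N0 : 0 <= N by exact: normc_ge0.
  have hN : 8 * N <= p * Z.
    rewrite -E; apply: ler_wpM2r => //.
    by have := @pi_ge2 R; clear; lra.
  have hq : 4 * rho * (8 * G / T) * p <= 2 * eta.
    have -> : 4 * rho * (8 * G / T) * p = 2 * (16 * rho * G * p / T) by field; rewrite gt_eqF.
    rewrite ler_wpM2l// ler_pdivrMr// [eta * T]mulrC -ler_pdivrMr// /T.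
    by clear -r0 T11 T00 y0 rx; lra.
  have B0 : 0 <= p * B by rewrite mulr_ge0.
  have := ler_wpM2l p0 hZ; rewrite mulrDr [p * (2 * B)]mulrCA [p * (4 * _ * _)]mulrC.
  by clear -hN hq B0 eta0; lra.
apply: le_trans fin _.
have EU (r : R) : (strip_mod xs r 0 * (x + r ^+ 2)) = ((laguerre_sq n a).[r] ^+ 2 * (x + r ^+ 2)) / c ^+ 2.
  by rewrite (laguerre_sq_strip r xs0 c0 Exs) expr_div_n mulrAC.
have [q1 q2] := (laguerre_sq_gt0 n rho a1, laguerre_sq_gt0 n r' a1).
have pE y (r : R) : 0 < (laguerre_sq n a).[r] ^+ 2 * (x + r ^+ 2) ->
  p * (y / (strip_mod xs r 0 * (x + r ^+ 2))) =
  x ^+ e * (laguerre n a).[x] ^+ 2 * (y / ((laguerre_sq n a).[r] ^+ 2 * (x + r ^+ 2))).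
  move=> q0; rewrite EU /p expr_div_n.
  by move: (_ * (x + r ^+ 2)) q0 => q q0; field; rewrite (gt_eqF q0) c0.
have BE : B <= eps / U + K3 * pi / U'.
  have -> : B = (2 * (K1 * (pi / 2 - atan T0)) + 2 * (d * K2)) / U + K3 * pi / U'.
    by rewrite /B; field; rewrite !gt_eqF.
  by rewrite lerD2r ler_wpM2r// invr_ge0 ltW.
apply: le_trans (ler_wpM2l p0 BE) _; rewrite mulrDr [X in _ <= X]mulrDr /U /U'.
by rewrite (pE _ rho) ?(pE _ r')// mulr_gt0// exprn_gt0.
Qed.

(** * From the hypotheses on f to bounds on the strip *)

(** Compactness of the rectangle in the covering form of near filters: a single n serves at all its
    points, with 1/(n+1) as horizontal margin and n as bound for [g]. *)
Lemma strip_uniform (R : realType) (g : R[i] -> R[i]) (rho T0 : R) : 0 < rho ->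
  (forall s, - rho <= complex.Re s <= rho -> exists2 r : R, 0 < r & exists M : R,
     forall s', normc (s' - s) < r -> holo g s' /\ normc (g s') <= M) ->
  exists2 d : R, 0 < d & exists M : R, forall s,
    - rho <= complex.Re s <= rho + d -> `|complex.Im s| <= T0 ->
    holo g s /\ normc (g s) <= M.
Proof.
move=> r0 H.
pose K : set (R * R) := `[- rho, rho]%classic `*` `[- T0, T0]%classic.
have cK : compact K by apply: compact_setX; exact: segment_compact.
pose P (n : nat) (p : R * R) := forall x, `|x - p.1| <= n.+1%:R^-1 ->
  holo g (x +i* p.2) /\ normc (g (x +i* p.2)) <= n%:R.
have : \forall n \near \oo, K `<=` P n.
  apply: (compact_near_coveringP K).1 => // -[x0 t0] [/= hx _].
  have [|r rp [M HM]] := H (x0 +i* t0); first by move: hx; rewrite /= in_itv.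
  have r4 : 0 < r / 4 by exact: divr_gt0.
  near=> p n => x hxp.
  have M_n : M <= n%:R by near: n; exact: nbhs_infty_ger.
  suff /HM[h1 h2] : normc ((x +i* p.2) - (x0 +i* t0)) < r by split=> //; exact: le_trans M_n.
  apply: le_lt_trans (normc_le_ReIm _) _ => /=.
  have p1 : `|p.1 - x0| < r / 4.
    by near: p; exact: (cvg_fst (near_dist_lt x0 r4)).
  have p2 : `|p.2 - t0| < r / 4.
    by near: p; exact: (cvg_snd (near_dist_lt t0 r4)).
  have n1 : n.+1%:R^-1 < r / 4.
    by near: n; exact: (near_infty_natSinv_lt (PosNum r4)).
  have := ler_normD (x - p.1) (p.1 - x0); rewrite addrA subrK => h.
  have := le_lt_trans hxp n1; move: h p1 p2 rp; clear.
  by move: `|x - p.1| `|x - x0| `|p.1 - x0| `|p.2 - t0| => a b c d; lra.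
case=> n _ /(_ n (leqnn n)) Hn; exists n.+1%:R^-1; first by rewrite invr_gt0.
exists n%:R => s hs ht.
have d0 : 0 < n.+1%:R^-1 :> R by rewrite invr_gt0.
have [sr|sr] := lerP (complex.Re s) rho.
  have /Hn /(_ (complex.Re s)) : K (complex.Re s, complex.Im s).
    split; rewrite /= in_itv /=; last by rewrite -ler_norml.
    by rewrite sr andbT; case/andP: hs.
  by rewrite subrr normr0 => /(_ (ltW d0)); case: (s).
have /Hn /(_ (complex.Re s)) : K (rho, complex.Im s).
  split; rewrite /= in_itv /=; last by rewrite -ler_norml.
  by rewrite lexx andbT; clear -r0; lra.
have -> : `|complex.Re s - rho| <= n.+1%:R^-1.
  by rewrite ger0_norm; [rewrite lerBlDl; case/andP: hs|clear -sr; lra].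
by move=> /(_ isT); case: (s).
Unshelve. all: by end_near.
Qed.

(** Identifies the closed strip |Re s| <= rho with the region inside and on the parabola. *)
Lemma normc_sqrtc (R : realType) (s : R[i]) : complex.Re (sqrtc (s ^+ 2)) = `|complex.Re s|.
Proof.
have : sqrtc (s ^+ 2) ^+ 2 == s ^+ 2 by rewrite sqr_sqrtc.
have : 0 <= complex.Re (sqrtc (s ^+ 2)).
  by case: (s ^+ 2) => a b /=; exact: sqrtr_ge0.
rewrite eqf_sqr => h /orP[/eqP E|/eqP E]; rewrite E in h *.
  by rewrite ger0_norm.
by move: h; case: s {E} => a b /=; rewrite oppr_ge0 => h; rewrite ler0_norm.
Qed.

Lemma open_normc (R : realType) (U : set R[i]^o) (z : R[i]) : open U -> U z ->
  exists2 r : R, 0 < r & forall w, normc (w - z) < r -> U w.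
Proof.
move=> oU Uz; have /nbhs_ballP[e /= e0 He] : nbhs (z : R[i]^o) U by exact: open_nbhs_nbhs.
have [r [r0 eE]] : exists r : R, 0 < r /\ e = r%:C.
  move: e0 {He}; case: e => x y; rewrite ltcE /= => /andP[/eqP -> x0].
  by exists x.
exists r => // w hw; apply: He; rewrite eE /ball /= /ball_.
by rewrite normc_normE ltcR normcB.
Qed.

Lemma analytic_strip (R : realType) (f : R[i] -> R[i]) (rho : R) (s : R[i]) :
  analytic_near f (parabola_interior rho `|` parabola rho) ->
  - rho <= complex.Re s <= rho ->
  exists2 r : R, 0 < r & exists M : R,
    forall s', normc (s' - s) < r ->
      holo (fun s => f (- s ^+ 2)) s' /\ normc (f (- s' ^+ 2)) <= M.
Proof.
move=> [U [oU SU dU]] hs; pose g s := f (- s ^+ 2).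
have hg w : U (- w ^+ 2) -> holo g w.
  move=> Uw; apply: (@holo_comp _ f (fun s => - s ^+ 2)); first by split; exact: dU.
  by apply: holoN; apply: holoM; exact: holo_id.
have Us : U (- s ^+ 2).
  apply: SU; have := normc_sqrtc s; rewrite -ler_norml in hs.
  rewrite /parabola_interior /parabola /= opprK => ->.
  by move: hs; rewrite le_eqVlt => /orP[/eqP ->|]; [right|left].
have [r1 r10 H1] := open_normc oU Us.
have [D1 D10 [D D0 HD]] := holo_near_bound (hg s Us).
have hsq : holo (fun s => - s ^+ 2) s by apply: holoN; apply: holoM; exact: holo_id.
have [D2 D20 [E E0 HE]] := holo_near_bound hsq.
exists (Num.min D1 (Num.min D2 (r1 / E))).
  by rewrite !lt_min D10 D20 divr_gt0.
exists (normc (g s) + D * D1) => s'; rewrite !lt_min => /and3P[h1 h2 h3]; split.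
  apply: hg; apply: H1; apply: le_lt_trans (HE _ h2) _.
  by rewrite mulrC -ltr_pdivlMr.
rewrite -/(g s') -(subrK (g s) (g s')) addrC (le_trans (normcD_le _ _))// lerD2l.
by apply: le_trans (HD _ h1) _; rewrite ler_wpM2l ?ltW.
Qed.

(** The growth hypothesis concerns large |z| strictly inside the parabola. Bounded imaginary parts
    are covered by compactness, and the line itself by continuity from inside; the exponent [k]
    exceeds |beta|, so that negative [beta] is included. *)
Lemma strip_growth (R : realType) (f : R[i] -> R[i]) (rho beta C : R) :
  0 < rho -> 0 < C -> analytic_near f (parabola_interior rho `|` parabola rho) ->
  (exists M : R, forall z : R[i], parabola_interior rho z -> M <= normc z ->
     normc (f z) <= C * normc z `^ beta) ->
  exists (G : R) (m : nat), forall s, - rho <= complex.Re s <= rho ->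
    normc (f (- s ^+ 2)) <= G * (1 + complex.Im s ^+ 2) ^+ m.
Proof.
move=> r0 C0 hf [Mg hg]; pose T := `|Mg| + 1.
have T1 : 1 <= T by rewrite lerDr.
have [d d0 [M HM]] := strip_uniform T r0 (fun s hs => analytic_strip hf hs).
pose k := (Num.truncn `|beta|).+1; pose G := `|M| + C * (1 + rho ^+ 2) ^+ k.
exists G, k => s hs.
have q1 (t : R) : 1 <= 1 + t ^+ 2 by rewrite lerDl sqr_ge0.
have C1 : 0 <= C * (1 + rho ^+ 2) ^+ k.
  by rewrite mulr_ge0 ?(ltW C0)// exprn_ge0// (le_trans ler01).
have [hT|hT] := lerP `|complex.Im s| T.
  have hs' : - rho <= complex.Re s <= rho + d.
    by case/andP: hs => -> /le_trans; apply; rewrite lerDl ltW.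
  have [_ h] := HM s hs' hT.
  apply: (@le_trans _ _ (G * 1)).
    by rewrite mulr1 (le_trans h)// (le_trans (ler_norm M))// lerDl.
  by rewrite ler_wpM2l ?addr_ge0// exprn_ege1.
apply: (@le_trans _ _ (C * (1 + rho ^+ 2) ^+ k * (1 + complex.Im s ^+ 2) ^+ k)); last first.
  by rewrite ler_wpM2r ?lerDr// exprn_ge0// (le_trans ler01).
have inner s' : `|complex.Re s'| < rho -> complex.Im s' = complex.Im s ->
    normc (f (- s' ^+ 2)) <= C * (1 + rho ^+ 2) ^+ k * (1 + complex.Im s ^+ 2) ^+ k.
  move=> h1 h2.
  have nz : normc (- s' ^+ 2) = complex.Re s' ^+ 2 + complex.Im s' ^+ 2.
    by rewrite normcN normcX sqr_normc_ReIm.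
  have Tz : T <= normc (- s' ^+ 2).
    rewrite nz h2 -[complex.Im s ^+ 2]real_normK ?num_real//.
    apply: (@le_trans _ _ (`|complex.Im s| ^+ 2)); last by rewrite lerDr sqr_ge0.
    by rewrite expr2 (le_trans (ltW hT))// ler_peMl// (le_trans T1)// ltW.
  have : normc (f (- s' ^+ 2)) <= C * normc (- s' ^+ 2) `^ beta.
    apply: hg; first by rewrite /parabola_interior /= opprK normc_sqrtc.
    by apply: le_trans Tz; rewrite (le_trans (ler_norm Mg))// lerDl.
  move=> /le_trans; apply; rewrite -mulrA ler_wpM2l ?(ltW C0)// -exprMn.
  apply: (@le_trans _ _ (normc (- s' ^+ 2) `^ k%:R)).
    apply: ler_powR; first exact: le_trans Tz.
    by rewrite (le_trans (ler_norm _))// ltW// truncnS_gt.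
  rewrite powR_mulrn ?normc_ge0//; apply: lerXn2r; rewrite ?nnegrE ?normc_ge0//.
    by apply: mulr_ge0; apply: addr_ge0 => //; exact: sqr_ge0.
  rewrite nz h2; have : complex.Re s' ^+ 2 <= rho ^+ 2.
    by rewrite -[complex.Re s' ^+ 2]real_normK ?num_real// lerXn2r// ?nnegrE ?(ltW r0)// ltW.
  have := mulr_ge0 (sqr_ge0 rho) (sqr_ge0 (complex.Im s)).
  rewrite mulrDl mul1r mulrDr mulr1.
  by move: (_ ^+ 2) (rho ^+ 2) (complex.Im s ^+ 2) => a b c; lra.
have [r rp [M' HM']] := analytic_strip hf hs.
have ss : normc (s - s) < r by rewrite subrr normc0.
have [hs0 _] := HM' s ss.
have [dl dl0 [D D0 HD]] := holo_near_bound hs0.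
apply/ler_addgt0Pr => eta eta0.
(* Relative shrinking of the real part: it moves [s] strictly inside the strip and changes the value
   of f by at most [eta]. *)
pose e := Num.min 1 (Num.min (dl / (2 * rho)) (eta / (D * rho))).
have e0 : 0 < e.
  by rewrite !lt_min ltr01 !divr_gt0// mulr_gt0.
have e1 : e <= 1 by rewrite ge_min lexx.
have e2 : e <= dl / (2 * rho) by rewrite !ge_min lexx orbT.
have e3 : e <= eta / (D * rho) by rewrite !ge_min lexx !orbT.
pose s' : R[i] := ((1 - e) * complex.Re s) +i* complex.Im s.
have Rs : `|complex.Re s| <= rho by rewrite ler_norml.
have ds : normc (s' - s) <= e * rho.
  apply: le_trans (normc_le_ReIm _) _; rewrite /s'.
  case: (s) Rs => a b /= Ra; rewrite subrr normr0 addr0.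
  rewrite (_ : (1 - e) * a - a = - (e * a)); last by ring.
  by rewrite normrN normrM (ger0_norm (ltW e0)) ler_wpM2l// ltW.
have ds1 : normc (s' - s) < dl.
  apply: le_lt_trans ds _; apply: (@le_lt_trans _ _ (dl / (2 * rho) * rho)).
    by rewrite ler_wpM2r// ltW.
  rewrite (_ : dl / (2 * rho) * rho = dl / 2); last by field; rewrite gt_eqF.
  by clear -dl0; lra.
have i1 : `|complex.Re s'| < rho.
  rewrite /= normrM ger0_norm ?subr_ge0//.
  apply: (@le_lt_trans _ _ ((1 - e) * rho)); first by rewrite ler_wpM2l// subr_ge0.
  by rewrite gtr_pMl// gtrBl.
have h1 := inner s' i1 erefl; have h2 := HD s' ds1.
rewrite -(subrK (f (- s' ^+ 2)) (f (- s ^+ 2))) (le_trans (normcD_le _ _))// addrC.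
apply: lerD => //; rewrite normcB (le_trans h2)//.
apply: (@le_trans _ _ (D * (eta / (D * rho) * rho))).
  by rewrite ler_wpM2l ?(ltW D0)// (le_trans ds)// ler_wpM2r// ltW.
by rewrite le_eqVlt; apply/orP; left; apply/eqP; field; rewrite !gt_eqF.
Qed.

(** The form in which analyticity and growth of f are used from here on: a polynomial bound on the
    closed strip, and a margin to its right for each bound on the imaginary part. *)
Lemma strip_hypotheses (R : realType) (f : R[i] -> R[i]) (rho beta C : R) :
  0 < rho -> 0 < C -> analytic_near f (parabola_interior rho `|` parabola rho) ->
  (exists M : R, forall z : R[i], parabola_interior rho z -> M <= normc z ->
     normc (f z) <= C * normc z `^ beta) ->
  exists (G : R) (m : nat),
    (forall s, - rho <= complex.Re s <= rho -> holo (fun s => f (- s ^+ 2)) s /\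
       normc (f (- s ^+ 2)) <= G * (1 + complex.Im s ^+ 2) ^+ m) /\
    (forall T0, exists2 d0, 0 < d0 & exists M, forall s,
       rho <= complex.Re s <= rho + d0 -> `|complex.Im s| <= T0 ->
       holo (fun s => f (- s ^+ 2)) s /\ normc (f (- s ^+ 2)) <= M).
Proof.
move=> r0 C0 hf hg; have [G [m HG]] := strip_growth r0 C0 hf hg.
exists G, m; split => [s hs|T0].
  split; last exact: HG.
  have [r rp [M HM]] := analytic_strip hf hs.
  by apply: (HM s _).1; rewrite subrr normc0.
have [d d0 [M HM]] := strip_uniform T0 r0 (fun s hs => analytic_strip hf hs).
exists d => //; exists M => s /andP[h1 h2]; apply: HM; rewrite h2 andbT.
by apply: le_trans h1; clear -r0; lra.
Qed.

(** * The quadrature error *)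

Definition weight_integrable (R : realType) (a : R) (phi : R -> R) : Prop :=
  lebesgue_measure.-integrable `[(0:R), +oo[ (EFin \o (fun x => laguerre_weight a x * phi x)).

Definition weight_integrable_parts (R : realType) (a : R) (f : R[i] -> R[i]) : Prop :=
  weight_integrable a (fun x => complex.Re (f x%:C)) /\
  weight_integrable a (fun x => complex.Im (f x%:C)).

Lemma laguerre_integralB (R : realType) (a : R) (f g : R[i] -> R[i]) :
  weight_integrable_parts a f -> weight_integrable_parts a g ->
  laguerre_integral a (fun z => f z - g z) = laguerre_integral a f - laguerre_integral a g.
Proof.
move=> [f1 f2] [g1 g2]; rewrite /laguerre_integral; apply/eqP; rewrite eq_complex /=.
rewrite -!RintegralB//.
by apply/andP; split; apply/eqP; apply: eq_Rintegral => x _;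
  case: (f _) => ? ?; case: (g _) => ? ? /=; rewrite mulrBr.
Qed.

Lemma weight_intZD (R : realType) (a u v : R) (phi psi : R -> R) :
  weight_integrable a phi -> weight_integrable a psi ->
  weight_integrable a (fun x => u * phi x + v * psi x) /\
  weight_int a (fun x => u * phi x + v * psi x) = u * weight_int a phi + v * weight_int a psi.
Proof.
move=> h1 h2.
have k1 : weight_integrable a (fun x => u * phi x).
  have := @integrable_mulr R `[(0:R), +oo[ _ u (measurable_itv _) h1.
  by apply: eq_integrable => // x _ /=; congr (_%:E); ring.
have k2 : weight_integrable a (fun x => v * psi x).
  have := @integrable_mulr R `[(0:R), +oo[ _ v (measurable_itv _) h2.
  by apply: eq_integrable => // x _ /=; congr (_%:E); ring.
split.
  have mD : measurable (`[(0:R), +oo[%classic : set (measurableTypeR R)) by [].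
  have := @integrableD _ _ R lebesgue_measure _ mD _ _ k1 k2.
  by apply: eq_integrable => // x _ /=; rewrite -EFinD mulrDr.
rewrite /weight_int -!RintegralZl// -RintegralD//; last 2 first.
- by move: k1; apply: eq_integrable => // x _ /=; congr (_%:E); ring.
- by move: k2; apply: eq_integrable => // x _ /=; congr (_%:E); ring.
by apply: eq_Rintegral => x _; ring.
Qed.

(** The integral is projected onto its own direction, the unit vector [(u, v)], which reduces the
    claim to real integrands. *)
Lemma normc_laguerre_integral_le (R : realType) (a : R) (f : R[i] -> R[i]) (b : R -> R) :
  weight_integrable_parts a f -> weight_integrable a b ->
  (forall x, 0 <= x -> normc (f x%:C) <= b x) ->
  normc (laguerre_integral a f) <= weight_int a b.
Proof.
move=> [f1 f2] bi fb; set I := laguerre_integral a f.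
have b0 x : 0 <= x -> 0 <= b x by move=> /fb; apply: le_trans; exact: normc_ge0.
have [->|I0] := eqVneq I 0.
  rewrite normc0; apply: Rintegral_ge0 => x /=; rewrite in_itv/= andbT => x0.
  by rewrite mulr_ge0 ?laguerre_weight_ge0// b0.
have n0 : 0 < normc I by rewrite normc_gt0.
pose u := complex.Re I / normc I; pose v := complex.Im I / normc I.
have uv : u ^+ 2 + v ^+ 2 = 1.
  have := sqr_normc_ReIm I; rewrite /u /v !expr_div_n => E.
  by rewrite -mulrDl -E mulfV// sqrf_eq0 gt_eqF.
have nE : normc I = u * complex.Re I + v * complex.Im I.
  have := sqr_normc_ReIm I; rewrite /u /v => E.
  apply: (mulIf (lt0r_neq0 n0)); rewrite -expr2 E.
  by field; rewrite gt_eqF.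
have [k1 k2] := weight_intZD u v f1 f2.
rewrite nE (_ : complex.Re I = weight_int a (fun x => complex.Re (f x%:C)))//.
rewrite (_ : complex.Im I = weight_int a (fun x => complex.Im (f x%:C)))// -k2.
apply: le_weight_int => // x x0; apply: le_trans (fb x x0).
rewrite (_ : u * complex.Re (f x%:C) + v * complex.Im (f x%:C) = complex.Re ((u +i* - v) * f x%:C)); last first.
  by case: (f _) => p q /=; ring.
apply: le_trans (ler_norm _) _; apply: le_trans (Re_le_normc _) _.
by rewrite normcM /= sqrrN uv sqrtr1 mul1r.
Qed.

Definition Re_poly (R : realType) (p : {poly R[i]}) : {poly R} :=
  \poly_(i < size p) complex.Re p`_i.

Definition Im_poly (R : realType) (p : {poly R[i]}) : {poly R} :=
  \poly_(i < size p) complex.Im p`_i.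

Lemma horner_ReIm (R : realType) (p : {poly R[i]}) (x : R) :
  p.[x%:C] = (Re_poly p).[x] +i* (Im_poly p).[x].
Proof.
rewrite !horner_poly horner_coef -complex_sum; apply: eq_bigr => i _.
rewrite -rmorphXn /=; case: (p`_i) => u v.
by apply/eqP; rewrite eq_complex /=; apply/andP; split; apply/eqP; ring.
Qed.

Lemma horner_integrable_parts (R : realType) (a : R) (p : {poly R[i]}) : -1 < a ->
  weight_integrable_parts a (horner p).
Proof.
move=> a1; split.
  have := integrable_weight_poly (Re_poly p) a1.
  by apply: eq_integrable => // x _ /=; rewrite horner_ReIm.
have := integrable_weight_poly (Im_poly p) a1.
by apply: eq_integrable => // x _ /=; rewrite horner_ReIm.
Qed.

Lemma laguerre_weight_shift (R : realType) (a : R) e (x : R) : -1 < a -> 0 <= x ->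
  laguerre_weight (a + e%:R) x = laguerre_weight a x * x ^+ e.
Proof.
move=> a1; rewrite le_eqVlt => /orP[/eqP <-|]; last exact: laguerre_weightS.
case: e => [|e]; first by rewrite addr0 expr0 mulr1.
rewrite expr0n /= mulr0 /laguerre_weight powR0 ?mul0r// gt_eqF//.
by rewrite -natr1 addrCA ltr_wpDl//; lra.
Qed.

Lemma weight_int_shift (R : realType) (a : R) e (phi : R -> R) : -1 < a ->
  weight_int (a + e%:R) phi = weight_int a (fun x => x ^+ e * phi x).
Proof.
move=> a1; apply: eq_Rintegral => x; rewrite inE /= in_itv /= andbT => x0.
by rewrite laguerre_weight_shift// mulrA.
Qed.

(** Since x^e omega_a is the weight of parameter a + e, the node polynomial is orthogonal under
    omega_a to all polynomials of degree less than n; this is the source of the higher degree of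
    exactness. *)
Lemma laguerre_integral_node0 (R : realType) (a : R) e n (q : {poly R[i]}) : -1 < a ->
  (size q <= n)%N ->
  laguerre_integral a
    (horner (q * map_poly (real_complex R) ('X^e * laguerre n (a + e%:R)))) = 0.
Proof.
move=> a1 qn; have a2 : -1 < a + e%:R by rewrite ltr_wpDr.
have Z (p : {poly R}) : (size p <= size q)%N ->
    weight_int a (fun x => x ^+ e * (laguerre n (a + e%:R) * p).[x]) = 0.
  move=> pq; rewrite -weight_int_shift//; apply: weight_int_laguerreM => //.
  exact: leq_trans qn.
have E x : (q * map_poly (real_complex R) ('X^e * laguerre n (a + e%:R))).[x%:C] =
    (x ^+ e * (laguerre n (a + e%:R) * Re_poly q).[x]) +i*
    (x ^+ e * (laguerre n (a + e%:R) * Im_poly q).[x]).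
  rewrite hornerM horner_map horner_ReIm !hornerM hornerXn.
  by apply/eqP; rewrite eq_complex /=; apply/andP; split; apply/eqP; ring.
rewrite /laguerre_integral; apply/eqP; rewrite eq_complex /=; apply/andP; split; apply/eqP.
  rewrite -[RHS](Z (Re_poly q)) ?size_poly//.
  by apply: eq_Rintegral => x _; rewrite E.
rewrite -[RHS](Z (Im_poly q)) ?size_poly//.
by apply: eq_Rintegral => x _; rewrite E.
Qed.

(** The half-line x >= 0 is the image of the imaginary axis s = i sqrt x, where f is continuous and
    of polynomial growth. *)
Lemma weight_integrable_growth (R : realType) (a G : R) m (f : R[i] -> R[i]) : -1 < a ->
  (forall t, holo (fun s => f (- s ^+ 2)) (0 +i* t)) ->
  (forall t, normc (f (- (0 +i* t) ^+ 2)) <= G * (1 + t ^+ 2) ^+ m) ->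
  weight_integrable_parts a f.
Proof.
move=> a1 hf hg.
pose h t := f (- (0 +i* t) ^+ 2).
have fh x : 0 <= x -> f x%:C = h (Num.sqrt x).
  move=> x0; congr f; apply/eqP; rewrite eq_complex /= -{1}(sqr_sqrtr x0).
  by apply/andP; split; apply/eqP; ring.
have ch t : {for t, continuous (fun t => complex.Re (h t))} /\
            {for t, continuous (fun t => complex.Im (h t))}.
  apply: (@holo_cont_ver _ (fun s => f (- s ^+ 2)) 0 t t) => //; last by rewrite lexx.
have m1 : measurable_fun [set: R] (fun x => complex.Re (h (Num.sqrt x))).
  apply: continuous_measurable_fun => x.
  apply: (@continuous_comp _ _ _ (@Num.sqrt R) (fun t => complex.Re (h t))).
    exact: sqrt_continuous.
  exact: (ch _).1.
have m2 : measurable_fun [set: R] (fun x => complex.Im (h (Num.sqrt x))).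
  apply: continuous_measurable_fun => x.
  apply: (@continuous_comp _ _ _ (@Num.sqrt R) (fun t => complex.Im (h t))).
    exact: sqrt_continuous.
  exact: (ch _).2.
have [K K0 HK] := horner_bound ((1 + 'X) ^+ m : {poly R}).
have G0 : 0 <= G.
  have q0 : 0 < (1 + (0 : R) ^+ 2) ^+ m by rewrite exprn_gt0// ltr_pwDl ?sqr_ge0.
  by have := le_trans (normc_ge0 _) (hg 0); rewrite (pmulr_lge0 _ q0).
have bd x : 0 <= x -> normc (h (Num.sqrt x)) <= G * K * (1 + x ^+ size ((1 + 'X) ^+ m : {poly R})).
  move=> x0; apply: le_trans (hg _) _; rewrite -mulrA ler_wpM2l// sqr_sqrtr//.
  apply: le_trans (HK x x0); rewrite horner_exp hornerD hornerX -polyC1 hornerC.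
  exact: ler_norm.
split.
  have := @integrable_weightM R a _ _ _ a1 (measurable_funTS m1)
    (fun x x0 => le_trans (Re_le_normc _) (bd x x0)).
  apply: eq_integrable => // x; rewrite inE /= in_itv /= andbT => x0.
  by rewrite fh.
have := @integrable_weightM R a _ _ _ a1 (measurable_funTS m2)
  (fun x x0 => le_trans (Im_le_normc _) (bd x x0)).
apply: eq_integrable => // x; rewrite inE /= in_itv /= andbT => x0.
by rewrite fh.
Qed.

Lemma interpolation (F : fieldType) (xs : seq F) (f : F -> F) : uniq xs ->
  exists2 r : {poly F}, (size r <= size xs)%N & {in xs, forall x, r.[x] = f x}.
Proof.
elim: xs => [_|y xs IH] /=.
  by exists 0; rewrite ?size_poly0.
move=> /andP[yxs /IH[r sr hr]]; pose p := \prod_(x <- xs) ('X - x%:P).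
have py : p.[y] != 0 by rewrite -rootE root_prod_XsubC.
exists (r + ((f y - r.[y]) / p.[y]) *: p).
  rewrite (leq_trans (size_polyD _ _))// geq_max (leq_trans sr)//=.
  by rewrite (leq_trans (size_scale_leq _ _))// size_prod_XsubC.
move=> x; rewrite inE hornerD hornerZ => /orP[/eqP ->|xxs].
  by rewrite divfK// addrC subrK.
have /eqP -> : p.[x] == 0 by rewrite -rootE root_prod_XsubC.
by rewrite mulr0 addr0 hr.
Qed.

Lemma quadrature_interpolant (R : realType) n (x w : 'I_n.+1 -> R) (f : R[i] -> R[i]) :
  injective x -> exists2 r : {poly R[i]}, (size r <= n.+1)%N &
    forall k, r.[(x k)%:C] = f (x k)%:C.
Proof.
move=> xi; have u : uniq [seq (x k)%:C | k <- enum 'I_n.+1].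
  by rewrite map_inj_uniq ?enum_uniq// => j k /complexI; exact: xi.
have [r sr hr] := interpolation f u; exists r; first by move: sr; rewrite size_map size_enum_ord.
by move=> k; apply: hr; apply: map_f; rewrite mem_enum.
Qed.

Lemma eq_quadrature (R : realType) n (x w : 'I_n.+1 -> R) (f g : R[i] -> R[i]) :
  (forall k, f (x k)%:C = g (x k)%:C) -> quadrature x w f = quadrature x w g.
Proof. by move=> fg; apply: eq_bigr => k _; rewrite fg. Qed.

(** At the nodes f may be replaced by its interpolating polynomial of degree at most n, on which
    both rules give the exact integral. *)
Lemma quadrature_same_nodes (R : realType) (a : R) n (x w x' w' : 'I_n.+1 -> R)
    (f : R[i] -> R[i]) :
  interpolatory a x w -> interpolatory a x' w' -> (forall k, exists j, x' k = x j) ->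
  quadrature x w f = quadrature x' w' f.
Proof.
move=> [xi ex] [_ ex'] xx; have [r sr hr] := quadrature_interpolant w f xi.
rewrite (@eq_quadrature _ _ x w f (horner r)); last by move=> k; rewrite hr.
rewrite (@eq_quadrature _ _ x' w' f (horner r)); last first.
  by move=> k; have [j ->] := xx k; rewrite hr.
by rewrite -ex// -ex'.
Qed.

Lemma laguerre_resolvent_shift (R : realType) (a u : R) e n : -1 < a ->
  laguerre_resolvent n (a + e%:R) u =
  weight_int a (fun x => ('X^e * laguerre n (a + e%:R) ^+ 2).[x] / (x + u)).
Proof.
move=> a1; rewrite /laguerre_resolvent weight_int_shift//; congr weight_int.
by apply/funext => x; rewrite hornerM hornerXn horner_exp mulrA.
Qed.

(** The bound on f - H contains the node polynomial, so f and H agree at the nodes. Dividing H by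
    the node polynomial P, the remainder is integrated exactly because the rule is interpolatory,
    and the quotient times P has integral 0 by orthogonality. Hence the error is the integral of f -
    H. *)
Lemma rule_error (R : realType) (a A1 A2 u1 u2 : R) e N n (x w : 'I_n.+1 -> R)
    (f : R[i] -> R[i]) (H : {poly R[i]}) :
  -1 < a -> 0 < u1 -> 0 < u2 -> (N + e = n.+1)%N -> interpolatory a x w ->
  (forall k, root ('X^e * laguerre N (a + e%:R)) (x k)) -> (forall k, 0 <= x k) ->
  weight_integrable_parts a f -> (size H <= 2 * N + e)%N ->
  (forall y, 0 <= y -> normc (f y%:C - H.[y%:C]) <=
     y ^+ e * (laguerre N (a + e%:R)).[y] ^+ 2 * (A1 / (y + u1) + A2 / (y + u2))) ->
  normc (laguerre_integral a f - quadrature x w f) <=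
    A1 * laguerre_resolvent N (a + e%:R) u1 + A2 * laguerre_resolvent N (a + e%:R) u2.
Proof.
move=> a1 u10 u20 Nn [xi ex] rx x0 fi sH fH.
have a2 : -1 < a + e%:R by rewrite ltr_wpDr.
pose P := map_poly (real_complex R) ('X^e * laguerre N (a + e%:R)).
have lN0 : laguerre N (a + e%:R) != 0.
  by rewrite -size_poly_eq0 size_laguerre.
have sP : size P = n.+2.
  by rewrite size_map_poly mulrC size_mulXn// size_laguerre// addnS -Nn addnC.
have P0 : P != 0 by rewrite -size_poly_eq0 sP.
have Px k : P.[(x k)%:C] = 0 by rewrite horner_map (eqP (rx k)).
have fx k : f (x k)%:C = H.[(x k)%:C].
  have /eqP := rx k; rewrite hornerM hornerXn => E.
  apply/eqP; rewrite -subr_eq0 -normc_eq0 eq_le normc_ge0 andbT.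
  apply: le_trans (fH _ (x0 k)) _.
  by rewrite expr2 mulrA E !mul0r.
rewrite (eq_quadrature w fx).
have EH := divp_eq H P.
have Qr : quadrature x w (horner H) = laguerre_integral a (horner (H %% P)).
  rewrite ex; last by rewrite -ltnS -sP ltn_modp.
  by apply: eq_quadrature => k; rewrite {1}EH hornerD hornerM Px mulr0 add0r.
have IH : laguerre_integral a (horner H) = laguerre_integral a (horner (H %% P)).
  have := laguerre_integralB (horner_integrable_parts H a1) (horner_integrable_parts (H %% P) a1).
  have -> : laguerre_integral a (fun z => H.[z] - (H %% P).[z]) =
      laguerre_integral a (horner (H %/ P * P)).
    by congr laguerre_integral; apply/funext => z; rewrite {1}EH hornerD addrK.
  rewrite laguerre_integral_node0//; last first.
    (* P has degree n + 1 = N + e, so the quotient of H, of size at most 2N + e, has size at most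
       N. *)
    by rewrite size_divp// sP /= leq_subLR -Nn (leq_trans sH)// mul2n -addnn addnAC.
  by move/esym/eqP; rewrite subr_eq0 => /eqP.
rewrite Qr -IH -laguerre_integralB//; last exact: horner_integrable_parts.
have v1 := @integrable_weight_polyV R a u1 ('X^e * laguerre N (a + e%:R) ^+ 2) a1 u10.
have v2 := @integrable_weight_polyV R a u2 ('X^e * laguerre N (a + e%:R) ^+ 2) a1 u20.
have [b1 b2] := weight_intZD A1 A2 v1 v2.
rewrite !laguerre_resolvent_shift// -b2; apply: normc_laguerre_integral_le => //.
  have [f1 f2] := fi; have [h1 h2] := horner_integrable_parts H a1.
  split.
    have [k1 _] := weight_intZD 1 (-1) f1 h1.
    move: k1; apply: eq_integrable => // y _ /=; congr (_ * _)%:E.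
    by case: (f _) => ? ?; case: (H.[_]) => ? ? /=; ring.
  have [k1 _] := weight_intZD 1 (-1) f2 h2.
  move: k1; apply: eq_integrable => // y _ /=; congr (_ * _)%:E.
  by case: (f _) => ? ?; case: (H.[_]) => ? ? /=; ring.
move=> y y0; apply: le_trans (fH y y0) _.
by rewrite le_eqVlt; apply/orP; left; apply/eqP; rewrite hornerM hornerXn horner_exp; ring.
Qed.

Lemma laguerre_root_gt0 (R : realType) n (a y : R) : -1 < a -> root (laguerre n a) y -> 0 < y.
Proof.
move=> a1 /eqP hy; rewrite ltNge; apply/negP => y0.
have := horner_laguerreN_gt0 n a1 (_ : 0 <= - y).
by rewrite oppr_ge0 opprK hy ltxx => /(_ y0).
Qed.

(** The nodes themselves supply the zeros: among n + 1 distinct zeros of x^e L_N at most e are not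
    zeros of L_N, so N of them are, and L_N splits over the reals. *)
Lemma laguerre_split (R : realType) n N e (a : R) (x : 'I_n.+1 -> R) :
  -1 < a -> (e <= 1)%N -> (N + e = n.+1)%N -> injective x ->
  (forall k, root ('X^e * laguerre N a) (x k)) ->
  exists c xs, [/\ c != 0, all (fun y => 0 <= y) xs &
    laguerre N a = c *: \prod_(y <- xs) ('X - y%:P)].
Proof.
move=> a1 e1 Nn xi rx; pose L := laguerre N a.
have L0 : L != 0 by rewrite -size_poly_eq0 size_laguerre.
pose s := [seq x k | k <- enum 'I_n.+1].
have us : uniq s by rewrite map_inj_uniq ?enum_uniq.
have ss : size s = n.+1 by rewrite size_map size_enum_ord.
pose xs := [seq y <- s | root L y].
have uxs : uniq xs by rewrite filter_uniq.
have rxs : all (root L) xs by exact: filter_all.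
have sxs : size xs = N.
  apply/eqP; rewrite eqn_leq -ltnS -(size_laguerre N a1) max_poly_roots//=.
  have : (size [seq y <- s | ~~ root L y] <= e)%N.
    have H y : y \in [seq y <- s | ~~ root L y] -> (e == 1)%N && (y == 0).
      rewrite mem_filter => /andP[yL /mapP[k _ yk]]; have := rx k.
      rewrite -yk rootM (negPf yL) orbF; case: (e) e1 => [|[|//]] _.
        by rewrite expr0 (negPf (root1 _)).
      by rewrite expr1 rootX.
    case: (e) e1 H => [|[|//]] _ H.
      by case: [seq y <- s | _] H => // y ys /(_ y); rewrite mem_head => /(_ isT).
    have /(uniq_leq_size) : {subset [seq y <- s | ~~ root L y] <= [:: 0]}.
      by move=> y /H; rewrite inE.
    by apply; rewrite filter_uniq.
  move=> h; have := count_predC (root L) s; rewrite ss -Nn -!size_filter -/xs => E.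
  by rewrite -(leq_add2r e) -E leq_add2l.
exists (lead_coef L), xs; split.
- by rewrite lead_coef_eq0.
- by apply/allP => y /(allP rxs) /laguerre_root_gt0 /ltW; apply.
- by apply: all_roots_prod_XsubC; rewrite ?uniq_rootsE// sxs size_laguerre.
Qed.

(** Combines [contour_error], [rule_error] and the decay of the resolvents at [rho] and [r']. Since
    e <= 1, N >= n, so e^{-4 r sqrt N} may be replaced by e^{-4 r sqrt n}. *)
Lemma rule_error_littleo (R : realType) (a rho G : R) (e m : nat) (f : R[i] -> R[i]) :
  -1 < a -> (e <= 1)%N -> 0 < rho ->
  (forall s, - rho <= complex.Re s <= rho -> holo (fun s => f (- s ^+ 2)) s /\
     normc (f (- s ^+ 2)) <= G * (1 + complex.Im s ^+ 2) ^+ m) ->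
  (forall T0, exists2 d0, 0 < d0 & exists M, forall s,
     rho <= complex.Re s <= rho + d0 -> `|complex.Im s| <= T0 ->
     holo (fun s => f (- s ^+ 2)) s /\ normc (f (- s ^+ 2)) <= M) ->
  forall eta, 0 < eta -> exists n0, forall n, (n0 <= n)%N -> forall N (x w : 'I_n.+1 -> R),
    (N + e = n.+1)%N -> interpolatory a x w ->
    (forall k, root ('X^e * laguerre N (a + e%:R)) (x k)) ->
    normc (laguerre_integral a f - quadrature x w f)
      <= eta * expR (- (4 * rho * Num.sqrt n%:R)).
Proof.
move=> a1 e1 r0 hf hbox eta eta0; set b := a + e%:R.
have b1 : -1 < b by rewrite ltr_wpDr.
have [C1 C10 [n1 H1]] := laguerre_resolvent_bound b1 r0.
(* Half of [eta] goes to the part on Re s = rho; the other half absorbs the part on Re s = r' once n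
   is large. *)
pose eps := eta / (2 * (C1 + 1)).
have C11 : 0 < C1 + 1 by rewrite ltr_wpDl.
have eps0 : 0 < eps by rewrite divr_gt0// mulr_gt0.
have [r' rr' [K K0 [n2 H2]]] := contour_error e b1 r0 hf hbox eps0.
have r'0 : 0 < r' by exact: lt_trans rr'.
have [C2 C20 [n3 H3]] := laguerre_resolvent_bound b1 r'0.
pose d := 4 * (r' - rho).
have d0 : 0 < d by rewrite mulr_gt0// subr_gt0.
have [n4 H4] := sqrtn_ge (2 * (K * C2) / (eta * d)).
exists (maxn (maxn n1 n2) (maxn n3 n4)) => n hn N x w Nn hx rx.
have nN : (n <= N)%N.
  by rewrite -ltnS -Nn -addn1 leq_add2l.
have [n1n n2n n3n n4n] : [/\ n1 <= N, n2 <= N, n3 <= N & n4 <= n]%N.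
  move: hn; rewrite !geq_max => /andP[/andP[h1 h2] /andP[h3 h4]].
  by split=> //; [exact: leq_trans h1 nN|exact: leq_trans h2 nN|exact: leq_trans h3 nN].
have [c [xs [c0 xs0 E]]] := laguerre_split b1 e1 Nn hx.1 rx.
have [H sH HH] := H2 N n2n c xs c0 xs0 E.
have q1 : 0 < (laguerre_sq N b).[rho] ^+ 2 by rewrite exprn_gt0// laguerre_sq_gt0.
have q2 : 0 < (laguerre_sq N b).[r'] ^+ 2 by rewrite exprn_gt0// laguerre_sq_gt0.
have x0 k : 0 <= x k.
  have := rx k; rewrite rootM => /orP[|/(laguerre_root_gt0 b1)/ltW//].
  by rewrite rootE hornerXn expf_eq0 => /andP[_ /eqP ->].
have fi : weight_integrable_parts a f.
  have h0 t : - rho <= complex.Re (0 +i* t) <= rho by rewrite /= oppr_le0 !ltW.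
  by apply: (@weight_integrable_growth _ a G m) => // t; have [] := hf _ (h0 t).
have := @rule_error R a (eps / (laguerre_sq N b).[rho] ^+ 2) (K / (laguerre_sq N b).[r'] ^+ 2)
  (rho ^+ 2) (r' ^+ 2) e N n x w f H a1 (exprn_gt0 _ r0) (exprn_gt0 _ r'0) Nn hx rx x0 fi sH.
rewrite -/b => /(_ _)/le_trans; apply.
  move=> y y0; apply: le_trans (HH y y0) _.
  rewrite le_eqVlt; apply/orP; left; apply/eqP; congr (_ * (_ + _)).
    by rewrite invfM mulrA.
  by rewrite invfM mulrA.
have sN : Num.sqrt n%:R <= Num.sqrt N%:R :> R by rewrite ler_sqrt// ler_nat.
have eN r : 0 < r -> expR (- (4 * r * Num.sqrt N%:R)) <= expR (- (4 * r * Num.sqrt n%:R)) :> R.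
  by move=> r_gt0; rewrite ler_expR lerN2 ler_wpM2l// mulr_ge0// ltW.
have part (A C r : R) (q : R) : 0 < q -> 0 <= A -> 0 <= C -> 0 < r ->
    laguerre_resolvent N b (r ^+ 2) <= C * expR (- (4 * r * Num.sqrt N%:R)) * q ->
    A / q * laguerre_resolvent N b (r ^+ 2) <= A * C * expR (- (4 * r * Num.sqrt n%:R)).
  move=> q0 A0 C0 rp h; apply: (@le_trans _ _ (A / q * (C * expR (- (4 * r * Num.sqrt n%:R)) * q))).
    apply: ler_wpM2l; first by rewrite divr_ge0// ltW.
    apply: le_trans h _; rewrite ler_wpM2r ?(ltW q0)// ler_wpM2l//; exact: eN.
  by rewrite le_eqVlt; apply/orP; left; apply/eqP; field; rewrite gt_eqF.
have := part _ _ _ _ q1 (ltW eps0) C10 r0 (H1 N n1n).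
have := part _ _ _ _ q2 K0 C20 r'0 (H3 N n3n).
have e2 : expR (- (4 * r' * Num.sqrt n%:R)) = expR (- (4 * rho * Num.sqrt n%:R)) * expR (- (d * Num.sqrt n%:R)) :> R.
  by rewrite -expRD; congr expR; rewrite /d; ring.
have e3 : K * C2 * expR (- (d * Num.sqrt n%:R)) <= eta / 2.
  have [->|n0] := eqVneq (K * C2) 0; first by rewrite mul0r divr_ge0// ltW.
  have KC : 0 < K * C2 by rewrite lt0r n0 mulr_ge0.
  have ed : 0 < eta * d by exact: mulr_gt0.
  have := H4 n n4n; rewrite (ler_pdivrMr _ _ ed) => h.
  rewrite expRN ler_pdivrMr ?expR_gt0//.
  apply: (@le_trans _ _ (eta / 2 * (1 + d * Num.sqrt n%:R))); last first.
    by rewrite ler_wpM2l ?expR_ge1Dx// divr_ge0// ltW.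
  move: h; rewrite mulrDr mulr1; move: (Num.sqrt n%:R) => y h.
  have : 0 < eta / 2 by rewrite divr_gt0.
  by rewrite (_ : eta / 2 * (d * y) = y * (eta * d) / 2); [move: h; clear; lra|field].
have e4 : eps * C1 <= eta / 2.
  rewrite /eps (_ : eta / (2 * (C1 + 1)) * C1 = C1 / (C1 + 1) * (eta / 2)); last by field; rewrite gt_eqF.
  by rewrite ler_piMl ?divr_ge0 ?(ltW eta0)// ler_pdivrMr// mul1r lerDl.
rewrite e2 => p2 p1; apply: le_trans (lerD p1 p2) _.
set Z := expR _ in p1 p2 *; have Z0 : 0 <= Z by exact: expR_ge0.
rewrite (_ : eta * Z = eta / 2 * Z + eta / 2 * Z); last by field.
apply: lerD; first by rewrite ler_wpM2r.
by rewrite [Z * _]mulrC mulrA ler_wpM2r.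
Qed.

(** For each n all rules with the prescribed nodes give the same value ([quadrature_same_nodes]), so
    [b n] can be the common error, or 0 if no rule exists. One sequence is thus available before any
    rule is given. *)
Lemma rule_bound (R : realType) (a rho G : R) (e m : nat) (f : R[i] -> R[i]) :
  -1 < a -> (e <= 1)%N -> 0 < rho ->
  (forall s, - rho <= complex.Re s <= rho -> holo (fun s => f (- s ^+ 2)) s /\
     normc (f (- s ^+ 2)) <= G * (1 + complex.Im s ^+ 2) ^+ m) ->
  (forall T0, exists2 d0, 0 < d0 & exists M, forall s,
     rho <= complex.Re s <= rho + d0 -> `|complex.Im s| <= T0 ->
     holo (fun s => f (- s ^+ 2)) s /\ normc (f (- s ^+ 2)) <= M) ->
  exists b : nat -> R, [/\ forall n, 0 <= b n,
    forall n (x w : 'I_n.+1 -> R), interpolatory a x w ->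
      (forall k, root ('X^e * laguerre (n.+1 - e) (a + e%:R)) (x k)) ->
      normc (laguerre_integral a f - quadrature x w f) <= b n &
    forall eta, 0 < eta -> exists n0, forall n, (n0 <= n)%N ->
      b n <= eta * expR (- (4 * rho * Num.sqrt n%:R))].
Proof.
move=> a1 e1 r0 hf hbox.
have a2 : -1 < a + e%:R by rewrite ltr_wpDr.
pose rule n (x w : 'I_n.+1 -> R) := interpolatory a x w /\
  forall k, root ('X^e * laguerre (n.+1 - e) (a + e%:R)) (x k).
pose err n (x w : 'I_n.+1 -> R) := normc (laguerre_integral a f - quadrature x w f).
have Nn n : (n.+1 - e + e = n.+1)%N by rewrite subnK// (leq_trans e1).
have [b Hb] : {b : nat -> R & forall n,
    (forall x w, rule n x w -> err n x w = b n) /\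
    ((exists x w, rule n x w) \/ b n = 0)}.
  apply: (@choice _ _ (fun n b => (forall x w, rule n x w -> err n x w = b) /\
    ((exists x w, rule n x w) \/ b = 0))) => n.
  have [[x [w xw]]|no] := pselect (exists x w, rule n x w); last first.
    by exists 0; split; [move=> x w xw; case: no; exists x, w|right].
  exists (err n x w); split; last by left; exists x, w.
  move=> x' w' xw'; rewrite /err (@quadrature_same_nodes R a n x w x' w')//.
  - by case: xw.
  - by case: xw'.
  case: xw => -[xi _] rx k; case: xw' => _ /(_ k).
  pose P := 'X^e * laguerre (n.+1 - e) (a + e%:R) : {poly R}.
  have lN0 : laguerre (n.+1 - e) (a + e%:R) != 0.
    by rewrite -size_poly_eq0 size_laguerre.
  have sP : size P = n.+2.
    by rewrite /P mulrC size_mulXn// size_laguerre// addnS addnC Nn.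
  pose s := [seq x k | k <- enum 'I_n.+1].
  have EP : P = lead_coef P *: \prod_(y <- s) ('X - y%:P).
    apply: all_roots_prod_XsubC.
    - by rewrite sP size_map size_enum_ord.
    - by apply/allP => _ /mapP[j _ ->]; exact: rx.
    - by rewrite uniq_rootsE map_inj_uniq ?enum_uniq.
  rewrite -/P EP rootZ ?root_prod_XsubC; last first.
    by rewrite lead_coef_eq0 -size_poly_eq0 sP.
  by move=> /mapP[j _ ->]; exists j.
exists b; split.
- move=> n; have [h1 [[x [w xw]]|->//]] := Hb n.
  by rewrite -(h1 x w xw) normc_ge0.
- by move=> n x w h1 h2; have [h3 _] := Hb n; rewrite -(h3 x w (conj h1 h2)).
move=> eta eta0; have [n0 H0] := rule_error_littleo a1 e1 r0 hf hbox eta0.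
exists n0 => n hn; have [h1 [[x [w xw]]|->]] := Hb n; last first.
  by rewrite mulr_ge0 ?(ltW eta0)// expR_ge0.
rewrite -(h1 x w xw); case: xw => xw1 xw2.
exact: (H0 n hn _ x w (Nn n) xw1 xw2).
Qed.

(** * Finiteness of the arc length integral, and the theorem *)

Lemma normc_cexp (R : realType) (z : R[i]) : normc (cexp z) = expR (complex.Re z).
Proof.
rewrite /cexp /normc; set E := expR _.
rewrite !exprMn -mulrDr cos2Dsin2 mulr1 sqrtr_sqr ger0_norm//.
exact: expR_ge0.
Qed.

Lemma normc_cpow (R : realType) (z : R[i]) (p : R) : normc (cpow z p) = normc z `^ p.
Proof.
rewrite /cpow {1}/normc; set E := powR _ _.
by rewrite !exprMn -mulrDr cos2Dsin2 mulr1 sqrtr_sqr ger0_norm// powR_ge0.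
Qed.

Lemma path_speed_parabola (R : realType) (rho t : R) :
  path_speed (parabola_path rho) t = 2 * Num.sqrt (rho ^+ 2 + t ^+ 2).
Proof.
have d1 : deriv_at (@complex.Re R \o parabola_path rho) t (2 * t).
  rewrite (_ : _ \o _ = fun t => t * t - rho * rho).
    apply: drv_eq; first by apply: drvB; [apply: drvM; exact: drv_id|exact: drvC].
    by rewrite mul1r mulr1 subr0 -mulr2n mulr_natl.
  by apply/funext => u; rewrite /parabola_path /=; ring.
have d2 : deriv_at (@complex.Im R \o parabola_path rho) t (- (2 * rho)).
  rewrite (_ : _ \o _ = fun t => - (2 * rho) * t).
    by apply: drv_eq; [apply: drvZ; exact: drv_id|rewrite mulr1].
  by apply/funext => u; rewrite /parabola_path /=; ring.
rewrite /path_speed !derive1E (@derive_val _ _ _ _ _ _ _ d1) (@derive_val _ _ _ _ _ _ _ d2) /=.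
rewrite (_ : (2 * t) ^+ 2 + _ = 2 ^+ 2 * (rho ^+ 2 + t ^+ 2)); last by ring.
by rewrite sqrtrM ?sqr_ge0// sqrtr_sqr ger0_norm.
Qed.

Lemma powR_sqrt (R : realType) (y p : R) : 0 < y -> y `^ p * Num.sqrt y = y `^ (p + 1 / 2).
Proof.
move=> y0; rewrite powRD; last by rewrite (gt_eqF y0) implybT.
by congr (_ * _); rewrite mul1r -powR12_sqrt// ltW.
Qed.

(** In the parameter t = Im s, the modulus of e^{-z} is e^{rho^2 - t^2}, the remaining factors grow
    polynomially, and the integrand is dominated by K / (1 + t^2). The speed 2 |s| raises the
    exponent a + 1/2 of |s|^2 to a + 1. *)
Lemma arc_length_integral_fin (R : realType) (a rho G : R) m (f : R[i] -> R[i]) :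
  -1 < a -> 0 < rho ->
  (forall t, holo (fun s => f (- s ^+ 2)) (rho +i* t) /\
     normc (f (- (rho +i* t) ^+ 2)) <= G * (1 + t ^+ 2) ^+ m) ->
  exists2 A : R, 0 <= A & arc_length_integral (parabola_path rho)
    (fun z => normc (cexp (- z) * cpow (- z) (a + 1 / 2) * f z)) = A%:E.
Proof.
move=> a1 r0 hf; pose F t := f (- (rho +i* t) ^+ 2).
pose y (t : R) := rho ^+ 2 + t ^+ 2.
have y0 t : 0 < y t by rewrite ltr_pwDl ?sqr_ge0// exprn_gt0.
pose h t := expR (rho ^+ 2 - t ^+ 2) * y t `^ (a + 1 / 2) * normc (F t) * (2 * Num.sqrt (y t)).
have E : arc_length_integral (parabola_path rho)
    (fun z => normc (cexp (- z) * cpow (- z) (a + 1 / 2) * f z)) =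
    (\int[lebesgue_measure]_t (h t)%:E)%E.
  apply: eq_integral => t _; rewrite path_speed_parabola !normcM normc_cexp normc_cpow.
  rewrite /parabola_path opprK normcX sqr_normc_ReIm /=.
  by congr (_ * _ * _ * _)%:E; congr expR; ring.
have h0 t : 0 <= h t.
  by rewrite /h mulr_ge0 ?mulr_ge0 ?normc_ge0 ?powR_ge0 ?expR_ge0 ?sqrtr_ge0.
have G0 : 0 <= G.
  have q0 : 0 < (1 + (0 : R) ^+ 2) ^+ m by rewrite exprn_gt0// ltr_pwDl ?sqr_ge0.
  by have := le_trans (normc_ge0 _) (hf 0).2; rewrite (pmulr_lge0 _ q0).
have [K K0 hK] : exists2 K : R, 0 <= K & forall t, h t <= K / (1 + t ^+ 2).
  pose k := (Num.truncn (a + 1)).+1.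
  have [K1 K10 HK1] := expRN_pow_le R (k + m.+1).
  pose D := 2 * G * expR (rho ^+ 2 + 1) * (1 + (rho ^+ 2 + 1) ^+ k).
  have D0 : 0 <= D.
    have : 0 <= (rho ^+ 2 + 1) ^+ k by rewrite exprn_ge0// addr_ge0// sqr_ge0.
    by move=> q; rewrite /D mulr_ge0 ?addr_ge0// mulr_ge0 ?expR_ge0// mulr_ge0.
  exists (D * K1); first by rewrite mulr_ge0// ltW.
  move=> t; pose q := 1 + t ^+ 2.
  have q1 : 1 <= q by rewrite lerDl sqr_ge0.
  have q0 : 0 < q by exact: lt_le_trans q1.
  have yk : y t `^ (a + 1) <= (1 + (rho ^+ 2 + 1) ^+ k) * q ^+ k.
    apply: (@le_trans _ _ (1 + y t ^+ k)).
      apply: powR_le_1DX; [lra| |exact: ltW].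
      by apply: ltW; exact: truncnS_gt.
    rewrite mulrDl mul1r; apply: lerD; first exact: exprn_ege1.
    rewrite -exprMn lerXn2r// ?nnegrE ?(ltW (y0 t))//.
      by rewrite mulr_ge0 ?(ltW q0)// addr_ge0// sqr_ge0.
    rewrite /q /y; have := mulr_ge0 (sqr_ge0 rho) (sqr_ge0 t).
    by move: (rho ^+ 2) (t ^+ 2) => p r; clear; lra.
  have -> : h t = 2 * expR (rho ^+ 2 - t ^+ 2) * (y t `^ (a + 1) * normc (F t)).
    have := powR_sqrt (a + 1 / 2) (y0 t).
    rewrite (_ : a + 1 / 2 + 1 / 2 = a + 1); last by field.
    by rewrite /h => <-; ring.
  rewrite ler_pdivlMr// -/q.
  have -> : expR (rho ^+ 2 - t ^+ 2) = expR (rho ^+ 2 + 1) * expR (- q).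
    by rewrite -expRD; congr expR; rewrite /q; ring.
  apply: (@le_trans _ _ (2 * (expR (rho ^+ 2 + 1) * expR (- q)) *
      ((1 + (rho ^+ 2 + 1) ^+ k) * q ^+ k * (G * q ^+ m)) * q)).
    apply: ler_wpM2r; first exact: ltW.
    apply: ler_wpM2l; first by rewrite mulr_ge0// mulr_ge0// expR_ge0.
    by apply: ler_pM => //; [exact: powR_ge0|exact: normc_ge0|exact: (hf t).2].
  have -> : 2 * (expR (rho ^+ 2 + 1) * expR (- q)) *
      ((1 + (rho ^+ 2 + 1) ^+ k) * q ^+ k * (G * q ^+ m)) * q =
      D * (q ^+ (k + m.+1) * expR (- q)).
    rewrite /D (exprD q) (exprSr q).
    by move: (q ^+ k) (q ^+ m) ((rho ^+ 2 + 1) ^+ k) => u v w'; ring.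
  by rewrite ler_wpM2l// HK1// ltW.
have mh : measurable_fun [set: R] h.
  have cF t : {for t, continuous (fun t => complex.Re (F t))} /\
              {for t, continuous (fun t => complex.Im (F t))}.
    apply: (@holo_cont_ver _ (fun s => f (- s ^+ 2)) rho t t); last by rewrite lexx.
    by move=> u _; exact: (hf u).1.
  have msq : measurable_fun [set: R] (fun t : R => t ^+ 2).
    by apply: continuous_measurable_fun => t; exact: exprn_continuous.
  have my : measurable_fun [set: R] y by apply: measurable_funD.
  have msqrt : measurable_fun [set: R] (@Num.sqrt R).
    by apply: continuous_measurable_fun; exact: sqrt_continuous.
  have mn : measurable_fun [set: R] (fun t => normc (F t)).
    rewrite (_ : (fun t => _) = (@Num.sqrt R) \o
       (fun t => complex.Re (F t) ^+ 2 + complex.Im (F t) ^+ 2)); last first.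
      by apply/funext => t /=; case: (F t).
    apply: measurableT_comp => //; apply: measurable_funD.
      apply: (measurableT_comp msq); apply: continuous_measurable_fun => t; exact: (cF t).1.
    apply: (measurableT_comp msq); apply: continuous_measurable_fun => t; exact: (cF t).2.
  apply: measurable_funM; last first.
    by apply: measurable_funM => //; exact: measurableT_comp.
  apply: measurable_funM => //; apply: measurable_funM.
    by apply: measurableT_comp; [exact: measurable_expR|apply: measurable_funB].
  by apply: (measurableT_comp (measurable_powR _) my).
have cup : \bigcup_n `[- n.+1%:R, n.+1%:R]%classic = [set: R].
  apply/seteqP; split => // x _; exists (Num.truncn `|x|) => //=.
  by rewrite in_itv /= -ler_norml ltW// truncnS_gt.
have fin : (\int[lebesgue_measure]_t (h t)%:E <= (K * pi)%:E)%E.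
  rewrite -cup; apply: (@exhaustion_integral_le R h (fun t => K / (1 + t ^+ 2)) (fun t => K * atan t)
    (fun n => - n.+1%:R) (fun n => n.+1%:R)).
  - by move=> n; rewrite ge0_cp// ler0n.
  - move=> i j ij; rewrite subsetEset => x /=; rewrite !in_itv /= -!ler_norml.
    by move=> /le_trans; apply; rewrite ler_nat.
  - by move=> n t _; apply: drvZ; exact: is_derive1_atan.
  - move=> n; apply: (@derive_within_continuous _ _
      (fun t => K * (- (2 * t) / (1 + t ^+ 2) ^+ 2))) => t _.
    apply: drvZ; apply: (@drvV _ (fun t => 1 + t ^+ 2)); first by rewrite gt_eqF// ltr_pwDl ?sqr_ge0.
    apply: drv_eq; first by apply: drvD; [exact: drvC|apply: drv_X; exact: drv_id].
    by rewrite /= expr1 add0r mulr1.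
  - by move=> n t _; rewrite h0 hK.
  - by move=> n; exact: measurable_funTS.
  - move=> n; rewrite atanN mulrN opprK -mulrDr ler_wpM2l//.
    by have := atan_ltpi2 (n.+1%:R : R); lra.
have ge0 : (0 <= \int[lebesgue_measure]_t (h t)%:E)%E.
  by apply: integral_ge0 => t _; rewrite lee_fin.
exists (fine (\int[lebesgue_measure]_t (h t)%:E)%E); first exact: fine_ge0.
by rewrite E fineK// ge0_fin_numE// (le_lt_trans fin)// ltry.
Qed.

Theorem theorem6p3 (R : realType) (alpha rho beta C : R) (f : R[i] -> R[i])
    (halpha : -1 < alpha) (hrho : 0 < rho) (hC : 0 < C)
    (hf : analytic_near f (parabola_interior rho `|` parabola rho))
    (hgrowth : exists M : R, forall z : R[i],
       parabola_interior rho z -> M <= normc z ->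
       normc (f z) <= C * normc z `^ beta) :
  exists K : nat -> R,
    [/\ forall n, 0 < K n,
        exists B : R, forall n, K n <= B,
        (K n)%:E @[n --> \oo] -->
          arc_length_integral (parabola_path rho)
            (fun z => normc (cexp (- z) * cpow (- z) (alpha + 1 / 2) * f z)) &
        forall n,
          (forall x w : 'I_n.+1 -> R, gauss_laguerre_rule alpha x w ->
             normc (laguerre_integral alpha f - quadrature x w f)
               <= K n * expR (- (4 * rho * Num.sqrt n%:R))) /\
          (forall x w : 'I_n.+1 -> R, gauss_laguerre_radau_rule alpha x w ->
             normc (laguerre_integral alpha f - quadrature x w f)
               <= K n * expR (- (4 * rho * Num.sqrt n%:R)))].
Proof.
have [G [m [hs hbox]]] := strip_hypotheses hrho hC hf hgrowth.
have hr t : - rho <= complex.Re (rho +i* t) <= rho.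
  by rewrite /= lexx andbT; lra.
have [A A0 EA] := arc_length_integral_fin halpha hrho (fun t => hs _ (hr t)).
(* The Gauss rule is the case e = 0 and the Radau rule the case e = 1. *)
have [bG [bG0 HG LG]] := rule_bound halpha (leq0n 1) hrho hs hbox.
have [bR [bR0 HR LR]] := rule_bound halpha (leqnn 1) hrho hs hbox.
pose E n : R := expR (- (4 * rho * Num.sqrt n%:R)).
have E0 n : 0 < E n by exact: expR_gt0.
(* The middle term bounds both errors multiplied by e^{4 rho sqrt n} and tends to 0; the last term
   keeps [K n] positive even if [A = 0]. *)
pose K n : R := A + (bG n + bR n) / E n + n.+1%:R^-1.
have i0 n : 0 < n.+1%:R^-1 :> R by rewrite invr_gt0.
have q0 n : 0 <= (bG n + bR n) / E n by rewrite divr_ge0 ?addr_ge0 ?(ltW (E0 n)).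
have K0 n : 0 < K n by rewrite ltr_wpDl ?addr_ge0.
have cK : K n @[n --> \oo] --> A.
  apply/cvgrPdist_le => eta eta0.
  have e3 : 0 < eta / 3 by exact: divr_gt0.
  have [n1 H1] := LG _ e3; have [n2 H2] := LR _ e3.
  near=> n.
  have h1 : (n1 <= n)%N by near: n; exact: nbhs_infty_ge.
  have h2 : (n2 <= n)%N by near: n; exact: nbhs_infty_ge.
  have h3 : n.+1%:R^-1 < eta / 3 by near: n; exact: (near_infty_natSinv_lt (PosNum e3)).
  have -> : A - K n = - ((bG n + bR n) / E n + n.+1%:R^-1) by rewrite /K -addrA opprD addNKr.
  rewrite normrN ger0_norm; last by rewrite addr_ge0 ?(ltW (i0 n)).
  rewrite mulrDl.
  have k1 : bG n / E n <= eta / 3 by rewrite ler_pdivrMr//; exact: H1.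
  have k2 : bR n / E n <= eta / 3 by rewrite ler_pdivrMr//; exact: H2.
  rewrite (_ : eta = eta / 3 + eta / 3 + eta / 3); last by field.
  by apply: lerD; [exact: lerD|exact: ltW].
exists K; split => //.
- have /cvgrPdist_le/(_ 1 ltr01)[n0 _ H] := cK.
  (* From [n0] on, [K n <= A + 1]; each earlier value is at most the sum of the positive terms
     before [n0]. *)
  exists (A + 1 + \sum_(i < n0) K i) => n.
  have S0 : 0 <= \sum_(i < n0) K i by rewrite sumr_ge0// => i _; exact: ltW.
  have [nn|nn] := leqP n0 n.
    have := H n nn; rewrite ler_distlC => /andP[_ h]; apply: le_trans h _.
    by rewrite lerDl.
  apply: (@le_trans _ _ (\sum_(i < n0) K i)); last by rewrite lerDr; lra.
  rewrite (bigD1 (Ordinal nn))//= lerDl sumr_ge0// => i _; exact: ltW.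
- by rewrite EA; apply: cvg_EFin => //; exact: nearW.
move=> n; have KE b : b <= bG n + bR n -> b <= K n * E n.
  move=> hb; apply: (@le_trans _ _ ((bG n + bR n) / E n * E n)).
    by rewrite divfK// gt_eqF.
  by rewrite ler_pM2r// /K -addrA addrCA lerDl addr_ge0// ltW.
split => [x w [hx rx]|x w [hx _ rx]]; apply: KE.
  apply: (@le_trans _ _ (bG n)); last by rewrite lerDl.
  by apply: HG => // k; rewrite expr0 mul1r subn0 addr0; exact: rx.
apply: (@le_trans _ _ (bR n)); last by rewrite lerDr.
by apply: HR => // k; rewrite expr1 subn1; exact: rx.
Unshelve. all: by end_near.
Qed.
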